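(* Let $n=2$, $R$ a domain containing $\mathbb{Z}$ with field of fractions $K$, and $f\in R[x_1,x_2]$ a coordinate of $K[x_1,x_2]$ over $K$. Then $f$ is of one of the types I through V if and only if the following three conditions hold: (A) $H(f)\neq\{\mathrm{id}_{R[\mathbf{x}]}\}$; (B) $f$ is tamely reduced over $R$; (C) $\deg_{x_1}f\ge\deg_{x_2}f\ge1$.
   Context: $V(R)$ is the set of $\alpha/\beta\in K^\times$ with $\alpha,\beta\in R\setminus\{0\}$, $\alpha R+\beta R=R$. $\mathrm{Aff}(K,\mathbf{x})$: affine automorphisms of $K[\mathbf{x}]$ (generated by those with $\deg\phi(x_i)=1$). $\mathrm{T}(R,\mathbf{x})$: subgroup of $\mathrm{Aut}(R[\mathbf{x}]/R)$ generated by affine and elementary (fixing all variables but one) automorphisms. $H(f)=\mathrm{Aut}(R[\mathbf{x}]/R[f])\cap\mathrm{T}(R,\mathbf{x})$. $f\in R[\mathbf{x}]\setminus R$ is tamely reduced over $R$ if $\deg_{x_1}\tau(f)+\deg_{x_2}\tau(f)\ge\deg_{x_1}f+\deg_{x_2}f$ for all $\tau\in\mathrm{T}(R,\mathbf{x})$. Types for $f\in R[\mathbf{x}]$: (I) $f=ax_2+g$ with $a\in R\setminus\{0\}$, $g\in R[x_1]$, $\deg g\ge2$, leading coefficient of $g$ not in $aR$. (II) $f=a'x_1+h$ with $a'\in K^\times$, $h\in K[\mathbf{x}]$, such that there exist $\zeta\in R\setminus\{1\}$, $e\ge2$ with $\zeta^e=1$ and $a'\in R':=R[(\zeta-1)^{-1}]$,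 and there is $g\in R[x_1]$ with $\deg g\ge2$ whose leading coefficient is not in $(\zeta-1)R$, with $h\in R'[y_2^e]\setminus R'$ where $y_2=(\zeta-1)x_2+g$. (III) $f=a_1x_1+a_2x_2+b$ with $a_1,a_2\in R\setminus\{0\}$, $b\in R$, $a_1/a_2\notin V(R)$. (IV) $f=a\tau(x_1)^2+\tau(x_2)$ with $a\in R\setminus\{0\}$, $\tau\in\mathrm{Aff}(K,\mathbf{x})$, $\tau(x_1)=\alpha_1x_1+\alpha_2x_2$, $\alpha_1,\alpha_2\in K^\times$, $\alpha_1/\alpha_2\notin V(R)$. (V) $f=\tau(x_2+g')$ with $\tau\in\mathrm{Aff}(K,\mathbf{x})$, $g'\in K[x_1]$, $\deg g'\ge3$, such that (a) $g'\in x_1^{e'}K[x_1^{e'}]$ for some $e'\ge2$; (b) writing $\tau(x_1)=\alpha_1x_1+\alpha_2x_2+\alpha_0$, $\tau(x_2)=\beta_1x_1+\beta_2x_2+\beta_0$, we have $\alpha_1,\alpha_2\ne0$ and $\alpha_1/\alpha_2\notin V(R)$; (c) there is $\zeta'\in R\setminus\{1\}$ with $(\zeta')^{e'}=1$ and $(\zeta'-1)\alpha_i\beta_j/(\alpha_1\beta_2-\alpha_2\beta_1)\in R$ for $i=0,1,2$, $j=1,2$. *)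

(* Defs.v *)
(* Bivariate polynomials R[x1,x2] are represented as
   {poly {poly R}}: the outer variable is x2, the inner variable is x1. *)
From HB Require Import structures.
From mathcomp Require Import all_boot all_order all_algebra fraction.
Set Implicit Arguments. Unset Strict Implicit. Unset Printing Implicit Defensive.
Import Order.TTheory GRing.Theory Num.Theory.
Local Open Scope ring_scope.

Notation P2 S := ({poly {poly S}}).

Section Bivariate.
Variable S : comNzRingType.
Local Notation P2 := (P2 S).
Definition X1 : P2 := ('X)%:P.
Definition X2 : P2 := 'X.
Definition cst (c : S) : P2 := c%:P%:P.

Definition comp2 (p g1 g2 : P2) : P2 :=
  \sum_(i < size p) (\sum_(j < size p`_i) cst ((p`_i)`_j) * g1 ^+ j) * g2 ^+ i.

(* an S-algebra endomorphism phi of S[x1,x2], given by (phi(x1), phi(x2)) *)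
Definition endo := (P2 * P2)%type.
Definition id_endo : endo := (X1, X2).
Definition app_endo (phi : endo) (p : P2) : P2 := comp2 p phi.1 phi.2.
Definition comp_endo (phi psi : endo) : endo := (app_endo phi psi.1, app_endo phi psi.2).
Definition is_inv (psi phi : endo) : Prop :=
  comp_endo phi psi = id_endo /\ comp_endo psi phi = id_endo.
Definition is_aut (phi : endo) : Prop := exists psi, is_inv psi phi.

Definition affine_form (p : P2) : Prop :=
  exists a b c : S, (a != 0 \/ b != 0) /\ p = cst a * X1 + cst b * X2 + cst c.
Definition is_affine (phi : endo) : Prop :=
  is_aut phi /\ affine_form phi.1 /\ affine_form phi.2.
Definition is_elementary (phi : endo) : Prop :=
  is_aut phi /\ (phi.1 = X1 \/ phi.2 = X2).

Inductive tame : endo -> Prop :=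
| tame_gen phi : is_affine phi \/ is_elementary phi -> tame phi
| tame_comp phi psi : tame phi -> tame psi -> tame (comp_endo phi psi)
| tame_inv phi psi : tame phi -> is_inv psi phi -> tame psi.

Definition degx2 (p : P2) : nat := (size p).-1.
Definition degx1 (p : P2) : nat := (\max_(i < size p) (size (nth 0%R p i)).-1)%N.

Definition coordinate (f : P2) : Prop := exists phi, is_aut phi /\ phi.1 = f.

Definition H_nontrivial (f : P2) : Prop :=
  exists phi, tame phi /\ app_endo phi f = f /\ phi <> id_endo.

Definition tamely_reduced (f : P2) : Prop :=
  (~ exists c, f = cst c) /\
  forall tau, tame tau ->
    (degx1 f + degx2 f <= degx1 (app_endo tau f) + degx2 (app_endo tau f))%N.

Definition in_ideal (a x : S) : Prop := exists r, x = a * r.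
End Bivariate.

Arguments X1 {S}. Arguments X2 {S}.

Section Types.
Variable R : idomainType.
Local Notation K := {fraction R}.
Local Notation "x %:F" := (@FracField.tofrac R x).

Definition toK (f : P2 R) : P2 K := map_poly (map_poly (@FracField.tofrac R)) f.

Definition in_R (c : K) : Prop := exists r : R, c = r%:F.
Definition inRp (zeta : R) (c : K) : Prop :=
  exists (r : R) (k : nat), c = r%:F / (zeta%:F - 1) ^+ k.
Definition inV (c : K) : Prop :=
  exists alpha beta : R, [/\ alpha != 0, beta != 0,
    (exists u v : R, alpha * u + beta * v = 1) & c = alpha%:F / beta%:F].

Definition typeI (f : P2 R) : Prop :=
  exists (a : R) (g : {poly R}),
    [/\ a != 0, (2 <= (size g).-1)%N, ~ in_ideal a (lead_coef g)
      & f = cst a * X2 + g%:P].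

Definition typeII (f : P2 R) : Prop :=
  exists (a' : K) (h : P2 K),
    a' != 0 /\ toK f = cst a' * X1 + h /\
    exists (zeta : R) (e : nat),
      [/\ zeta != 1, (2 <= e)%N, zeta ^+ e = 1, inRp zeta a' &
      exists g : {poly R},
        [/\ (2 <= (size g).-1)%N, ~ in_ideal (zeta - 1) (lead_coef g) &
        let y2 : P2 K := toK (cst (zeta - 1) * X2 + g%:P) in
        (exists q : {poly K}, (forall i, inRp zeta q`_i) /\
           h = (map_poly (fun c : K => cst c) q).[y2 ^+ e]) /\
        ~ (exists c : K, inRp zeta c /\ h = cst c)]].

Definition typeIII (f : P2 R) : Prop :=
  exists a1 a2 b : R,
    [/\ a1 != 0, a2 != 0, f = cst a1 * X1 + cst a2 * X2 + cst b
      & ~ inV (a1%:F / a2%:F)].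

Definition typeIV (f : P2 R) : Prop :=
  exists (a : R) (tau : endo K) (alpha1 alpha2 : K),
    [/\ a != 0, is_affine tau, tau.1 = cst alpha1 * X1 + cst alpha2 * X2,
      [/\ alpha1 != 0, alpha2 != 0 & ~ inV (alpha1 / alpha2)]
      & toK f = cst a%:F * tau.1 ^+ 2 + tau.2].

Definition typeV (f : P2 R) : Prop :=
  exists (tau : endo K) (g' : {poly K}),
    [/\ is_affine tau, (3 <= (size g').-1)%N,
      toK f = app_endo tau (X2 + g'%:P) &
    exists (alpha0 alpha1 alpha2 beta0 beta1 beta2 : K),
      [/\ tau.1 = cst alpha1 * X1 + cst alpha2 * X2 + cst alpha0,
          tau.2 = cst beta1 * X1 + cst beta2 * X2 + cst beta0,
          [/\ alpha1 != 0, alpha2 != 0 & ~ inV (alpha1 / alpha2)] &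
      exists e' : nat,
        [/\ (2 <= e')%N,
            (exists q : {poly K}, g' = 'X^e' * (q \Po 'X^e')) &
            exists zeta' : R,
              [/\ zeta' != 1, zeta' ^+ e' = 1 &
                forall (alpha beta : K),
                  alpha \in [:: alpha0; alpha1; alpha2] ->
                  beta \in [:: beta1; beta2] ->
                  in_R ((zeta'%:F - 1) * alpha * beta /
                       (alpha1 * beta2 - alpha2 * beta1))]]]].
End Types.

(* Main.v *)
(** Tame automorphisms factor into affine automorphisms and shears [x2 |-> x2 + g(x1)], and a
    ping-pong argument on weighted top forms controls the degree of the image of a polynomial
    along such a factorisation. For [F] of least degree in its tame orbit it shows that, up to an
    affine change of variables, every tame automorphism fixing [F] is affine or triangular.

    Over [K], complete the coordinate [F] to an automorphism [(F, P)]; in these coordinates an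
    automorphism fixing [F] becomes [(x1, m * x2 + s(x1))], and comparing degrees in [x2] puts [F]
    in normal form when the automorphism is triangular or affine. Over [R], minimality of the
    degree then leaves types I and II (triangular case) or I, III, IV and V (affine case).

    Conversely each type is fixed by an explicit tame automorphism, and its top form does not
    vanish on unimodular vectors (types III-V) or at elements of [R] (types I, II). With this
    non-vanishing the ping-pong gives tame reducedness, and moreover that a tame automorphism not
    raising [deg_x1 + deg_x2] is affine, respectively triangular. Hence, when [f] itself is only
    tamely reduced, the information on the stabilizer of a representative of least degree
    transfers back to the stabilizer of [f]. *)
Require Import Defs.
From HB Require Import structures.
From mathcomp Require Import all_boot all_order all_algebra fraction.
From mathcomp Require Import zify ring.
From Stdlib Require Import Classical.
Set Implicit Arguments. Unset Strict Implicit. Unset Printing Implicit Defensive.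
Import Order.TTheory GRing.Theory Num.Theory.
Local Open Scope ring_scope.

(** * Endomorphisms, affine and triangular automorphisms *)

Section Evaluation.
Variable S : comNzRingType.
Implicit Types (phi psi chi : endo S) (p q : P2 S).

(** Total degree, unlike [degx1 + degx2], is invariant under affine automorphisms, so along a
    reduced word only non-linear shears can change it. The stabilizer argument therefore minimises
    total degree, and the two notions of minimality have to be reconciled. This is why the types are
    recognised from the weak conditions [locmin] and [affine_minimal], which hold both for [f] and
    for a suitable representative of least total degree, and why the easy direction is used inside
    the hard one: once the representative has a type, its non-vanishing top form restricts the
    automorphism carrying it to [f].

    Two points over [K] need care. A linear part need not have an eigenvector, since [K] is not
    algebraically closed; an invariant linear form is extracted instead from the degrees of [x1] and
    [x2] in the coordinates [(F, P)]. And degree two stands apart: a translation of [x1] changes a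
    quadratic polynomial only by a linear term, which an affine map can absorb (type IV). From
    degree three on characteristic zero forbids this, and only multiplication by a root of unity
    survives (type V). *)

Definition ev phi : P2 S -> P2 S :=
  horner_eval phi.2 \o map_poly (horner_eval phi.1 \o map_poly (polyC \o polyC)).

Lemma app_endoE phi : app_endo phi =1 ev phi.
Proof.
move=> p; rewrite /app_endo /comp2 /ev [RHS]/= {1}/horner_eval.
rewrite (horner_coef_wide _ (size_poly _ _)); apply: eq_bigr => i _.
rewrite coef_map [X in _ = X * _]/= {1}/horner_eval; congr (_ * _).
rewrite (horner_coef_wide _ (size_poly _ _)); apply: eq_bigr => j _.
by rewrite coef_map.
Qed.

Lemma app_endo_is_zmod_morphism phi : zmod_morphism (app_endo phi).
Proof. by move=> p q; rewrite !app_endoE /ev rmorphB. Qed.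

Lemma app_endo_is_monoid_morphism phi : monoid_morphism (app_endo phi).
Proof.
split=> [|p q]; first by rewrite app_endoE /ev rmorph1.
by rewrite !app_endoE /ev rmorphM.
Qed.

HB.instance Definition _ phi :=
  GRing.isZmodMorphism.Build (P2 S) (P2 S) (app_endo phi) (app_endo_is_zmod_morphism phi).
HB.instance Definition _ phi :=
  GRing.isMonoidMorphism.Build (P2 S) (P2 S) (app_endo phi) (app_endo_is_monoid_morphism phi).

Lemma cst_is_zmod_morphism : zmod_morphism (@cst S).
Proof. by move=> a b; rewrite /cst !raddfB. Qed.
Lemma cst_is_monoid_morphism : monoid_morphism (@cst S).
Proof. by split=> [|a b]; rewrite /cst ?rmorph1 // !rmorphM. Qed.
HB.instance Definition _ :=
  GRing.isZmodMorphism.Build S (P2 S) (@cst S) cst_is_zmod_morphism.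
HB.instance Definition _ :=
  GRing.isMonoidMorphism.Build S (P2 S) (@cst S) cst_is_monoid_morphism.

Lemma app_cst phi c : app_endo phi (cst c) = cst c.
Proof. by rewrite app_endoE /ev /= map_polyC /= /horner_eval hornerC map_polyC /= hornerC. Qed.

Lemma app_X1 phi : app_endo phi X1 = phi.1.
Proof. by rewrite app_endoE /ev /= map_polyC /= /horner_eval hornerC map_polyX hornerX. Qed.

Lemma app_X2 phi : app_endo phi X2 = phi.2.
Proof. by rewrite app_endoE /ev /= map_polyX /horner_eval hornerX. Qed.

Lemma app_polyC phi (g : {poly S}) :
  app_endo phi g%:P = (map_poly (@cst S) g).[phi.1].
Proof.
by rewrite app_endoE /ev /= map_polyC /= /horner_eval hornerC.
Qed.

Lemma app_endo_ext phi psi :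
  phi.1 = psi.1 -> phi.2 = psi.2 -> app_endo phi =1 app_endo psi.
Proof. by move=> e1 e2 p; rewrite /app_endo e1 e2. Qed.

Lemma P2_rmorph_ext (T : nzRingType) (u v : {rmorphism P2 S -> T}) :
  (forall c, u (cst c) = v (cst c)) -> u X1 = v X1 -> u X2 = v X2 -> u =1 v.
Proof.
move=> ec e1 e2; have eC (g : {poly S}) : u g%:P = v g%:P.
  elim/poly_ind: g => [|g c IH]; first by rewrite !rmorph0.
  by rewrite polyCD polyCM !rmorphD !rmorphM /= IH e1 ec.
elim/poly_ind => [|g c IH]; first by rewrite !rmorph0.
by rewrite !rmorphD !rmorphM /= IH e2 eC.
Qed.

Lemma app_comp phi psi p :
  app_endo (comp_endo phi psi) p = app_endo phi (app_endo psi p).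
Proof.
pose u : {rmorphism P2 S -> P2 S} := app_endo phi \o app_endo psi.
apply: (P2_rmorph_ext (u := app_endo (comp_endo phi psi)) (v := u)) => [c||] /=.
- by rewrite !app_cst.
- by rewrite !app_X1.
- by rewrite !app_X2.
Qed.

Lemma app_id p : app_endo (id_endo S) p = p.
Proof.
apply: (P2_rmorph_ext (u := app_endo (id_endo S)) (v := idfun)) => [c||] /=.
- by rewrite app_cst.
- by rewrite app_X1.
- by rewrite app_X2.
Qed.

Lemma comp_endoA phi psi chi :
  comp_endo phi (comp_endo psi chi) = comp_endo (comp_endo phi psi) chi.
Proof. by rewrite /comp_endo /= -!app_comp. Qed.

Lemma comp_id_endo phi : comp_endo (id_endo S) phi = phi.
Proof. by rewrite /comp_endo !app_id; case: phi. Qed.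

Lemma comp_endo_id phi : comp_endo phi (id_endo S) = phi.
Proof. by rewrite /comp_endo app_X1 app_X2; case: phi. Qed.

Lemma is_inv_sym phi psi : is_inv psi phi -> is_inv phi psi.
Proof. by case. Qed.

Lemma is_inv_uniq phi psi chi : is_inv psi phi -> is_inv chi phi -> psi = chi.
Proof.
move=> [_ ip] [ic _].
by rewrite -[psi]comp_endo_id -ic comp_endoA ip comp_id_endo.
Qed.

Lemma is_inv_comp phi psi phi' psi' :
  is_inv phi' phi -> is_inv psi' psi ->
  is_inv (comp_endo psi' phi') (comp_endo phi psi).
Proof.
move=> [h1 h2] [k1 k2]; split.
  by rewrite -comp_endoA (comp_endoA psi) k1 comp_id_endo.
by rewrite -comp_endoA (comp_endoA phi') h2 comp_id_endo.
Qed.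

Lemma app_inv phi psi p : is_inv psi phi -> app_endo psi (app_endo phi p) = p.
Proof. by move=> [_ e]; rewrite -app_comp e app_id. Qed.

Lemma is_aut_comp phi psi : is_aut phi -> is_aut psi -> is_aut (comp_endo phi psi).
Proof. by move=> [p hp] [q hq]; exists (comp_endo q p); apply: is_inv_comp. Qed.

Lemma app_polyX1 phi (g : {poly S}) :
  phi.1 = X1 -> app_endo phi g%:P = g%:P.
Proof.
move=> e; elim/poly_ind: g => [|g c IH]; first by rewrite rmorph0.
by rewrite polyCD polyCM rmorphD rmorphM /= IH app_X1 e app_cst.
Qed.

Lemma app_polyC1 phi (g q : {poly S}) :
  phi.1 = q%:P -> app_endo phi g%:P = (g \Po q)%:P.
Proof.
move=> e; elim/poly_ind: g => [|g c IH]; first by rewrite comp_poly0 rmorph0.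
rewrite polyCD polyCM rmorphD rmorphM /= IH app_X1 e app_cst.
by rewrite comp_polyD comp_polyM comp_polyX comp_polyC polyCD polyCM.
Qed.

Lemma app_triangular phi p :
  phi.1 = X1 -> app_endo phi p = p \Po phi.2.
Proof.
move=> e; elim/poly_ind: p => [|p c IH]; first by rewrite comp_poly0 rmorph0.
rewrite rmorphD rmorphM /= IH app_X2 app_polyX1 //.
by rewrite comp_polyD comp_polyM comp_polyX comp_polyC.
Qed.

End Evaluation.

Lemma pair_congr (T U : Type) (a a' : T) (b b' : U) : a = a' -> b = b' -> (a, b) = (a', b').
Proof. by move=> -> ->. Qed.

Section AffineForms.
Variable S : comNzRingType.
Implicit Types (phi psi : endo S) (p q : P2 S).

Definition afm (a1 a2 a0 : S) : P2 S := cst a1 * X1 + cst a2 * X2 + cst a0.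

Lemma afmE a1 a2 a0 : afm a1 a2 a0 = a2%:P *: 'X + (a1 *: 'X + a0%:P)%:P.
Proof. by rewrite /afm /cst /X1 /X2 -!mul_polyC polyCD polyCM; ring. Qed.

Lemma coef_afm a1 a2 a0 i j :
  (afm a1 a2 a0)`_j`_i =
  if (i, j) == (1, 0)%N then a1 else if (i, j) == (0, 1)%N then a2
  else if (i, j) == (0, 0)%N then a0 else 0.
Proof.
rewrite afmE coefD coefZ coefX coefC.
case: j => [|[|j]] /=; rewrite ?mulr0 ?mulr1 ?add0r ?addr0 ?coef0 ?coefC ?xpair_eqE ?andbF //.
  rewrite coefD coefZ coefX coefC.
  by case: i => [|[|i]] //=; rewrite ?mulr0 ?mulr1 ?add0r ?addr0.
by case: i => [|[|i]] //=; rewrite ?mulr0 ?mulr1 ?add0r ?addr0.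
Qed.

Lemma afm_coef1 a1 a2 a0 : (afm a1 a2 a0)`_0`_1 = a1. Proof. exact: coef_afm. Qed.
Lemma afm_coef2 a1 a2 a0 : (afm a1 a2 a0)`_1`_0 = a2. Proof. exact: coef_afm. Qed.
Lemma afm_coef0 a1 a2 a0 : (afm a1 a2 a0)`_0`_0 = a0. Proof. exact: coef_afm. Qed.

Lemma afm_inj a1 a2 a0 b1 b2 b0 :
  afm a1 a2 a0 = afm b1 b2 b0 -> [/\ a1 = b1, a2 = b2 & a0 = b0].
Proof.
move=> e; split.
- by rewrite -(afm_coef1 a1 a2 a0) e afm_coef1.
- by rewrite -(afm_coef2 a1 a2 a0) e afm_coef2.
- by rewrite -(afm_coef0 a1 a2 a0) e afm_coef0.
Qed.

Lemma afm_congr a1 a2 a0 b1 b2 b0 :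
  a1 = b1 -> a2 = b2 -> a0 = b0 -> afm a1 a2 a0 = afm b1 b2 b0.
Proof. by move=> -> -> ->. Qed.

Lemma X1_afm : X1 = afm 1 0 0.
Proof. by rewrite /afm !rmorph1 !rmorph0; ring. Qed.

Lemma X2_afm : X2 = afm 0 1 0.
Proof. by rewrite /afm !rmorph1 !rmorph0; ring. Qed.

Lemma afm_pair_congr a1 a2 a0 a1' a2' a0' b1 b2 b0 b1' b2' b0' :
  a1 = a1' -> a2 = a2' -> a0 = a0' -> b1 = b1' -> b2 = b2' -> b0 = b0' ->
  (afm a1 a2 a0, afm b1 b2 b0) = (afm a1' a2' a0', afm b1' b2' b0').
Proof. by move=> -> -> -> -> -> ->. Qed.

Lemma id_endoE : id_endo S = (afm 1 0 0, afm 0 1 0).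
Proof. by rewrite -X1_afm -X2_afm. Qed.

Lemma app_afm_gen phi (p q r : S) : app_endo phi (afm p q r) = cst p * phi.1 + cst q * phi.2 + cst r.
Proof. by rewrite /afm !rmorphD !rmorphM /= !app_cst app_X1 app_X2. Qed.

Lemma app_afm (a1 a2 a0 b1 b2 b0 p q r : S) :
  app_endo (afm a1 a2 a0, afm b1 b2 b0) (afm p q r) =
  afm (p * a1 + q * b1) (p * a2 + q * b2) (p * a0 + q * b0 + r).
Proof. by rewrite app_afm_gen /afm /= !rmorphD !rmorphM /=; ring. Qed.

(* The chain rule at the origin. *)
Lemma chain_rule0 (p : P2 S) (a b : S) : exists r u v, forall phi,
  phi.1`_0`_0 = a -> phi.2`_0`_0 = b ->
  [/\ (app_endo phi p)`_0`_0 = r,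
      (app_endo phi p)`_0`_1 = u * phi.1`_0`_1 + v * phi.2`_0`_1 &
      (app_endo phi p)`_1`_0 = u * phi.1`_1`_0 + v * phi.2`_1`_0].
Proof.
pose good p := exists r u v, forall phi,
  phi.1`_0`_0 = a -> phi.2`_0`_0 = b ->
  [/\ (app_endo phi p)`_0`_0 = r,
      (app_endo phi p)`_0`_1 = u * phi.1`_0`_1 + v * phi.2`_0`_1 &
      (app_endo phi p)`_1`_0 = u * phi.1`_1`_0 + v * phi.2`_1`_0].
have gC c : good (cst c).
  exists c, 0, 0 => phi _ _; by rewrite app_cst /cst; split; rewrite ?mul0r ?addr0 coefC ?coefC ?coef0.
have gX1 : good X1 by exists a, 1, 0 => phi ha hb; rewrite app_X1; split=> //; ring.
have gX2 : good X2 by exists b, 0, 1 => phi ha hb; rewrite app_X2; split=> //; ring.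
have gD p1 p2 : good p1 -> good p2 -> good (p1 + p2).
  move=> [r [u [v h]]] [r' [u' [v' h']]].
  exists (r + r'), (u + u'), (v + v') => phi ha hb.
  have [e0 e1 e2] := h _ ha hb; have [k0 k1 k2] := h' _ ha hb.
  by rewrite rmorphD /= !coefD e0 e1 e2 k0 k1 k2; split; ring.
have gM p1 p2 : good p1 -> good p2 -> good (p1 * p2).
  move=> [r [u [v h]]] [r' [u' [v' h']]].
  exists (r * r'), (u * r' + r * u'), (v * r' + r * v') => phi ha hb.
  have [e0 e1 e2] := h _ ha hb; have [k0 k1 k2] := h' _ ha hb.
  rewrite rmorphM /= !coefM !big_ord_recr !big_ord0 /= !add0r coefD !coefM.
  by rewrite !big_ord_recr !big_ord0 /= !add0r e0 e1 e2 k0 k1 k2; split; ring.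
have gP (g : {poly S}) : good g%:P.
  elim/poly_ind: g => [|g c IH]; first by have := gC 0; rewrite rmorph0.
  by rewrite polyCD polyCM; apply: gD; [exact: gM | exact: gC].
rewrite -/(good p); elim/poly_ind: p => [|q g IH]; first by have := gC 0; rewrite rmorph0.
by apply: gD; [exact: gM | exact: gP].
Qed.

End AffineForms.

Section Affine.
Variable S : idomainType.
Implicit Types (phi psi : endo S) (p q : P2 S).

Definition aff phi := exists a1 a2 a0 b1 b2 b0 : S,
  phi = (afm a1 a2 a0, afm b1 b2 b0) /\ a1 * b2 - a2 * b1 \is a GRing.unit.

Lemma aff_id : aff (id_endo S).
Proof.
exists 1, 0, 0, 0, 1, 0; rewrite -X1_afm -X2_afm; split=> //.
by rewrite mulr1 mulr0 subr0 unitr1.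
Qed.

Lemma aff_comp phi psi : aff phi -> aff psi -> aff (comp_endo phi psi).
Proof.
move=> [a1 [a2 [a0 [b1 [b2 [b0 [-> u]]]]]]] [c1 [c2 [c0 [d1 [d2 [d0 [-> v]]]]]]].
rewrite /comp_endo /= !app_afm; do 6 eexists; split; first by reflexivity.
rewrite (_ : _ - _ = (a1 * b2 - a2 * b1) * (c1 * d2 - c2 * d1)); last by ring.
by rewrite unitrM u v.
Qed.

Lemma aff_inv phi : aff phi -> exists2 psi, is_inv psi phi & aff psi.
Proof.
move=> [a1 [a2 [a0 [b1 [b2 [b0 [-> u]]]]]]].
set d := a1 * b2 - a2 * b1 in u; have := mulrV u; set e := d^-1 => du.
exists (afm (b2 * e) (- a2 * e) ((a2 * b0 - b2 * a0) * e),
        afm (- b1 * e) (a1 * e) ((b1 * a0 - a1 * b0) * e)).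
  split; rewrite id_endoE /comp_endo [LHS]/= !app_afm; apply: afm_pair_congr.
  all: try by rewrite /d; ring.
  all: try by rewrite -du /d; ring.
    by transitivity (a0 - a0 * (d * e)); [rewrite /d; ring | rewrite du; ring].
  by transitivity (b0 - b0 * (d * e)); [rewrite /d; ring | rewrite du; ring].
do 6 eexists; split; first by reflexivity.
rewrite (_ : _ - _ = e * (d * e)); last by rewrite /d; ring.
by rewrite du mulr1 unitrV.
Qed.

Lemma afm_affine_form a1 a2 a0 : a1 != 0 \/ a2 != 0 -> @affine_form S (afm a1 a2 a0).
Proof. by move=> h; exists a1, a2, a0. Qed.

Lemma affP phi : is_affine phi <-> aff phi.
Proof.
split.
  case: phi => p q [[psi [h _]]] /= [[a1 [a2 [a0 [_ ep]]]] [b1 [b2 [b0 [_ eq]]]]].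
  have {}ep : p = afm a1 a2 a0 by []. have {}eq : q = afm b1 b2 b0 by [].
  exists a1, a2, a0, b1, b2, b0; split; first by rewrite ep eq.
  (* Differentiating [psi(p, q) = (x1, x2)] at the origin yields a left inverse of the matrix of
     [phi], whose determinant is therefore a unit. *)
  have [r1 [u1 [v1 h1]]] := chain_rule0 psi.1 a0 b0.
  have [r2 [u2 [v2 h2]]] := chain_rule0 psi.2 a0 b0.
  have k1 : p`_0`_0 = a0 by rewrite ep afm_coef0.
  have k2 : q`_0`_0 = b0 by rewrite eq afm_coef0.
  have {k1 k2 h1 h2} [[_ e1 e2] [_ e3 e4]] := (h1 (p, q) k1 k2, h2 (p, q) k1 k2).
  have i1 := congr1 fst h; have i2 := congr1 snd h.
  rewrite /= X1_afm in i1; rewrite /= X2_afm in i2.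
  have [p1 p2] : p`_0`_1 = a1 /\ p`_1`_0 = a2 by rewrite ep afm_coef1 afm_coef2.
  have [q1 q2] : q`_0`_1 = b1 /\ q`_1`_0 = b2 by rewrite eq afm_coef1 afm_coef2.
  rewrite /= p1 q1 i1 afm_coef1 in e1; rewrite /= p2 q2 i1 afm_coef2 in e2.
  rewrite /= p1 q1 i2 afm_coef1 in e3; rewrite /= p2 q2 i2 afm_coef2 in e4.
  apply/unitrPr; exists (u1 * v2 - v1 * u2).
  have <- : (u1 * a1 + v1 * b1) * (u2 * a2 + v2 * b2)
          - (u1 * a2 + v1 * b2) * (u2 * a1 + v2 * b1) = 1.
    by rewrite -e1 -e2 -e3 -e4; ring.
  by ring.
move=> h; have [psi inv _] := aff_inv h; split; first by exists psi.
case: h => [a1 [a2 [a0 [b1 [b2 [b0 [-> u]]]]]]] /=.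
have u0 : a1 * b2 - a2 * b1 != 0 by apply: contraTneq u => ->; rewrite unitr0.
split; apply: afm_affine_form.
  have [e1|] := eqVneq a1 0; last by left.
  by right; apply: contraNneq u0 => e2; rewrite e1 e2; apply/eqP; ring.
have [e1|] := eqVneq b1 0; last by left.
by right; apply: contraNneq u0 => e2; rewrite e1 e2; apply/eqP; ring.
Qed.

Definition swap : endo S := (X2, X1).

Lemma aff_swap : aff swap.
Proof.
exists 0, 1, 0, 1, 0, 0; rewrite -X1_afm -X2_afm; split=> //.
by rewrite mul0r mulr1 sub0r unitrN unitr1.
Qed.

Lemma swapK : is_inv swap swap.
Proof. by split; rewrite /comp_endo app_X1 app_X2. Qed.

Definition shear (g : {poly S}) : endo S := (X1, X2 + g%:P).

Lemma shear_comp (g h : {poly S}) : comp_endo (shear g) (shear h) = shear (g + h).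
Proof.
apply: pair_congr; first by rewrite app_X1.
by rewrite [LHS]rmorphD [X in X + _]app_X2 [X in _ + X]app_polyX1 // -addrA -polyCD.
Qed.

Lemma shear0 : shear 0 = id_endo S.
Proof. by rewrite /shear polyC0 addr0. Qed.

Lemma shear_inv (g : {poly S}) : is_inv (shear (- g)) (shear g).
Proof. by split; rewrite shear_comp ?addrN ?addNr shear0. Qed.

Lemma aff_shear (g : {poly S}) : (size g <= 2)%N -> aff (shear g).
Proof.
move=> sg; exists 1, 0, 0, g`_1, 1, g`_0; split; last by rewrite mulr1 mul0r subr0 unitr1.
apply: pair_congr; first exact: X1_afm.
rewrite afmE scale1r; congr (_ + _%:P).
apply/polyP => -[|[|i]]; rewrite coefD coefZ coefX coefC /= ?mulr0 ?mulr1 ?add0r ?addr0 //.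
by rewrite nth_default // (leq_trans sg).
Qed.

Definition trg (u c v : S) (g : {poly S}) : endo S := (afm u 0 c, cst v * X2 + g%:P).

Definition triangular phi := exists u c v (g : {poly S}),
  [/\ u \is a GRing.unit, v \is a GRing.unit & phi = trg u c v g].

Lemma afm0E u c : afm u 0 c = (u *: 'X + c%:P)%:P :> P2 S.
Proof. by rewrite afmE polyC0 scale0r add0r. Qed.

Lemma app_linX2 phi (v : S) (g : {poly S}) :
  app_endo phi (cst v * X2 + g%:P) = cst v * phi.2 + app_endo phi g%:P.
Proof. by rewrite rmorphD rmorphM /= app_cst app_X2. Qed.

Lemma trg_congr u c v (g : {poly S}) u' c' v' (g' : {poly S}) :
  u = u' -> c = c' -> v = v' -> g = g' -> trg u c v g = trg u' c' v' g'.
Proof. by move=> -> -> -> ->. Qed.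

Lemma trg_comp u c v (g : {poly S}) u' c' v' (g' : {poly S}) :
  comp_endo (trg u c v g) (trg u' c' v' g') =
  trg (u' * u) (u' * c + c') (v' * v) (v' *: g + (g' \Po (u *: 'X + c%:P))).
Proof.
have e : app_endo (trg u c v g) g'%:P = (g' \Po (u *: 'X + c%:P))%:P.
  by rewrite (@app_polyC1 _ _ _ (u *: 'X + c%:P)) //= afm0E.
apply: pair_congr.
  rewrite -[(trg u' c' v' g').1]/(afm u' 0 c') app_afm_gen.
  by rewrite -[(trg u c v g).1]/(afm u 0 c) /afm !rmorphD !rmorphM /= !rmorph0; ring.
rewrite -[(trg u' c' v' g').2]/(cst v' * X2 + g'%:P) app_linX2 e.
rewrite -[(trg u c v g).2]/(cst v * X2 + g%:P).
by rewrite polyCD -[v' *: g]mul_polyC polyCM rmorphM /= -/(cst v'); ring.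
Qed.

Lemma shearE (g : {poly S}) : shear g = trg 1 0 1 g.
Proof. by apply: pair_congr; rewrite ?X1_afm // rmorph1 mul1r. Qed.

Lemma id_trg : id_endo S = trg 1 0 1 0.
Proof. by rewrite -shearE shear0. Qed.

Lemma aff_trg u c v b1 b0 :
  (afm u 0 c, afm b1 v b0) = trg u c v (b1 *: 'X + b0%:P).
Proof. by rewrite [X in (_, X)]afmE -mul_polyC. Qed.

Lemma triangular_comp phi psi :
  triangular phi -> triangular psi -> triangular (comp_endo phi psi).
Proof.
move=> [u [c [v [g [uu uv ->]]]]] [u' [c' [v' [g' [uu' uv' ->]]]]].
by rewrite trg_comp; do 4 eexists; split; last reflexivity; rewrite unitrM ?uu ?uv ?uu' ?uv'.
Qed.

Lemma triangular_shear (g : {poly S}) : triangular (shear g).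
Proof. by exists 1, 0, 1, g; rewrite unitr1 shearE. Qed.

Lemma comp_linK (u c : S) : u \is a GRing.unit ->
  (u^-1 *: 'X - (c / u)%:P) \Po (u *: 'X + c%:P) = 'X.
Proof.
move=> uu; rewrite comp_polyB comp_polyZ comp_polyX comp_polyC scalerDr scalerA mulVr //.
by rewrite scale1r -mul_polyC -polyCM [c / u]mulrC addrK.
Qed.

Lemma triangular_decomp (u c v : S) (g : {poly S}) : u \is a GRing.unit ->
  trg u c v g = comp_endo (trg u c v 0) (shear (g \Po (u^-1 *: 'X - (c / u)%:P))).
Proof.
move=> uu; rewrite shearE trg_comp -comp_polyA comp_linK // comp_polyXr.
by rewrite scaler0 add0r !mul1r addr0.
Qed.

Lemma triangular_inv phi : triangular phi -> exists2 psi, is_inv psi phi & triangular psi.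
Proof.
move=> [u [c [v [g [uu uv ->]]]]].
exists (trg u^-1 (- (c / u)) v^-1 (- (v^-1 *: (g \Po (u^-1 *: 'X - (c / u)%:P))))).
  split; rewrite trg_comp id_trg; apply: trg_congr.
  - exact: mulVr.
  - by rewrite [c / u]mulrC subrr.
  - exact: mulVr.
  - rewrite -[X in X \Po _]scaleN1r !comp_polyZ -comp_polyA comp_linK //.
    by rewrite comp_polyXr scaleN1r subrr.
  - exact: mulrV.
  - by rewrite mulrN mulrCA mulrV // mulr1 addNr.
  - exact: mulrV.
  - by rewrite scalerN scalerA mulrV // scale1r polyCN addNr.
do 4 eexists; split; last reflexivity; by rewrite unitrV.
Qed.

(** [G] is invertible for composition as a polynomial in [x2] over [S[x1]]. Degrees multiply, so it
    has degree one, and its leading coefficient, a unit of [S[x1]], is a constant. *)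
Lemma aut_fix_X1 G : is_aut (X1, G) ->
  exists2 v, v \is a GRing.unit & exists g : {poly S}, G = cst v * X2 + g%:P.
Proof.
case=> [[Z H]] [e e']; move: (e') (e); rewrite /comp_endo /= !app_X1 => -[eZ _] _.
have {}e := congr1 snd e; have {}e' := congr1 snd e'; rewrite /= in e e' eZ.
rewrite app_triangular //= in e; rewrite app_triangular //= in e'.
have := size_comp_poly H G; rewrite e size_polyX /=.
move=> /esym/eqP; rewrite muln_eq1 => /andP[/eqP sH /eqP sG].
have {}sH : (size H <= 2)%N by case: (size H) sH => [|[|[]]].
have {}sG : (size G <= 2)%N by case: (size G) sG => [|[|[]]].
have dec (q : P2 S) : (size q <= 2)%N -> q = q`_1 *: 'X + (q`_0)%:P.
  move=> sq; apply/polyP => -[|[|i]]; rewrite coefD coefZ coefX coefC /= ?mulr0 ?mulr1 ?add0r ?addr0 //.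
  by rewrite nth_default // (leq_trans sq).
have := congr1 (fun q : P2 S => q`_1) e.
rewrite {1}(dec H) // comp_polyD comp_polyZ comp_polyX comp_polyC coefD coefZ coefC /= addr0 coefX /= => e1.
have : G`_1 \is a GRing.unit by apply/unitrPr; exists H`_1; rewrite mulrC.
rewrite poly_unitE => /andP[/size_poly1P [v v0 ev]].
rewrite ev coefC /= => uv; exists v => //; exists G`_0.
by rewrite {1}(dec G) // ev -mul_polyC.
Qed.

Lemma swap_aut : is_aut swap.
Proof. by exists swap; exact: swapK. Qed.

Lemma is_aut_swap phi : is_aut phi -> is_aut (phi.2, phi.1).
Proof.
move=> h; have := is_aut_comp h swap_aut.
by rewrite /comp_endo /= app_X1 app_X2.
Qed.

Lemma is_aut_conj_swap phi : is_aut phi -> is_aut (app_endo swap phi.1, app_endo swap phi.2).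
Proof. by move=> h; have := is_aut_comp swap_aut h. Qed.

Lemma app_swap_polyC (g : {poly S}) : app_endo swap g%:P = map_poly (polyC) g.
Proof.
elim/poly_ind: g => [|g c IH]; first by rewrite !rmorph0.
rewrite polyCD polyCM [LHS]rmorphD [X in X + _]rmorphM /= IH -/(cst c) app_X1 app_cst.
by rewrite [RHS]rmorphD /= [X in _ = X + _]rmorphM /= map_polyX map_polyC.
Qed.

Lemma aut_fix_X2 G : is_aut (G, X2) ->
  exists2 v, v \is a GRing.unit & exists g : {poly S}, G = cst v * X1 + map_poly polyC g.
Proof.
move=> /is_aut_conj_swap /is_aut_swap; rewrite app_X2 /= => /aut_fix_X1 [v uv [g e]].
exists v => //; exists g; rewrite -[G](app_inv _ swapK) e rmorphD rmorphM /= app_cst app_X2.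
by rewrite app_swap_polyC.
Qed.

End Affine.

(** * Normal form of tame automorphisms *)

Section TameWords.
Variable S : idomainType.
Implicit Types (phi psi a : endo S) (g h : {poly S}).

Lemma tame_aff a : aff a -> tame a.
Proof. by move=> h; apply: tame_gen; left; apply/affP. Qed.

Lemma tame_shear g : tame (shear g).
Proof.
apply: tame_gen; right; split; last by left.
by exists (shear (- g)); exact: shear_inv.
Qed.

Lemma aff_trg0 (u c v : S) : u \is a GRing.unit -> v \is a GRing.unit -> aff (trg u c v 0).
Proof.
move=> uu uv; exists u, 0, c, 0, v, 0; rewrite mul0r subr0 unitrM uu uv; split=> //.
by rewrite aff_trg scale0r add0r.
Qed.

Lemma tame_triangular phi : triangular phi -> tame phi.
Proof.
move=> [u [c [v [g [uu uv ->]]]]]; rewrite triangular_decomp //.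
by apply: tame_comp; [apply: tame_aff; exact: aff_trg0 | exact: tame_shear].
Qed.

(** Words built from the left and without a constructor for inverses, so that reduction is an
    induction on the word. *)
Inductive gen_word : endo S -> Prop :=
| gw_id : gen_word (id_endo S)
| gw_aff a phi : aff a -> gen_word phi -> gen_word (comp_endo a phi)
| gw_shear g phi : gen_word phi -> gen_word (comp_endo (shear g) phi).

Lemma gw_comp phi psi : gen_word phi -> gen_word psi -> gen_word (comp_endo phi psi).
Proof.
move=> hphi hpsi; elim: hphi => [|a p ha _ IH|g p _ IH]; first by rewrite comp_id_endo.
  by rewrite -comp_endoA; apply: gw_aff.
by rewrite -comp_endoA; apply: gw_shear.
Qed.

Lemma gw_of_aff a : aff a -> gen_word a.
Proof. by move=> h; rewrite -[a]comp_endo_id; apply: gw_aff => //; exact: gw_id. Qed.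

Lemma gw_of_triangular phi : triangular phi -> gen_word phi.
Proof.
move=> [u [c [v [g [uu uv ->]]]]]; rewrite triangular_decomp //.
apply: gw_aff; first exact: aff_trg0.
by rewrite -[shear _]comp_endo_id; apply: gw_shear; exact: gw_id.
Qed.

Lemma tame_inv_exists phi : tame phi -> exists2 psi, is_inv psi phi & tame psi.
Proof.
move=> h; have [psi inv] : is_aut phi.
  elim: h => [p [] [] //|p q _ hp _ hq|p q _ _ inv]; first exact: is_aut_comp.
  by exists p; exact: is_inv_sym.
by exists psi => //; apply: tame_inv h inv.
Qed.

Lemma elementary_triangular phi : is_elementary phi ->
  triangular phi \/
  exists2 psi, triangular psi & phi = comp_endo (swap S) (comp_endo psi (swap S)).
Proof.
have aux (G : P2 S) : is_aut (X1, G) -> triangular (X1, G).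
  move=> /aut_fix_X1 [v uv [g ->]]; exists 1, 0, v, g; rewrite unitr1; split=> //.
  by rewrite /trg -X1_afm.
case: phi => p q [h /= [e|e]]; rewrite e in h *; first by left; apply: aux.
right; exists (X1, app_endo (swap S) p).
  by apply: aux; have := is_aut_conj_swap (is_aut_swap h); rewrite /= app_X2.
have e1 : comp_endo (X1, app_endo (swap S) p) (swap S) = (app_endo (swap S) p, X1).
  by apply: pair_congr; rewrite ?app_X2 ?app_X1.
rewrite e1; apply: pair_congr; last by rewrite app_X1.
by rewrite app_inv //; exact: swapK.
Qed.

(** A word for some inverse is carried along because [tame] has a constructor for inverses;
    uniqueness of inverses then settles that case. *)
Lemma tame_gen_word phi :
  tame phi -> gen_word phi /\ exists2 psi, is_inv psi phi & gen_word psi.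
Proof.
elim=> [p [/affP ha|/elementary_triangular [ht|[q ht ->]]]|p q _ [hp [p' ip hp']] _ [hq [q' iq hq']]|].
- split; first exact: gw_of_aff.
  by have [q iq hq] := aff_inv ha; exists q => //; exact: gw_of_aff.
- split; first exact: gw_of_triangular.
  by have [q iq hq] := triangular_inv ht; exists q => //; exact: gw_of_triangular.
- have gs := gw_of_aff (aff_swap S).
  split; first by apply: gw_comp => //; apply: gw_comp => //; exact: gw_of_triangular.
  have [q' iq hq] := triangular_inv ht.
  exists (comp_endo (comp_endo (swap S) q') (swap S)).
    by apply: is_inv_comp; [exact: swapK | apply: is_inv_comp => //; exact: swapK].
  by apply: gw_comp => //; apply: gw_comp => //; exact: gw_of_triangular.
- split; first exact: gw_comp.
  by exists (comp_endo q' p'); [exact: is_inv_comp | exact: gw_comp].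
move=> p q _ [hp [p' ip hp']] iq; rewrite (is_inv_uniq iq ip).
by split=> //; exists p => //; exact: is_inv_sym.
Qed.

(* [a] moves the point at infinity fixed by the triangular automorphisms. *)
Definition nontri a := a.1`_1`_0 != 0.

Lemma aff_tri a : aff a -> ~~ nontri a ->
  exists u c v r s, [/\ u \is a GRing.unit, v \is a GRing.unit & a = trg u c v (r *: 'X + s%:P)].
Proof.
move=> [a1 [a2 [a0 [b1 [b2 [b0 [-> u]]]]]]]; rewrite /nontri /= afm_coef2 negbK => /eqP e.
rewrite e mul0r subr0 in u *; exists a1, a0, b2, b1, b0.
by move: u; rewrite unitrM => /andP[u1 u2]; rewrite aff_trg.
Qed.

Lemma aff_tri_triangular a : aff a -> ~~ nontri a -> triangular a.
Proof.
move=> ha nt; have [u [c [v [r [s [uu uv e]]]]]] := aff_tri ha nt.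
by exists u, c, v, (r *: 'X + s%:P).
Qed.

(** Reduced words of the amalgamated product of the affine and triangular groups over their
    intersection: non-linear shears separated by non-triangular affine maps. Only the rightmost
    affine factor, which acts first, is unrestricted. *)
Inductive NT : endo S -> Prop :=
| NT1 g a : (2 < size g)%N -> aff a -> NT (comp_endo (shear g) a)
| NT2 g a psi : (2 < size g)%N -> aff a -> nontri a -> NT psi ->
    NT (comp_endo (shear g) (comp_endo a psi)).

Definition reduced phi := aff phi \/ exists a psi, [/\ aff a, NT psi & phi = comp_endo a psi].

Lemma NT_reduced phi : NT phi -> reduced phi.
Proof.
by right; exists (id_endo S), phi; rewrite comp_id_endo; split=> //; exact: aff_id.
Qed.

Lemma reduced_aff a phi : aff a -> reduced phi -> reduced (comp_endo a phi).
Proof.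
move=> ha [hp|[b [psi [hb hpsi ->]]]]; first by left; apply: aff_comp.
by right; exists (comp_endo a b), psi; rewrite comp_endoA; split=> //; exact: aff_comp.
Qed.

(** Triangular affine maps normalise the group of shears, so they can be moved to the left of a
    shear. *)
Lemma shear_trg g (u c v : S) h : u \is a GRing.unit ->
  exists g', comp_endo (shear g) (trg u c v h) = comp_endo (trg u c v h) (shear g').
Proof.
move=> uu; exists (v *: (g \Po (u^-1 *: 'X - (c / u)%:P))).
rewrite !shearE !trg_comp; apply: trg_congr; rewrite ?mulr1 ?mul1r ?mulr0 ?addr0 ?add0r //.
by rewrite scale1r comp_polyZ -comp_polyA comp_linK // scale1r !comp_polyXr addrC.
Qed.

Lemma reduced_shear_NT g psi : NT psi -> reduced (comp_endo (shear g) psi).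
Proof.
case=> [h a sh ha|h a chi sh ha nta hchi]; rewrite comp_endoA shear_comp;
  have [small|big] := leqP (size (g + h)) 2.
- by left; apply: aff_comp => //; exact: aff_shear.
- by apply: NT_reduced; apply: NT1.
- apply: reduced_aff; first exact: aff_shear.
  by right; exists a, chi.
- by apply: NT_reduced; apply: NT2.
Qed.

Lemma reduced_shear g phi : reduced phi -> reduced (comp_endo (shear g) phi).
Proof.
move=> hphi; have [small|big] := leqP (size g) 2.
  by apply: reduced_aff => //; exact: aff_shear.
case: hphi => [ha|[a [psi [ha hpsi ->]]]]; first by apply: NT_reduced; apply: NT1.
have [nta|ta] := boolP (nontri a); first by apply: NT_reduced; apply: NT2.
have [u [c [v [r [s [uu uv e]]]]]] := aff_tri ha ta.
(* A triangular [a] would separate two shears illegally; moved to the left, it lets them merge. *)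
have [g' e'] := shear_trg g c v (r *: 'X + s%:P) uu.
rewrite comp_endoA e e' -e -comp_endoA; apply: reduced_aff => //.
exact: reduced_shear_NT.
Qed.

Theorem tame_reduced phi : tame phi -> reduced phi.
Proof.
move=> /tame_gen_word [h _]; elim: h => [|a p ha _ IH|g p _ IH].
- by left; exact: aff_id.
- exact: reduced_aff.
- exact: reduced_shear.
Qed.

(* Ping-pong: non-linear shears send [PS] into [PQs], affine maps that are not
   triangular send [PQ] back into [PS]; the strict variants [PQs], [PSs] record
   that a shear has strictly increased the degree. *)
Section PingPong.
Variables PS PQ PQs PSs : P2 S -> Prop.
Hypothesis shear_S : forall g F, (2 < size g)%N -> PS F -> PQs (app_endo (shear g) F).
Hypothesis nontri_Q : forall a F, aff a -> nontri a -> PQ F -> PS (app_endo a F).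
Hypothesis nontri_Qs : forall a F, aff a -> nontri a -> PQs F -> PSs (app_endo a F).
Hypothesis Qs_Q : forall F, PQs F -> PQ F.
Hypothesis tri_Qs : forall a F, aff a -> ~~ nontri a -> PQs F -> PQs (app_endo a F).

Lemma pingpong_aff F phi : (forall a, aff a -> PS (app_endo a F)) -> tame phi ->
  [\/ aff phi, PQs (app_endo phi F) | PSs (app_endo phi F)].
Proof.
move=> hF /tame_reduced [ha|[a [psi [ha hpsi ->]]]]; first by constructor 1.
have hQ : PQs (app_endo psi F).
  elim: {a ha} hpsi => [g a sg ha|g a chi sg ha nta _ IH]; rewrite !app_comp.
    by apply: shear_S => //; apply: hF.
  by apply: shear_S => //; apply: nontri_Q => //; apply: Qs_Q.
rewrite app_comp; have [nta|ta] := boolP (nontri a); last by constructor 2; apply: tri_Qs.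
by constructor 3; apply: nontri_Qs.
Qed.

Lemma pingpong_tri F phi : (forall t, triangular t -> PQ (app_endo t F)) -> tame phi ->
  [\/ triangular phi, PQs (app_endo phi F) | PS (app_endo phi F)].
Proof.
move=> hF; have hid : PQ F.
  by rewrite -[F]app_id; apply: hF; rewrite -shear0; exact: triangular_shear.
move=> /tame_reduced [ha|[a [psi [ha hpsi ->]]]].
  have [nta|ta] := boolP (nontri phi); first by constructor 3; apply: nontri_Q.
  by constructor 1; apply: aff_tri_triangular.
(* Only a single shear after a triangular affine map stays triangular; any further shear comes after
   a non-triangular map and lands in [PQs]. *)
have hQ : triangular psi \/ PQs (app_endo psi F).
  elim: {a ha} hpsi => [g a sg ha|g a chi sg ha nta _ IH].
    have [nta|ta] := boolP (nontri a).
      by right; rewrite app_comp; apply: shear_S => //; apply: nontri_Q.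
    by left; apply: triangular_comp; [exact: triangular_shear | exact: aff_tri_triangular].
  right; rewrite !app_comp; apply: shear_S => //; apply: nontri_Q => //.
  by case: IH => [/hF|/Qs_Q].
have [nta|ta] := boolP (nontri a).
  by constructor 3; rewrite app_comp; apply: nontri_Q => //; case: hQ => [/hF|/Qs_Q].
case: hQ => [ht|hQ].
  by constructor 1; apply: triangular_comp => //; apply: aff_tri_triangular.
by constructor 2; rewrite app_comp; apply: tri_Qs.
Qed.

End PingPong.
End TameWords.

(** * Top coefficients of products and powers *)

Section LeadingCoefficients.
Variable T : comNzRingType.

(** Stated for upper bounds on the degrees, not exact degrees: the top coefficients may vanish, and
    no hypothesis on zero divisors is needed. *)
Lemma mul_top (A B : {poly T}) p q :
  (size A <= p.+1)%N -> (size B <= q.+1)%N ->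
  (size (A * B)%R <= (p + q).+1)%N /\ (A * B)`_(p + q) = A`_p * B`_q.
Proof.
move=> sA sB; split.
  by apply: leq_trans (size_polyMleq _ _) _; lia.
rewrite coefM (bigD1 (inord p)) //= inordK ?ltnS ?leq_addr //.
rewrite addKn big1 ?addr0 // => i ni.
have [ip|pi|e] := ltngtP i p.
- by rewrite [B`_ _]nth_default ?mulr0 //; apply: leq_trans sB _; have := ltn_ord i; lia.
- by rewrite nth_default ?mul0r // (leq_trans sA).
- by case/eqP: ni; apply: val_inj; rewrite /= inordK ?ltnS ?leq_addr.
Qed.

Lemma exp_top (A : {poly T}) p i :
  (size A <= p.+1)%N -> (size (A ^+ i)%R <= (p * i).+1)%N /\ (A ^+ i)`_(p * i) = A`_p ^+ i.
Proof.
move=> sA; elim: i => [|i [IH1 IH2]]; first by rewrite muln0 !expr0 size_poly1 coef1.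
have [h1 h2] := mul_top sA IH1.
by rewrite mulnS !exprS -IH2.
Qed.

End LeadingCoefficients.

(** * Weighted degrees *)

Section Weights.
Variable S : comNzRingType.
Implicit Types (F G : P2 S) (d M : nat).

Definition wle d M F := forall i j, F`_j`_i != 0 -> (i + d * j <= M)%N.

(** The part of weight [M] of [F], for weights 1 and [d] of [x1] and [x2], evaluated at [(a, b)].
    The guard discards those [j] for which the subtraction [M - d * j] would be truncated. *)
Definition hform d M F (a b : {poly S}) : {poly S} :=
  \sum_(j < size F | (d * j <= M)%N) F`_j`_(M - d * j) *: (a ^+ (M - d * j) * b ^+ j).

Arguments wle (d M)%_N F.
Arguments hform (d M)%_N F (a b)%_R.

Lemma size_coef_cstM (c : S) (q : P2 S) k : (cst c * q)`_k = c *: q`_k.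
Proof. by rewrite /cst coefCM mul_polyC. Qed.

(* The master substitution lemma: with [x1], [x2] of weights [p], [p * d], the weight [p * M]
   part of [F(A, B)] only sees the top part of [F] and the leading coefficients of [A], [B]. *)
Lemma app_top d M F p (A B : P2 S) : (0 < p)%N -> wle d M F ->
    (size A <= p.+1)%N -> (size B <= (p * d).+1)%N ->
  (size (app_endo (A, B) F) <= (p * M).+1)%N /\
  (app_endo (A, B) F)`_(p * M) = hform d M F A`_p B`_(p * d)%N.
Proof.
move=> p0 hF sA sB.
have term i j : F`_j`_i != 0 -> (size (A ^+ i * B ^+ j)%R <= (p * (i + d * j)).+1)%N /\
    (A ^+ i * B ^+ j)`_(p * (i + d * j)) = A`_p ^+ i * B`_(p * d) ^+ j.
  move=> _; have [a1 a2] := exp_top i sA; have [b1 b2] := exp_top j sB.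
  by rewrite -a2 -b2 mulnDr mulnA; apply: mul_top.
rewrite /app_endo /comp2 /=; split.
  apply: leq_trans (size_sum _ _ _) _; apply/bigmax_leqP => j _.
  rewrite mulr_suml; apply: leq_trans (size_sum _ _ _) _; apply/bigmax_leqP => i _.
  have [->|nz] := eqVneq F`_j`_i 0; first by rewrite rmorph0 !mul0r size_poly0.
  rewrite -mulrA; apply/leq_sizeP => k hk; rewrite size_coef_cstM.
  rewrite [X in _ *: X]nth_default ?scaler0 //; apply: leq_trans hk; apply: leq_trans (proj1 (term _ _ nz)) _.
  by rewrite ltnS leq_mul2l hF // orbT.
rewrite coef_sum /hform [RHS]big_mkcond /=; apply: eq_bigr => j _.
rewrite mulr_suml coef_sum.
have zero i : (i + d * j != M)%N -> F`_j`_i *: (A ^+ i * B ^+ j)`_(p * M) = 0.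
  move=> ne; have [->|nz] := eqVneq F`_j`_i 0; first by rewrite scale0r.
  rewrite [X in _ *: X]nth_default ?scaler0 //; apply: leq_trans (proj1 (term _ _ nz)) _.
  by rewrite ltn_mul2l p0 ltn_neqAle ne hF.
have [djM|djM] := leqP (d * j) M; last first.
  by rewrite big1 // => i _; rewrite -mulrA size_coef_cstM zero //; apply/eqP; lia.
rewrite (eq_bigr (fun i : 'I_ _ => if i == (M - d * j)%N :> nat then
   F`_j`_i *: (A ^+ i * B ^+ j)`_(p * M) else 0)); last first.
  move=> i _; rewrite -mulrA size_coef_cstM; case: eqP => // ne.
  by rewrite zero //; apply/eqP; lia.
rewrite -big_mkcond /= (big_ord1_eq _ (fun i => F`_j`_i *: (A ^+ i * B ^+ j)`_(p * M))).
case: ltnP => [_|big]; last by rewrite [F`_j`_(_)]nth_default ?scale0r.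
have [->|nz] := eqVneq F`_j`_(M - d * j) 0; first by rewrite !scale0r.
by rewrite -(proj2 (term _ _ nz)) subnK.
Qed.

(* [x1^i * x2^j] goes to [x1^j * x2^(i + d * j)]: the outer variable records the weight. *)
Definition theta d : endo S := (X2, X1 * X2 ^+ d).

Lemma theta_coef d F k j :
  (app_endo (theta d) F)`_k`_j = if (d * j <= k)%N then F`_j`_(k - d * j) else 0.
Proof.
rewrite /app_endo /comp2 /theta /=.
have e (j' : nat) (i : nat) : (cst (F`_j'`_i) * X2 ^+ i * (X1 * X2 ^+ d) ^+ j')`_k`_j =
    if (i + d * j' == k) && (j' == j) then F`_j'`_i else 0.
  have -> : cst (F`_j'`_i) * X2 ^+ i * (X1 * X2 ^+ d) ^+ j' =
      (F`_j'`_i *: 'X^j')%:P * 'X^(i + d * j').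
    rewrite -mul_polyC polyCM rmorphXn /= exprMn exprD exprM /X1 /X2 /cst; ring.
  rewrite coefCM coefXn [k == _]eq_sym; case: (_ == k); last by rewrite mulr0 coef0.
  rewrite mulr1 coefZ coefXn [j == _]eq_sym; case: (_ == j); by rewrite ?mulr1 ?mulr0.
rewrite coef_sum coef_sum.
rewrite (eq_bigr (fun j' : 'I_ _ => if j' == j :> nat then
  (if (d * j <= k)%N then F`_j`_(k - d * j) else 0) else 0)); last first.
  move=> j' _; rewrite mulr_suml !coef_sum.
  rewrite (eq_bigr (fun i : 'I_ _ => if (i + d * j' == k)%N && (j' == j :> nat)
     then F`_j'`_i else 0)); last by move=> i _; rewrite e.
  case: eqP => [ej|_]; last by rewrite big1 // => i _; rewrite andbF.
  rewrite ej; case: leqP => [le|lt]; last first.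
    by rewrite big1 // => i _; rewrite andbT; case: eqP => //; lia.
  rewrite (eq_bigr (fun i : 'I_ _ => if i == (k - d * j)%N :> nat then F`_j`_i else 0)); last first.
    by move=> i _; rewrite andbT; congr (if _ then _ else _); apply/eqP/eqP; lia.
  rewrite -big_mkcond /= (big_ord1_eq _ (fun i => F`_j`_i)).
  by case: ltnP => // big; rewrite nth_default.
rewrite -big_mkcond /= (big_ord1_eq _ (fun=> _)).
by case: ltnP => // big; rewrite [F`_j]nth_default ?coef0 ?if_same.
Qed.

Lemma wleP d M F : wle d M F <-> (size (app_endo (theta d) F) <= M.+1)%N.
Proof.
split=> [h|/leq_sizeP h].
  apply/leq_sizeP => k hk; apply/polyP => j; rewrite theta_coef coef0.
  case: leqP => // le; apply/eqP; apply: contraTT hk => nz.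
  by rewrite -leqNgt; have := h _ _ nz; rewrite subnK.
move=> i j; apply: contra_neqT; rewrite -ltnNge => hk.
by have := theta_coef d F (i + d * j) j; rewrite leq_addl addnK h // coef0.
Qed.

(** The part of weight [M] dehomogenised at [x1 = 1], as a polynomial in [x2]. *)
Definition top d M F := (app_endo (theta d) F)`_M.

Arguments top (d M)%_N F.

Lemma top_coef d M F j :
  (top d M F)`_j = if (d * j <= M)%N then F`_j`_(M - d * j) else 0.
Proof. exact: theta_coef. Qed.

Lemma app_theta_polyC d (g : {poly S}) : app_endo (theta d) g%:P = map_poly polyC g.
Proof.
elim/poly_ind: g => [|g c IH]; first by rewrite !rmorph0.
rewrite polyCD polyCM [LHS]rmorphD [X in X + _]rmorphM /= IH -/(cst c) app_X1 app_cst.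
by rewrite [RHS]rmorphD /= [X in _ = X + _]rmorphM /= map_polyX map_polyC.
Qed.

Lemma app_comp_top d M F d' phi p A B : app_endo (theta d') phi.1 = A ->
    app_endo (theta d') phi.2 = B -> (0 < p)%N -> wle d M F ->
    (size A <= p.+1)%N -> (size B <= (p * d).+1)%N ->
  wle d' (p * M) (app_endo phi F) /\ top d' (p * M) (app_endo phi F) = hform d M F A`_p B`_(p * d)%N.
Proof.
move=> eA eB p0 hF sA sB; have [h1 h2] := app_top p0 hF sA sB.
have e : app_endo (theta d') (app_endo phi F) = app_endo (A, B) F.
  by rewrite -app_comp /comp_endo eA eB.
by split; [apply/wleP; rewrite e | rewrite /top e].
Qed.

Lemma theta1_afm a1 a2 a0 :
  (size (app_endo (theta 1) (afm a1 a2 a0)) <= 2)%N /\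
  (app_endo (theta 1) (afm a1 a2 a0))`_1 = a1%:P + a2 *: 'X.
Proof.
have -> : app_endo (theta 1) (afm a1 a2 a0) = (a1%:P + a2 *: 'X) *: 'X + a0%:P%:P.
  rewrite app_afm_gen /= /cst /X1 /X2 expr1 -mul_polyC polyCD -[a2 *: _]mul_polyC polyCM; ring.
split; last by rewrite coefD coefZ coefX coefC mulr1 addr0.
by apply/leq_sizeP => -[|[|k]] // _; rewrite coefD coefZ coefX coefC mulr0 addr0.
Qed.

Lemma theta_afm0 d a1 a0 :
  (size (app_endo (theta d) (afm a1 0 a0)) <= 2)%N /\
  (app_endo (theta d) (afm a1 0 a0))`_1 = a1%:P.
Proof.
have -> : app_endo (theta d) (afm a1 0 a0) = a1%:P *: 'X + a0%:P%:P.
  rewrite app_afm_gen /= /cst /X1 /X2 -mul_polyC rmorph0 mul0r addr0; ring.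
split; last by rewrite coefD coefZ coefX coefC mulr1 addr0.
by apply/leq_sizeP => -[|[|k]] // _; rewrite coefD coefZ coefX coefC mulr0 addr0.
Qed.

Lemma theta_linX2 d v (g : {poly S}) : (0 < d)%N -> (size g <= d.+1)%N ->
  (size (app_endo (theta d) (cst v * X2 + g%:P)) <= d.+1)%N /\
  (app_endo (theta d) (cst v * X2 + g%:P))`_d = v *: 'X + (g`_d)%:P.
Proof.
move=> d0 sg.
have -> : app_endo (theta d) (cst v * X2 + g%:P) = (v *: 'X) *: 'X^d + map_poly polyC g.
  rewrite rmorphD rmorphM /= app_cst app_X2 app_theta_polyC /= /cst /X1 /X2.
  by rewrite mulrA -polyCM mul_polyC mul_polyC.
split; last by rewrite coefD coefZ coefXn eqxx mulr1 coef_map.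
apply/leq_sizeP => k hk; rewrite coefD coefZ coefXn coef_map /= [g`_k]nth_default ?(leq_trans sg) //.
by rewrite gtn_eqF // mulr0 addr0.
Qed.

Lemma app_affine_top M F a1 a2 a0 b1 b2 b0 : wle 1 M F ->
  wle 1 M (app_endo (afm a1 a2 a0, afm b1 b2 b0) F) /\
  top 1 M (app_endo (afm a1 a2 a0, afm b1 b2 b0) F) =
    hform 1 M F (a1%:P + a2 *: 'X) (b1%:P + b2 *: 'X).
Proof.
move=> hF; have [sA eA] := theta1_afm a1 a2 a0; have [sB eB] := theta1_afm b1 b2 b0.
have [] := @app_comp_top 1 M F 1 (afm a1 a2 a0, afm b1 b2 b0) 1 _ _ erefl erefl isT hF sA sB.
by rewrite !mul1n eA eB.
Qed.

Lemma app_trg_top d M F u c v (g : {poly S}) : (0 < d)%N -> (size g <= d.+1)%N -> wle d M F ->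
  wle d M (app_endo (afm u 0 c, cst v * X2 + g%:P) F) /\
  top d M (app_endo (afm u 0 c, cst v * X2 + g%:P) F) =
    hform d M F u%:P (v *: 'X + (g`_d)%:P).
Proof.
move=> d0 sg hF; have [sA eA] := theta_afm0 d u c; have [sB eB] := theta_linX2 v d0 sg.
have [] := @app_comp_top d M F d (afm u 0 c, cst v * X2 + g%:P) 1 _ _ erefl erefl isT hF sA.
  by rewrite mul1n.
by rewrite !mul1n eA eB.
Qed.

Lemma hform0l d K F b : (0 < d)%N -> hform d (d * K) F 0 b = F`_K`_0 *: b ^+ K.
Proof.
move=> d0; rewrite /hform (eq_bigr (fun j : 'I_(size F) => if j == K :> nat then
  F`_K`_0 *: b ^+ K else 0)); last first.
  move=> j le; case: eqP => [->|ne]; first by rewrite subnn expr0 mul1r.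
  rewrite expr0n subn_eq0 (_ : (_ <= _)%N = false) ?mul0r ?scaler0 //.
  by rewrite leq_pmul2l // in le; rewrite leq_pmul2l //; apply/negbTE/negP => ?; lia.
rewrite -big_mkcondr /=.
have [lt|ge] := ltnP K (size F); last first.
  by rewrite [F`_K]nth_default // coef0 scale0r big1.
rewrite (bigD1 (Ordinal lt)) /= ?eqxx ?leqnn // big1 ?addr0 // => j.
by move=> /andP[/andP[_ /eqP e]] /eqP[]; apply: val_inj.
Qed.

Lemma hform0r d M F a : hform d M F a 0 = F`_0`_M *: a ^+ M.
Proof.
rewrite /hform (eq_bigr (fun j : 'I_(size F) => if j == 0 :> nat then
  F`_0`_M *: a ^+ M else 0)); last first.
  move=> j _; case: eqP => [->|ne]; first by rewrite muln0 subn0 expr0 mulr1.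
  by rewrite expr0n (_ : (_ == _) = false) ?mulr0 ?scaler0 //; apply/eqP.
rewrite -big_mkcondr /=.
have [s0|ge] := posnP (size F).
  by rewrite [F`_0]nth_default ?s0 // coef0 scale0r big1.
rewrite (bigD1 (Ordinal ge)) /= ?eqxx ?muln0 // big1 ?addr0 // => j.
by move=> /andP[/andP[_ /eqP e]] /eqP[]; apply: val_inj.
Qed.

(** The image of [x2] has weight [d > 1] and that of [x1] only weight 1, so among monomials of
    degree at most [K] only [x2 ^ K] reaches weight [d * K]. *)
Lemma top_shear d K F (g : {poly S}) : (1 < d)%N -> size g = d.+1 -> wle 1 K F ->
  wle d (d * K) (app_endo (X1, X2 + g%:P) F) /\
  top d (d * K) (app_endo (X1, X2 + g%:P) F) = F`_K`_0 *: ('X + (lead_coef g)%:P) ^+ K.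
Proof.
move=> d1 sg hF; have d0 := ltnW d1.
have [sA _] := theta_afm0 d 1 0; rewrite -X1_afm in sA.
have [] := @theta_linX2 d 1 g d0; rewrite ?sg // rmorph1 mul1r scale1r => sB eB.
have [] := @app_comp_top 1 K F d (X1, X2 + g%:P) d _ _ erefl erefl d0 hF (leq_trans sA (leqW d1)).
  by rewrite muln1; exact: sB.
rewrite muln1 eB [_`_d]nth_default ?(leq_trans sA) // => h1 ->; split=> //.
by rewrite -{1}[K]mul1n hform0l // lead_coefE sg.
Qed.

(** Both variables become polynomials of degree at most one; a factor [x2] uses weight [d > 1] for
    degree one, so only [x1 ^ M] can reach degree [M]. *)
Lemma top_nontri d M F a1 a2 a0 b1 b2 b0 : (1 < d)%N -> wle d M F ->
  wle 1 M (app_endo (afm a1 a2 a0, afm b1 b2 b0) F) /\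
  top 1 M (app_endo (afm a1 a2 a0, afm b1 b2 b0) F) = F`_0`_M *: (a1%:P + a2 *: 'X) ^+ M.
Proof.
move=> d1 hF; have [sA eA] := theta1_afm a1 a2 a0; have [sB eB] := theta1_afm b1 b2 b0.
have [] := @app_comp_top d M F 1 (afm a1 a2 a0, afm b1 b2 b0) 1 _ _ erefl erefl isT hF sA.
  by rewrite mul1n; apply: leq_trans sB (leqW d1).
rewrite !mul1n [_`_d]nth_default ?hform0r ?eA //.
by apply: leq_trans sB d1.
Qed.
End Weights.
Arguments wle {S} (d M)%_N F.
Arguments top {S} (d M)%_N F.
Arguments hform {S} (d M)%_N F (a b)%_R.
Arguments theta {S} d%_N.

Section Degrees.
Variable S : idomainType.
Implicit Types (F G : P2 S) (g : {poly S}) (a phi t : endo S).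

Lemma leq_degx2 F i j : F`_j`_i != 0 -> (j <= degx2 F)%N.
Proof.
move=> nz; rewrite /degx2 -ltnS; apply: leq_trans (leqSpred _).
by rewrite ltnNge; apply: contraNN nz => le; rewrite [F`_j]nth_default ?coef0.
Qed.

Lemma leq_degx1 F i j : F`_j`_i != 0 -> (i <= degx1 F)%N.
Proof.
move=> nz; have lt : (j < size F)%N.
  by rewrite ltnNge; apply: contraNN nz => le; rewrite [F`_j]nth_default ?coef0.
apply: leq_trans (leq_bigmax_cond (Ordinal lt) isT) => /=.
rewrite -ltnS; apply: leq_trans (leqSpred _).
by rewrite ltnNge; apply: contraNN nz => le; rewrite nth_default.
Qed.

Lemma degx1_leq F M : (forall i j, F`_j`_i != 0 -> (i <= M)%N) -> (degx1 F <= M)%N.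
Proof.
move=> h; apply/bigmax_leqP => j _; have [->|nz] := eqVneq F`_j 0; first by rewrite size_poly0.
by apply: (h _ j); rewrite -lead_coefE lead_coef_eq0.
Qed.

Lemma degx2_leq F M : (forall i j, F`_j`_i != 0 -> (j <= M)%N) -> (degx2 F <= M)%N.
Proof.
move=> h; rewrite /degx2; have [->|nz] := eqVneq F 0; first by rewrite size_poly0.
have := lead_coef_eq0 F; rewrite (negbTE nz) lead_coefE => nz'.
apply: (h (size F`_(size F).-1).-1).
by rewrite -lead_coefE lead_coef_eq0 nz'.
Qed.

Lemma wle1_degx F M : wle 1 M F -> (degx1 F <= M)%N /\ (degx2 F <= M)%N.
Proof.
by move=> h; split; [apply: degx1_leq => i j /h | apply: degx2_leq => i j /h]; lia.
Qed.

Definition tdeg F := (size (app_endo (theta 1) F)).-1.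

Lemma theta_eq0 d F : app_endo (theta d) F = 0 -> F = 0.
Proof.
move=> e; apply/polyP => j; apply/polyP => i; rewrite !coef0.
by have := theta_coef d F (i + d * j) j; rewrite leq_addl addnK e !coef0.
Qed.

Lemma wle_wdeg d F : wle d (size (app_endo (theta d) F)).-1 F.
Proof. by apply/wleP; exact: leqSpred. Qed.

Lemma top_wdeg d F : F != 0 -> top d (size (app_endo (theta d) F)).-1 F != 0.
Proof.
move=> nz; rewrite /top -lead_coefE lead_coef_eq0.
by apply: contraNneq nz => /theta_eq0 ->.
Qed.

Lemma wle_tdeg F : wle 1 (tdeg F) F. Proof. exact: wle_wdeg. Qed.

Lemma top_tdeg F : F != 0 -> top 1 (tdeg F) F != 0. Proof. exact: top_wdeg. Qed.

Lemma tdeg_leq F M : wle 1 M F -> (tdeg F <= M)%N.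
Proof. by move=> /wleP; rewrite /tdeg; case: size. Qed.

Lemma leq_tdeg F i j : F`_j`_i != 0 -> (i + j <= tdeg F)%N.
Proof. by move=> /(wle_tdeg (F := F)); rewrite mul1n. Qed.

Lemma tdeg_gt0_neq0 F : (0 < tdeg F)%N -> F != 0.
Proof. by apply: contraTneq => ->; rewrite /tdeg rmorph0 size_poly0. Qed.

Lemma tdeg_aff a F : aff a -> tdeg (app_endo a F) = tdeg F.
Proof.
have le b G : aff b -> (tdeg (app_endo b G) <= tdeg G)%N.
  move=> [a1 [a2 [a0 [b1 [b2 [b0 [-> _]]]]]]].
  by apply: tdeg_leq; have [] := app_affine_top a1 a2 a0 b1 b2 b0 (wle_tdeg (F := G)).
move=> ha; have [b ib hb] := aff_inv ha; apply/eqP; rewrite eqn_leq le //=.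
by rewrite -{1}[F](app_inv F ib) le.
Qed.

(* The top homogeneous part of [F] is divisible by a power of [x1] exceeding half the degree. *)
Definition dom F := forall i j, F`_j`_i != 0 -> (i + j = tdeg F)%N -> (2 * j < tdeg F)%N.

Lemma dom_top F j : dom F -> (top 1 (tdeg F) F)`_j != 0 -> (2 * j < tdeg F)%N.
Proof.
move=> dF; rewrite top_coef mul1n; case: (leqP j) => [le nz|_]; last by rewrite eqxx.
by apply: (dF (tdeg F - j)%N) => //; rewrite subnK.
Qed.

Lemma top_dom F : (forall j, (top 1 (tdeg F) F)`_j != 0 -> (2 * j < tdeg F)%N) -> dom F.
Proof.
move=> h i j nz e; apply: h; rewrite top_coef mul1n -e leq_addl addnK //.
Qed.

(** The power of [x1] dividing the top form becomes a power of a linear form that involves [x2]. Its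
    exponent exceeds half the degree, so some top monomial has too large an exponent in [x2]. *)
Lemma dom_nontri a F : aff a -> nontri a -> (0 < tdeg F)%N -> dom F -> ~ dom (app_endo a F).
Proof.
move=> ha nta N0 dF dG; set G := app_endo a F in dG.
have eN : tdeg G = tdeg F by exact: tdeg_aff.
have := top_tdeg (tdeg_gt0_neq0 (F := G) _); rewrite eN => /(_ N0) nz.
(* [k] is the least integer above half the degree; by [dom], [x1 ^ k] divides the top form of
   [F]. *)
pose k := (tdeg F)./2.+1; have hk : (tdeg F < 2 * k)%N by rewrite /k mul2n; have := odd_double_half (tdeg F); case: odd; lia.
have [A [R [sA eT]]] : exists A R : {poly S}, size A = 2 /\ top 1 (tdeg F) G = A ^+ k * R.
  move: ha nta; rewrite /G => -[a1 [a2 [a0 [b1 [b2 [b0 [-> _]]]]]]].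
  rewrite /nontri /= afm_coef2 => a2n.
  have [_ ->] := app_affine_top a1 a2 a0 b1 b2 b0 (wle_tdeg (F := F)).
  exists (a1%:P + a2 *: 'X), (\sum_(j < size F | (1 * j <= tdeg F)%N)
    F`_j`_(tdeg F - 1 * j) *: ((a1%:P + a2 *: 'X) ^+ (tdeg F - 1 * j - k) * (b1%:P + b2 *: 'X) ^+ j)).
  split.
    by rewrite addrC size_polyDl size_scale ?size_polyX ?size_polyC //; case: (_ == _).
  rewrite /hform mulr_sumr; apply: eq_bigr => j; rewrite mul1n => le.
  have [->|nz'] := eqVneq F`_j`_(tdeg F - j) 0; first by rewrite !scale0r mulr0.
  have lt : (2 * j < tdeg F)%N by apply: (dF (tdeg F - j)%N) => //; lia.
  rewrite -scalerAr mulrA -exprD; congr (_ *: (_ ^+ _ * _)); rewrite /k in hk *.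
  by have := odd_double_half (tdeg F); case: odd; lia.
have nA : A != 0 by rewrite -size_poly_eq0 sA.
have nR : R != 0 by apply: contraNneq nz => R0; rewrite eT R0 mulr0.
have szT : (k < size (top 1 (tdeg F) G))%N.
  have sAk : size (A ^+ k) = k.+1 by rewrite polySpred ?expf_neq0 // size_exp sA mul1n.
  by rewrite eT size_mul ?expf_neq0 // sAk addSn /= -[X in (X < _)%N]addn0 ltn_add2l lt0n size_poly_eq0.
have := dom_top dG (j := (size (top 1 (tdeg F) G)).-1).
rewrite eN -lead_coefE lead_coef_eq0 => /(_ nz) lt.
by move: szT lt hk; case: size => // s; rewrite ltnS /=; lia.
Qed.

Lemma dom_tri a F : aff a -> ~~ nontri a -> dom F -> dom (app_endo a F).
Proof.
move=> ha ta dF; apply: top_dom => j; rewrite tdeg_aff //.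
have [u [c [v [r [s [uu uv e]]]]]] := aff_tri ha ta; rewrite {}e.
have sg : (size (r *: 'X + s%:P)%R <= 2)%N.
  by apply/leq_sizeP => -[|[|k]] // _; rewrite coefD coefZ coefX coefC mulr0 addr0.
have [_ ->] := @app_trg_top S 1 (tdeg F) F u c v _ isT sg (wle_tdeg (F := F)).
apply: contraNT; rewrite -leqNgt => le; rewrite coef_sum big1 // => i; rewrite mul1n => lei.
have [->|nz] := eqVneq F`_i`_(tdeg F - i) 0; first by rewrite scale0r coef0.
have lt : (2 * i < tdeg F)%N by apply: (dF (tdeg F - i)%N) => //; lia.
rewrite coefZ -rmorphXn /= coefCM [X in _ * (_ * X)]nth_default ?mulr0 //.
have sB : (size (v *: 'X + ((r *: 'X + s%:P)`_1)%:P)%R <= 2)%N.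
  by apply/leq_sizeP => -[|[|k]] // _; rewrite coefD coefZ coefX coefC mulr0 addr0.
by have [h _] := exp_top i sB; apply: leq_trans h _; lia.
Qed.

Lemma hform1_comp d M F b : (0 < d)%N -> wle d M F -> hform d M F 1 b = top d M F \Po b.
Proof.
move=> d0 hF; have s0 : (size (0 : {poly S})%R <= d.+1)%N by rewrite size_poly0.
have [_] := @app_trg_top S d M F 1 0 1 0 d0 s0 hF.
rewrite rmorph1 mul1r coef0 polyC0 !addr0 scale1r -X1_afm app_id => ->.
rewrite /hform raddf_sum; apply: eq_bigr => j _.
by rewrite /= comp_polyZ rmorphM !rmorphXn /= comp_polyX comp_polyC.
Qed.

Lemma low_coefs_dvd (w : {poly S}) q : (forall j, (j < q)%N -> w`_j = 0) -> exists r, w = r * 'X^q.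
Proof.
move=> h; exists (drop_poly q w); rewrite -{1}(poly_take_drop q w) (_ : take_poly q w = 0) ?add0r //.
by apply/polyP => j; rewrite coef_take_poly coef0; case: ifP => // /h.
Qed.

(* If a non-linear shear does not increase the degree, the weighted top form [w] of [F] vanishes
   to high order both at [0] and at the leading coefficient of [g]. *)
Lemma shear_dom g F : (2 < size g)%N -> (0 < tdeg F)%N ->
  (tdeg (app_endo (shear g) F) <= tdeg F)%N -> dom F.
Proof.
move=> sg N0 le; have nF := tdeg_gt0_neq0 N0.
pose d := (size g).-1; have sgd : size g = d.+1 by rewrite /d; lia.
have d1 : (1 < d)%N by lia. have d0 := ltnW d1.
pose D := (size (app_endo (theta d) F)).-1.
have wF : wle d D F by exact: wle_wdeg.
set w := top d D F; have nw : w != 0 by exact: top_wdeg.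
set G := app_endo (shear g) F in le.
have [wG tG] : wle d D G /\ top d D G = w \Po ('X + (lead_coef g)%:P).
  have := @app_trg_top S d D F 1 0 1 g d0 _ wF; rewrite sgd => /(_ (leqnn _)) [].
  rewrite -/(trg 1 0 1 g) -shearE -/G => h1 ->; split=> //.
  by rewrite rmorph1 hform1_comp // scale1r lead_coefE sgd.
(* A monomial [x1 ^ i * x2 ^ j] with [i + d * j = D] and [i + j <= tdeg F] has
   [(d - 1) * j >= D - tdeg F]. The least such [j] is the order of vanishing forced at 0 on the top
   forms of both [F] and its image. *)
have [q hq minq] : exists2 q, (D - tdeg F <= (d - 1) * q)%N &
    forall j, (D - tdeg F <= (d - 1) * j)%N -> (q <= j)%N.
  have ex : exists q, (D - tdeg F <= (d - 1) * q)%N.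
    by exists (D - tdeg F)%N; rewrite leq_pmull // subn_gt0.
  by exists (ex_minn ex); case: ex_minnP.
have low H : wle d D H -> (tdeg H <= tdeg F)%N -> forall j, (j < q)%N -> (top d D H)`_j = 0.
  move=> wH leH j lt; rewrite top_coef; case: leqP => // dj; apply/eqP.
  apply: contraTT lt => nz; rewrite -leqNgt; apply: minq.
  have := leq_trans (leq_tdeg nz) leH; rewrite mulnBl mul1n; lia.
have [r1 e1] := low_coefs_dvd (low _ wF (leqnn _)); rewrite -/w in e1.
have [r2 e2] := low_coefs_dvd (low _ wG le); rewrite tG in e2.
set c := lead_coef g in e2.
have e3 : w = (r2 \Po ('X - c%:P)) * ('X - c%:P) ^+ q.
  have := congr1 (fun p => p \Po ('X - c%:P)) e2.
  rewrite -comp_polyA comp_polyD comp_polyX comp_polyC subrK comp_polyXr => ->.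
  by rewrite comp_polyM rmorphXn /= comp_polyX.
have c0 : c != 0 by rewrite lead_coef_eq0 -size_poly_eq0 sgd.
(* The two zeros of order [q] are distinct because [c != 0]; hence [2 * q] is at most the degree of
   [w], which is at most [D / d]. *)
have cop : coprimep ('X^q : {poly S}) (('X - c%:P) ^+ q).
  by apply/coprimep_expl/coprimep_expr; rewrite coprimep_XsubC rootE hornerX.
have dv : 'X^q * ('X - c%:P) ^+ q %| w.
  by rewrite Gauss_dvdp // {1}e1 e3 !dvdp_mull.
have := dvdp_leq nw dv.
rewrite size_mul ?expf_neq0 ?polyX_eq0 ?polyXsubC_eq0 // size_exp_XsubC size_polyXn.
move=> szw; have dq : (d * (2 * q) <= D)%N.
  have := lead_coef_eq0 w; rewrite (negbTE nw) lead_coefE top_coef.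
  case: (leqP _ D) => [lew _|]; last by rewrite eqxx.
  apply: leq_trans lew; rewrite leq_mul2l; apply/orP; right.
  by move: szw; clear; move: (size w) => s; lia.
move=> i j nz eij; have := wF _ _ nz; move: nF d1 hq dq N0 eij.
move: (tdeg F) => N _ d1 hq dq N0 eij lej.
(* Eliminating [q] gives [(d + 1) * D <= 2 * d * N]. For a top monomial, [N + (d - 1) * j <= D];
   together [(d + 1) * j <= N], which is stronger than [2 * j < N] as [d >= 2] and [N > 0]. *)
have b1 : (2 * d * (D - N) <= (d - 1) * D)%N by nia.
have b2 : (N + (d - 1) * j <= D)%N by nia.
have b3 : ((d + 1) * D <= 2 * d * N)%N by nia.
have b4 : ((d - 1) * ((d + 1) * j) <= (d - 1) * N)%N by nia.
have b5 : ((d + 1) * j <= N)%N by move: b4; rewrite leq_pmul2l //; lia.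
by nia.
Qed.

(** This is [shear_dom] for the inverse shear, which does not raise the degree of the image. *)
Lemma shear_dom_image g F : (2 < size g)%N -> (0 < tdeg F)%N ->
  (tdeg F <= tdeg (app_endo (shear g) F))%N -> dom (app_endo (shear g) F).
Proof.
move=> sg N0 le; apply: (@shear_dom (- g)); rewrite ?size_polyN ?(leq_trans N0) //.
by rewrite app_inv //; exact: shear_inv.
Qed.

Section Stabilizers.
Variable N : nat.
Hypothesis N_gt0 : (0 < N)%N.
Let PS F := (N <= tdeg F)%N /\ ~ dom F.
Let PQ F := (N <= tdeg F)%N /\ dom F.
Let PQs F := (N < tdeg F)%N /\ dom F.
Let PSs F := (N < tdeg F)%N /\ ~ dom F.

Let shear_PS g F : (2 < size g)%N -> PS F -> PQs (app_endo (shear g) F).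
Proof.
move=> sg [le nd]; have F0 := leq_trans N_gt0 le.
have lt : (tdeg F < tdeg (app_endo (shear g) F))%N.
  by rewrite ltnNge; apply/negP => /(shear_dom sg F0).
by split; [exact: leq_ltn_trans le lt | apply: shear_dom_image => //; exact: ltnW].
Qed.

Let nontri_PQ a F : aff a -> nontri a -> PQ F -> PS (app_endo a F).
Proof.
move=> ha nta [le dF]; split; first by rewrite tdeg_aff.
by apply: dom_nontri => //; exact: leq_trans le.
Qed.

Let nontri_PQs a F : aff a -> nontri a -> PQs F -> PSs (app_endo a F).
Proof.
move=> ha nta [le dF]; split; first by rewrite tdeg_aff.
by apply: dom_nontri => //; apply: leq_trans (ltnW le).
Qed.

Let PQs_PQ F : PQs F -> PQ F. Proof. by case=> /ltnW. Qed.

Let tri_PQs a F : aff a -> ~~ nontri a -> PQs F -> PQs (app_endo a F).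
Proof. by move=> ha ta [le dF]; split; [rewrite tdeg_aff | exact: dom_tri]. Qed.

(** The other two outcomes of the ping-pong have degree above [N], which is impossible for [F]
    itself. *)
Lemma stab_aff F phi : tdeg F = N -> (forall a, aff a -> ~ dom (app_endo a F)) ->
  tame phi -> app_endo phi F = F -> aff phi.
Proof.
move=> eN hF hphi fix_F.
have [||[]|[]] // := @pingpong_aff _ PS PQ PQs PSs shear_PS nontri_PQ nontri_PQs PQs_PQ tri_PQs F phi _ hphi;
  rewrite ?fix_F ?eN ?ltnn //.
by move=> a ha; split; [rewrite tdeg_aff ?eN | exact: hF].
Qed.

(** Minimality keeps the whole triangular orbit of [F] inside [dom], so the ping-pong applies. An
    image equal to [F] can neither have larger degree nor leave [dom]. *)
Lemma stab_triangular F phi : tdeg F = N -> dom F ->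
    (forall t, tame t -> (N <= tdeg (app_endo t F))%N) ->
  tame phi -> app_endo phi F = F -> triangular phi.
Proof.
move=> eN dF minF hphi fix_F.
have [||[]|[]] // := @pingpong_tri _ PS PQ PQs shear_PS nontri_PQ PQs_PQ tri_PQs F phi _ hphi;
  rewrite ?fix_F ?eN ?ltnn //.
move=> t [u [c [v [g [uu uv ->]]]]]; split.
  by apply: minF; apply: tame_triangular; exists u, c, v, g.
rewrite triangular_decomp // app_comp.
have ha : aff (trg u c v 0) by exact: aff_trg0.
have ta : ~~ nontri (trg u c v 0) by rewrite /nontri /= afm_coef2 negbK.
apply: dom_tri => //; set g' := (_ \Po _).
have [small|big] := leqP (size g') 2.
  apply: dom_tri => //; first exact: aff_shear.
  by rewrite /nontri /= X1_afm afm_coef2 negbK.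
by apply: shear_dom_image => //; rewrite eN //; apply: minF; exact: tame_shear.
Qed.

End Stabilizers.
End Degrees.

(** * Polynomials of minimal degree in their tame orbit *)

Section NewtonTriangles.
Variable S : idomainType.
Implicit Types (F G : P2 S) (g : {poly S}) (a phi t : endo S).

Definition sdeg F := (degx1 F + degx2 F)%N.

Lemma coef_swap F i j : (app_endo (swap S) F)`_j`_i = F`_i`_j.
Proof.
rewrite (_ : app_endo (swap S) F = app_endo (theta 0) F) ?theta_coef ?mul0n ?subn0 //.
by apply: app_endo_ext => //=; rewrite expr0 mulr1.
Qed.

Lemma degx2_swap F : degx2 (app_endo (swap S) F) = degx1 F.
Proof.
apply/eqP; rewrite eqn_leq; apply/andP; split.
  by apply: degx2_leq => i j; rewrite coef_swap; exact: leq_degx1.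
by apply: degx1_leq => i j; rewrite -coef_swap; exact: leq_degx2.
Qed.

Lemma swap_swap F : app_endo (swap S) (app_endo (swap S) F) = F.
Proof. by rewrite app_inv //; exact: swapK. Qed.

Lemma degx1_swap F : degx1 (app_endo (swap S) F) = degx2 F.
Proof. by rewrite -degx2_swap swap_swap. Qed.

Lemma degx2_triangular t F : triangular t -> degx2 (app_endo t F) = degx2 F.
Proof.
have le s G : triangular s -> (degx2 (app_endo s G) <= degx2 G)%N.
  move=> [u [c [v [g [uu uv ->]]]]].
  have h : (size (app_endo (trg u c v g) G) <= size G)%N.
    apply: leq_trans (size_sum _ _ _) _; apply/bigmax_leqP => i _.
    set p := \sum_(j < _) _; have sp : (size p <= 1)%N.
      apply: leq_trans (size_sum _ _ _) _; apply/bigmax_leqP => j _.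
      by rewrite /trg /= afm0E -rmorphXn /= /cst -polyCM size_polyC_leq1.
    have sv : (size (trg u c v g).2 <= 2)%N.
      apply/leq_sizeP => -[|[|k]] // _.
      by rewrite /trg /= /cst coefD coefCM coefX coefC mulr0 addr0.
    have [h _] := exp_top i sv; rewrite mul1n in h.
    have [h' _] := mul_top (p := 0) sp h; apply: leq_trans h' _.
    by rewrite add0n; exact: ltn_ord.
  by rewrite /degx2; case: (size _) h => // s'; case: size.
move=> ht; have [s is_ hs] := triangular_inv ht; apply/eqP; rewrite eqn_leq le //=.
by rewrite -{1}[F](app_inv F is_) le.
Qed.

Lemma coef_exp_lin (c : S) K : (('X + c%:P) ^+ K)`_K = 1 /\ (('X + c%:P) ^+ K)`_0 = c ^+ K.
Proof.
rewrite -[c%:P]opprK -polyCN; split.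
  have := monic_exp K (monicXsubC (- c)).
  by rewrite monicE lead_coefE size_exp_XsubC => /eqP.
by rewrite -horner_coef0 horner_exp hornerXsubC sub0r opprK.
Qed.

(* The Newton polygon is the full triangle with vertices [0], [x1 ^ (d * n)] and [x2 ^ n]. *)
Definition ntri n d F :=
  [/\ (1 < d)%N, wle d (d * n) F, F`_n`_0 != 0 & F`_0`_(d * n) != 0].

Lemma top_ends n d F : wle d (d * n) F ->
  F`_n`_0 = (top d (d * n) F)`_n /\ F`_0`_(d * n) = (top d (d * n) F)`_0.
Proof. by rewrite !top_coef leqnn muln0 leq0n subnn subn0. Qed.

Lemma ntri_deg n d F : ntri n d F -> (d * n <= degx1 F)%N /\ (n <= degx2 F)%N.
Proof. by move=> [_ _ h2 h1]; split; [exact: leq_degx1 h1 | exact: leq_degx2 h2]. Qed.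

Lemma ntri_shear K g F : (2 < size g)%N -> wle 1 K F -> F`_K`_0 != 0 ->
  ntri K (size g).-1 (app_endo (shear g) F).
Proof.
move=> sg wF cF; have d1 : (1 < (size g).-1)%N by lia.
have sgd : size g = (size g).-1.+1 by lia.
have [wG tG] := top_shear d1 sgd wF.
have [e2 e1] := top_ends wG; split=> //; rewrite ?e1 ?e2 tG coefZ.
  by have [-> _] := coef_exp_lin (lead_coef g) K; rewrite mulr1.
have [_ ->] := coef_exp_lin (lead_coef g) K; rewrite mulf_neq0 // expf_neq0 //.
by rewrite lead_coef_eq0 -size_poly_eq0 sgd.
Qed.

Lemma coef_hform_diag d M F (u v : S) j :
  (hform d M F u%:P (v *: 'X))`_j = u ^+ (M - d * j) * v ^+ j * (top d M F)`_j.
Proof.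
rewrite top_coef /hform coef_sum.
rewrite (eq_bigr (fun i : 'I_(size F) => if i == j :> nat then
   u ^+ (M - d * j) * v ^+ j * F`_j`_(M - d * j) else 0)); last first.
  move=> i _; rewrite exprZn -rmorphXn /= coefZ coefCM coefZ coefXn eq_sym.
  by case: eqP => [->|_]; rewrite ?mulr1 ?mulr0 // mulrC.
rewrite -big_mkcondr /=; have [lt|ge] := ltnP j (size F); last first.
  by rewrite [F`_j]nth_default // coef0 if_same !mulr0 big1.
case: leqP => le; last first.
  rewrite mulr0 big1 // => i /andP[le' /eqP e]; move: le'; rewrite e; lia.
rewrite (bigD1 (Ordinal lt)) /= ?le ?eqxx // big1 ?addr0 // => i.
by move=> /andP[/andP[_ /eqP e]] /eqP[]; apply: val_inj.
Qed.

Lemma ntri_tri n d a F : aff a -> ~~ nontri a -> ntri n d F -> ntri n d (app_endo a F).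
Proof.
move=> ha ta [d1 wF h2 h1]; have [u [c [v [r [s [uu uv e]]]]]] := aff_tri ha ta; rewrite {}e.
have sg : (size (r *: 'X + s%:P)%R <= 2)%N.
  by apply/leq_sizeP => -[|[|k]] // _; rewrite coefD coefZ coefX coefC mulr0 addr0.
have [wG tG] := app_trg_top u c v (ltnW d1) (leq_trans sg (leqW d1)) wF.
rewrite -/(trg u c v _) in wG tG.
have z : (r *: 'X + s%:P)`_d = 0 by rewrite nth_default // (leq_trans sg).
rewrite z polyC0 addr0 in tG.
have unz (x : S) k : x \is a GRing.unit -> x ^+ k != 0.
  by move=> ux; apply: expf_neq0; apply: contraTneq ux => ->; rewrite unitr0.
have [e2 e1] := top_ends wG; have [f2 f1] := top_ends wF.
split=> //; rewrite ?e1 ?e2 tG coef_hform_diag ?mulf_neq0 ?unz //.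
  by rewrite -f2.
by rewrite -f1.
Qed.

Lemma nontri_ntri n d a F : aff a -> nontri a -> ntri n d F ->
  [/\ wle 1 (d * n) (app_endo a F), (app_endo a F)`_(d * n)`_0 != 0 &
      (n <= degx1 (app_endo a F))%N].
Proof.
move=> [a1 [a2 [a0 [b1 [b2 [b0 [-> u]]]]]]]; rewrite /nontri /= afm_coef2 => a2n [d1 wF h2 h1].
have [wG tG] := top_nontri a1 a2 a0 b1 b2 b0 d1 wF.
set G := app_endo _ F in wG tG *.
have tC j : (j <= d * n)%N -> G`_j`_(d * n - j) = F`_0`_(d * n) * ((a1%:P + a2 *: 'X) ^+ (d * n))`_j.
  by move=> le; rewrite -coefZ -tG top_coef mul1n le.
split=> //.
  rewrite -[X in _`_X](subnn (d * n)) tC // mulf_neq0 //.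
  have sA : (size (a1%:P + a2 *: 'X)%R <= 2)%N.
    by apply/leq_sizeP => -[|[|k]] // _; rewrite coefD coefZ coefX coefC mulr0 addr0.
  have [_] := exp_top (d * n) sA; rewrite mul1n => ->.
  by rewrite coefD coefZ coefX coefC add0r mulr1 expf_neq0.
(* When [a1 = 0], composing with the swap gives a triangular map, and those preserve the degree in
   [x2]. *)
have [e|a1n] := eqVneq a1 0; last first.
  apply: leq_trans (leq_pmull n (ltnW d1)) _; apply: (@leq_degx1 _ _ _ 0).
  rewrite -[X in _`_X]subn0 tC // mulf_neq0 // -horner_coef0 horner_exp.
  by rewrite hornerD hornerC hornerZ hornerX mulr0 addr0 expf_neq0.
rewrite e mul0r sub0r unitrN unitrM in u; have /andP[u2 v1] := u.
rewrite -degx2_swap /G -app_comp /comp_endo /= !app_afm_gen /=.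
rewrite (_ : (_, _) = trg a2 a0 b1 (b2 *: 'X + b0%:P)).
  rewrite degx2_triangular; first exact: leq_degx2 h2.
  by exists a2, a0, b1, (b2 *: 'X + b0%:P).
rewrite -aff_trg /afm e !rmorph0; apply: pair_congr; ring.
Qed.

Section PingPongInstance.
Variables n1 k : nat.
(** [k] and [n1] are the larger and the smaller partial degree of the starting polynomial: [n1 = k]
    for [goodA], and [(n, d * n)] for [goodB]. In the strict variants the sum of the partial degrees
    is at least [3 * k]. *)
Definition PS F := exists K, [/\ (k <= K)%N, wle 1 K F, F`_K`_0 != 0 & (n1 <= degx1 F)%N].
Definition PQ F := exists n d, [/\ ntri n d F, (k <= d * n)%N & (n1 <= n)%N].
Definition PQs F := exists n d, ntri n d F /\ (k <= n)%N.
Definition PSs F := exists K, [/\ (2 * k <= K)%N, F`_K`_0 != 0 & (k <= degx1 F)%N].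

Lemma shear_PS g F : (2 < size g)%N -> PS F -> PQs (app_endo (shear g) F).
Proof. by move=> sg [K [le wF cF _]]; exists K, (size g).-1; split=> //; exact: ntri_shear. Qed.

Lemma nontri_PQ a F : aff a -> nontri a -> PQ F -> PS (app_endo a F).
Proof.
move=> ha nta [n [d [hF le le1]]]; have [h1 h2 h3] := nontri_ntri ha nta hF.
by exists (d * n)%N; split=> //; exact: leq_trans h3.
Qed.

Lemma nontri_PQs a F : aff a -> nontri a -> PQs F -> PSs (app_endo a F).
Proof.
move=> ha nta [n [d [hF le]]]; have [h1 h2 h3] := nontri_ntri ha nta hF.
exists (d * n)%N; split=> //; last exact: leq_trans h3.
by case: hF => d1 _ _ _; apply: leq_mul.
Qed.

Lemma tri_PQs a F : aff a -> ~~ nontri a -> PQs F -> PQs (app_endo a F).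
Proof. by move=> ha ta [n [d [hF le]]]; exists n, d; split=> //; exact: ntri_tri. Qed.

Lemma PQs_PQ : (n1 <= k)%N -> forall F, PQs F -> PQ F.
Proof.
move=> le1 F [n [d [hF le]]]; exists n, d; split=> //; last exact: leq_trans le.
by case: hF => d1 _ _ _; apply: leq_trans le (leq_pmull _ (ltnW d1)).
Qed.

End PingPongInstance.

(* For [F] of total degree [k]: the top form of [F] is non-zero at every pair [(a.1_x2, a.2_x2)]
   of linear coefficients of an affine automorphism [a], that is, at unimodular vectors. *)
Definition goodA k F := [/\ (0 < k)%N, wle 1 k F & forall a, aff a -> (app_endo a F)`_k`_0 != 0].

Lemma wle1_aff k a F : aff a -> wle 1 k F -> wle 1 k (app_endo a F).
Proof.
move=> [a1 [a2 [a0 [b1 [b2 [b0 [-> _]]]]]]] wF.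
by have [] := app_affine_top a1 a2 a0 b1 b2 b0 wF.
Qed.

Lemma goodA_aff k a F : aff a -> goodA k F -> goodA k (app_endo a F).
Proof.
move=> ha [k0 wF hF]; split=> //; first exact: wle1_aff.
by move=> b hb; rewrite -app_comp; apply: hF; apply: aff_comp.
Qed.

Lemma goodA_deg k F : goodA k F -> degx1 F = k /\ degx2 F = k.
Proof.
move=> [k0 wF hF]; have [le1 le2] := wle1_degx wF.
have h2 := hF _ (aff_id S); rewrite app_id in h2.
have h1 := hF _ (aff_swap S); rewrite coef_swap in h1.
have := leq_degx1 h1; have := leq_degx2 h2; lia.
Qed.

Lemma goodA_tame k F phi : goodA k F -> tame phi -> aff phi \/ (2 * k < sdeg (app_endo phi F))%N.
Proof.
move=> gF hphi; have k0 : (0 < k)%N by case: gF.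
have hS a : aff a -> PS k k (app_endo a F).
  move=> ha; have ga := goodA_aff ha gF; have [e1 e2] := goodA_deg ga.
  case: ga => _ w h; exists k; split=> //; last by rewrite e1.
  by have := h _ (aff_id S); rewrite app_id.
have [|[n [d [hn le]]]|[K [le cK le1]]] := pingpong_aff (@shear_PS k k) (@nontri_PQ k k)
    (@nontri_PQs k) (PQs_PQ (leqnn k)) (@tri_PQs k) hS hphi.
- by left.
- right; have [h1 h2] := ntri_deg hn; case: hn => d1 _ _ _; rewrite /sdeg.
  apply: leq_trans (leq_add h1 h2); nia.
- by right; have h2 := leq_degx2 cK; rewrite /sdeg; lia.
Qed.

(* For [F] of weighted degree [d * n], the top form does not vanish at [x2 = r * x1 ^ d], so no
   shear over [S] lowers the degree. *)
Definition goodB n d F := [/\ (1 < d)%N, (0 < n)%N, wle d (d * n) F, F`_n`_0 != 0 &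
  forall r, (top d (d * n) F).[r] != 0].

Lemma goodB_deg n d F : goodB n d F -> degx1 F = (d * n)%N /\ degx2 F = n.
Proof.
move=> [d1 n0 wF h2 hr]; have [_ e1] := top_ends wF.
have h1 : F`_0`_(d * n) != 0 by rewrite e1 -horner_coef0.
split; apply/eqP; rewrite eqn_leq.
  rewrite (leq_degx1 h1) andbT; apply: degx1_leq => i j /wF; lia.
rewrite (leq_degx2 h2) andbT; apply: degx2_leq => i j /wF le.
by rewrite -(@leq_pmul2l d) ?(ltnW d1) //; lia.
Qed.

Lemma goodB_shear n d F g : goodB n d F -> PQ n (d * n) (app_endo (shear g) F).
Proof.
move=> [d1 n0 wF h2 hr]; have d0 := ltnW d1.
have [small|big] := leqP (size g) d.+1.
  (* For [deg g <= d] the top form is translated by the coefficient of [x1 ^ d] in [g]. Its value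
     there is the new coefficient of [x1 ^ (d * n)], non-zero by hypothesis. *)
  have [wG tG] := @app_trg_top S d (d * n) F 1 0 1 g d0 small wF.
  rewrite -/(trg 1 0 1 g) -shearE in wG tG.
  rewrite rmorph1 hform1_comp // scale1r in tG.
  have [e2 e1] := top_ends wG; have [f2 f1] := top_ends wF.
  exists n, d; split=> //; split=> //; last first.
    by rewrite e1 tG -horner_coef0 horner_comp hornerD hornerX hornerC add0r.
  have sw : size (top d (d * n) F) = n.+1.
    apply/eqP; rewrite eqn_leq; apply/andP; split; last first.
      by rewrite ltnNge; apply: contraNN h2 => le; rewrite f2 nth_default.
    apply/leq_sizeP => j lt; rewrite top_coef leqNgt ltn_pmul2l // lt //.
  rewrite e2 tG; set p := _ \Po _.
  have sp : size p = n.+1 by rewrite /p size_comp_poly2 // -[_%:P]opprK -polyCN size_XsubC.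
  have -> : p`_n = lead_coef p by rewrite lead_coefE sp.
  by rewrite lead_coef_eq0 -size_poly_eq0 sp.
(* For a steeper [g] only [x2 ^ n] has top weight, so the new top form is a multiple of a power of
   [x2 + g_d' * x1 ^ d']. *)
pose d' := (size g).-1; have sg : size g = d'.+1 by rewrite /d'; lia.
have dd' : (d < d')%N by rewrite /d'; lia.
have wF' : wle d' (d' * n) F.
  move=> i j nz; have le := wF _ _ nz.
  have jn : (j <= n)%N by rewrite -(@leq_pmul2l d) //; lia.
  by nia.
have tF' : top d' (d' * n) F = F`_n`_0 *: 'X^n.
  apply/polyP => j; rewrite top_coef coefZ coefXn.
  case: eqP => [->|ne]; first by rewrite leqnn subnn mulr1.
  rewrite mulr0; case: leqP => // le; apply/eqP; apply: contra_notT ne => /wF le'.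
  have jn : (j <= n)%N by rewrite -(@leq_pmul2l d') //; lia.
  by nia.
have d0' : (0 < d')%N by lia.
have sg' : (size g <= d'.+1)%N by rewrite sg.
have [wG tG] := @app_trg_top S d' (d' * n) F 1 0 1 g d0' sg' wF'.
rewrite -/(trg 1 0 1 g) -shearE in wG tG.
rewrite rmorph1 hform1_comp // scale1r tF' comp_polyZ comp_Xn_poly in tG.
have [e2 e1] := top_ends wG.
exists n, d'; split=> //; last by rewrite leq_mul2r (ltnW dd') orbT.
split=> //; rewrite ?e1 ?e2 ?tG ?coefZ; first by lia.
  by have [-> _] := coef_exp_lin g`_d' n; rewrite mulr1.
have [_ ->] := coef_exp_lin g`_d' n; rewrite mulf_neq0 // expf_neq0 //.
by have : lead_coef g != 0 by rewrite ?lead_coef_eq0 -?size_poly_eq0 sg.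
Qed.

Lemma goodB_triangular n d F t : goodB n d F -> triangular t -> PQ n (d * n) (app_endo t F).
Proof.
move=> gF [u [c [v [g [uu uv ->]]]]]; rewrite triangular_decomp // app_comp.
have [n' [d' [h le le1]]] := goodB_shear (g \Po (u^-1 *: 'X - (c / u)%:P)) gF.
exists n', d'; split=> //; apply: ntri_tri => //; first exact: aff_trg0.
by rewrite /nontri /= afm_coef2 negbK.
Qed.

(** The premise [degx2 <= degx1] excludes images, such as the one under the swap, in which the
    partial degrees are exchanged without changing their sum. *)
Lemma goodB_tame n d F phi : goodB n d F -> tame phi ->
  (n + d * n <= sdeg (app_endo phi F))%N /\
  ((sdeg (app_endo phi F) <= n + d * n)%N ->
   (degx2 (app_endo phi F) <= degx1 (app_endo phi F))%N -> triangular phi).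
Proof.
move=> gF hphi; have [d1 n0 _ _ _] := gF.
have nk : (n <= d * n)%N by rewrite leq_pmull // ltnW.
have hQ t := goodB_triangular gF (t := t).
have [ht|[n' [d' [h le]]]|[K [le wK cK le1]]] := pingpong_tri (@shear_PS n (d * n))
    (@nontri_PQ n (d * n)) (PQs_PQ nk) (@tri_PQs (d * n)) hQ hphi.
- split=> // ; have [n' [d' [h le le1]]] := hQ _ ht.
  by have [h1 h2] := ntri_deg h; rewrite /sdeg; lia.
- have [h1 h2] := ntri_deg h; case: h => d1' _ _ _; have b : (2 * n' <= d' * n')%N by rewrite leq_mul.
  by rewrite /sdeg; split; lia.
- have h2 := leq_degx2 cK; have b : (2 * n <= d * n)%N by rewrite leq_mul.
  by rewrite /sdeg; split; lia.
Qed.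

End NewtonTriangles.

(** * Coordinates fixed by an automorphism, over a field *)

Section PolynomialSubstitutions.
Variable T : comNzRingType.

Lemma comp_translate_top (s : T) (p : {poly T}) k : (size p <= k.+2)%N ->
  (p \Po ('X + s%:P))`_k.+1 = p`_k.+1 /\
  (p \Po ('X + s%:P))`_k = p`_k + k.+1%:R * s * p`_k.+1.
Proof.
elim/poly_ind: p k => [|p a IH] k; first by rewrite comp_poly0 !coef0 mulr0 addr0.
rewrite comp_polyD comp_polyM comp_polyX comp_polyC !coefD !coefC !coefMX mulrDr !coefD.
rewrite !coefMX !coefMC /= => sp.
have {}sp : (size p <= k.+1)%N.
  apply/leq_sizeP => j hj; have := leq_sizeP _ _ sp j.+1 hj.
  by rewrite coefD coefMX coefC addr0.
have z : (p \Po ('X + s%:P))`_k.+1 = 0.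
  have [-> _] := IH k (leqW sp); exact: nth_default.
rewrite z mul0r !addr0; case: k sp z => [|k] sp z /=.
  have [-> _] : p`_0 = (p \Po ('X + s%:P))`_0 /\ True.
    split=> //; move: sp => /size1_polyC ->; by rewrite comp_polyC.
  by split=> //; ring.
have [-> ->] := IH k sp; split=> //.
by rewrite !addr0 -addrA; congr (_ + _); rewrite [in RHS]mulrSr; ring.
Qed.

Lemma coef_comp_scale (v : T) (p : {poly T}) i : (p \Po (v *: 'X))`_i = v ^+ i * p`_i.
Proof.
elim/poly_ind: p i => [|p a IH] i; first by rewrite comp_poly0 !coef0 mulr0.
rewrite comp_polyD comp_polyM comp_polyX comp_polyC -scalerAr !coefD coefZ !coefMX !coefC.
case: i => [|i] /=; first by rewrite expr0 mulr0 mul1r.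
by rewrite IH !addr0 exprS mulrA.
Qed.

Lemma app_map_polyC phi (h : {poly T}) :
  app_endo phi (map_poly polyC h) = (map_poly (@cst T) h).[phi.2].
Proof.
elim/poly_ind: h => [|h a IH]; first by rewrite !rmorph0 horner0.
have e (U : nzRingType) (f : {rmorphism T -> U}) :
    map_poly f (h * 'X + a%:P) = map_poly f h * 'X + (f a)%:P.
  by rewrite rmorphD rmorphM /= map_polyX map_polyC.
rewrite !e rmorphD rmorphM /= IH hornerD hornerM hornerX hornerC.
by rewrite -/(cst a) app_cst; congr (_ * _ + _); exact: app_X2.
Qed.

Lemma app_sub_cst phi (p : P2 T) c : app_endo phi (p - cst c) = app_endo phi p - cst c.
Proof. by rewrite rmorphD rmorphN /= app_cst. Qed.

Lemma app_mul_X2 phi (p : P2 T) : app_endo phi (p * X2) = app_endo phi p * phi.2.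
Proof. by rewrite rmorphM /= app_X2. Qed.

Lemma app_cst_X2_add (phi : endo T) (a b : T) : app_endo phi (cst a * X2 + cst b) = cst a * phi.2 + cst b.
Proof. by rewrite rmorphD rmorphM /= !app_cst app_X2. Qed.

Lemma horner_cst (h : {poly T}) (Y : P2 T) :
  (map_poly (@cst T) h).[Y] = map_poly polyC h \Po Y.
Proof. by rewrite -(app_map_polyC (X1, Y)) app_triangular. Qed.

End PolynomialSubstitutions.

Lemma nat_pred_add1 a b : (0 < a)%N -> (0 < b)%N -> 1%N = (a + b).-1 -> a = 1%N /\ b = 1%N.
Proof. lia. Qed.

Lemma nat_pred_add2 a b : (0 < a)%N -> (0 < b)%N -> 2%N = (a + b).-1 -> a = 1%N \/ b = 1%N.
Proof. lia. Qed.

Lemma nat_pred_add_le1 a b : ((a + b).-1 <= 1)%N -> (0 < a)%N -> (0 < b)%N -> b = 1%N.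
Proof. lia. Qed.

Section Core.
Variable K : fieldType.
Implicit Types (F G P : P2 K) (phi psi : endo K) (g h p : {poly K}).

(** Degrees multiply under composition: counted in [x2] they make [F] free of [x2], and counted in
    [x1] they make [h] and [F] linear. *)
Lemma horner_cst_X1 h F : (map_poly (@cst K) h).[F] = X1 ->
  size h = 2%N /\ exists a b : K, a != 0 /\ F = afm a 0 b.
Proof.
rewrite horner_cst => e.
have sz := size_comp_poly (map_poly polyC h) F; rewrite e size_polyC polyX_eq0 /= size_map_polyC in sz.
have hn : (size h).-1 != 0%N.
  apply/eqP => sh; have hC : (size h <= 1)%N by case: (size h) sh => [|[]].
  move: e; rewrite (size1_polyC hC) map_polyC /= comp_polyC => /polyC_inj /(congr1 (fun q : {poly K} => q`_1)).
  by rewrite coefC coefX => /eqP; rewrite eq_sym oner_eq0.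
move/esym/eqP: sz; rewrite muln_eq0 (negbTE hn) /= => /eqP sF.
have sF1 : (size F <= 1)%N by case: (size F) sF => [|[]].
have eF := size1_polyC sF1; set F0 := F`_0 in eF.
move: e; rewrite eF => e; have {}e : h \Po F0 = 'X.
  have e' : app_endo (F0%:P, 0) h%:P = (h \Po F0)%:P by rewrite (@app_polyC1 _ _ _ F0).
  by rewrite app_polyC /= horner_cst e in e'; apply: polyC_inj; rewrite -e'.
have sz := size_comp_poly h F0; rewrite e size_polyX /= in sz.
move/esym/eqP: sz; rewrite muln_eq1 => /andP[/eqP sh /eqP s0].
have sF0 : size F0 = 2%N by case: (size F0) s0 => [|[|[]]].
split; first by case: (size h) sh => [|[|[]]].
exists F0`_1, F0`_0; split.
  have : lead_coef F0 != 0 by rewrite lead_coef_eq0 -size_poly_eq0 sF0.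
  by rewrite lead_coefE sF0.
rewrite afm0E; congr (_%:P); apply/polyP => -[|[|i]]; rewrite coefD coefZ coefX coefC /= ?mulr0 ?mulr1 ?add0r ?addr0 //.
by rewrite nth_default // sF0.
Qed.

Lemma is_aut_trg (u c v : K) g : u != 0 -> v != 0 -> is_aut (trg u c v g).
Proof.
move=> u0 v0; have [psi h _] : exists2 psi, is_inv psi (trg u c v g) & triangular psi.
  by apply: triangular_inv; exists u, c, v, g; rewrite !unitfE.
by exists psi.
Qed.

Lemma aut_replace2 phi (a : K) (b : {poly K}) : a != 0 -> is_aut phi ->
  is_aut (phi.1, app_endo phi (cst a * X2 + b%:P)).
Proof.
move=> a0 h; have h1 : (1 : K) != 0 by exact: oner_neq0.
have := is_aut_comp h (is_aut_trg 0 b h1 a0); rewrite /comp_endo /trg /= -X1_afm app_X1.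
by [].
Qed.

(** In an automorphism [(F, P)] the component [P] may be replaced by [a * P + b(F)]. If this is
    [x1], then [F] completes [x1] to an automorphism, and [aut_fix_X1] gives its shape. *)
Lemma aut_X1_second phi (a : K) (b : {poly K}) : is_aut phi -> a != 0 ->
  app_endo phi (cst a * X2 + b%:P) = X1 ->
  exists (b' : K) (p : {poly K}), b' != 0 /\ phi.1 = cst b' * X2 + p%:P.
Proof.
move=> hphi a0 e; have := is_aut_swap (aut_replace2 b a0 hphi); rewrite e /=.
by move=> /aut_fix_X1 [v uv [p ->]]; exists v, p; rewrite -unitfE.
Qed.

(** After undoing the shear by [G], the first component completes [x2] to an automorphism. *)
Lemma aut_X2_second phi (a : K) (b G : {poly K}) : is_aut phi -> a != 0 ->
  app_endo phi (cst a * X2 + b%:P) = X2 + G%:P ->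
  exists (a' : K) (h : {poly K}), a' != 0 /\ phi.1 = cst a' * X1 + (map_poly (@cst K) h).[X2 + G%:P].
Proof.
move=> hphi a0 e; have := aut_replace2 b a0 hphi; rewrite e.
have hs : is_aut (shear (- G)) by exists (shear G); apply: is_inv_sym; exact: shear_inv.
move=> /(is_aut_comp hs); rewrite /comp_endo /=.
rewrite rmorphD /= [app_endo _ X2]app_X2 [app_endo _ G%:P]app_polyX1 //= -addrA -polyCD addNr addr0.
move=> /aut_fix_X2 [v uv [h e']]; exists v, h; rewrite -unitfE; split=> //.
rewrite -[LHS](app_inv _ (is_inv_sym (shear_inv G))) e' rmorphD rmorphM /= app_cst app_X1.
by rewrite app_map_polyC.
Qed.

Hypothesis char0 : forall n, n.+1%:R != 0 :> K.

(* Conjugating by the automorphism [(F, P)] turns [phi], which fixes [F], into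
   [(X1, m * X2 + s(X1))]; completing the square, [s = 0] as soon as [m != 1]. *)
Lemma conj_normal_form F phi : coordinate F -> is_aut phi -> app_endo phi F = F ->
    phi <> id_endo K ->
  exists (Phi Psi : endo K) (m : K) (s : {poly K}),
    [/\ is_inv Psi Phi, Phi.1 = F, m != 0,
        forall q, app_endo (trg 1 0 m s) (app_endo Psi q) = app_endo Psi (app_endo phi q) &
        m = 1 /\ s != 0 \/ m != 1 /\ s = 0].
Proof.
move=> [Phi [[Psi iP] e1]] aphi fixF nid.
have aPsi : is_aut Psi by exists Phi; exact: is_inv_sym.
have aPhi : is_aut Phi by exists Psi.
pose chi := comp_endo Psi (comp_endo phi Phi).
have chi1 : chi.1 = X1.
  have [_ e] := iP; have := congr1 fst e.
  by rewrite /chi /comp_endo /= e1 fixF.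
have achi : is_aut chi by apply: is_aut_comp => //; exact: is_aut_comp.
have [m um [s e2]] : exists2 m : K, m \is a GRing.unit & exists s : {poly K}, chi.2 = cst m * X2 + s%:P.
  by apply: aut_fix_X1; rewrite -chi1; case: (chi) achi.
have chiE : chi = trg 1 0 m s by rewrite /trg -X1_afm -chi1 -e2; case: (chi).
have inter q : app_endo chi (app_endo Psi q) = app_endo Psi (app_endo phi q).
  by rewrite /chi !app_comp (app_inv _ (is_inv_sym iP)).
have m0 : m != 0 by rewrite -unitfE.
rewrite chiE in inter.
have [em|nm] := eqVneq m 1.
  exists Phi, Psi, m, s; split=> //; left; split=> //; apply: contra_not_neq nid => s0.
  have echi : chi = id_endo K by rewrite chiE em s0 -id_trg.
  have [i1 i2] := iP.
  rewrite -[phi]comp_endo_id -i1 comp_endoA -[LHS]comp_id_endo -i1 -comp_endoA.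
  by rewrite (comp_endoA Psi) (_ : comp_endo Psi (comp_endo phi Phi) = id_endo K) ?comp_id_endo.
pose t := (m - 1)^-1 *: s; have m1 : m - 1 != 0 by rewrite subr_eq0.
exists (comp_endo Phi (shear t)), (comp_endo (shear (- t)) Psi), m, 0; split=> //.
- by apply: is_inv_comp => //; exact: shear_inv.
- by rewrite /comp_endo /= app_X1.
- move=> q; rewrite !app_comp -(app_comp (trg 1 0 m 0)).
  have -> : comp_endo (trg 1 0 m 0) (shear (- t)) = comp_endo (shear (- t)) (trg 1 0 m s).
    rewrite !shearE !trg_comp; apply: trg_congr; rewrite ?mulr1 ?mul1r ?mulr0 ?addr0 ?add0r //.
    have es : s = (m - 1) *: t by rewrite /t scalerA mulfV // scale1r.
    rewrite ?scaler0 ?add0r !scale1r !comp_polyXr [X in _ = _ + X]es scalerBl scale1r scalerN.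
    by rewrite addrA addNr add0r.
  by rewrite app_comp inter.
- by right.
Qed.

(** In degree [n > 0] in [x2] the translation adds [n * s] times the leading coefficient to the next
    one, which is non-zero in characteristic zero. *)
Lemma translation_fix_const F s : s != 0 -> app_endo (shear s) F = F -> (size F <= 1)%N.
Proof.
move=> s0; rewrite app_triangular //= => e; rewrite leqNgt; apply/negP => sF.
have [k sz] : exists k, size F = k.+2.
  by exists (size F).-2; move: sF; case: (size F) => [|[]].
have [_] := comp_translate_top s (eq_leq sz); rewrite e => /eqP.
rewrite -[X in X == _]addr0 (inj_eq (addrI _)) eq_sym mulf_eq0 mulf_eq0 (negbTE s0) orbF.
have -> : F`_k.+1 = lead_coef F by rewrite lead_coefE sz.
rewrite lead_coef_eq0 -size_poly_eq0 sz orbF.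
by rewrite -polyC_natr polyC_eq0 (negbTE (char0 _)).
Qed.

Lemma coord_const (Phi Psi : endo K) : is_inv Psi Phi -> (size Phi.1 <= 1)%N ->
  exists a b : K, a != 0 /\ Phi.1 = afm a 0 b.
Proof.
move=> iP /size1_polyC e; set F0 := (Phi.1)`_0 in e.
have eX : (map_poly (@cst K) F0).[Psi.1] = X1.
  by rewrite -app_polyC -e; have := congr1 fst (proj2 iP).
have [sF0 _] := horner_cst_X1 eX.
exists F0`_1, F0`_0; split.
  have : lead_coef F0 != 0 by rewrite lead_coef_eq0 -size_poly_eq0 sF0.
  by rewrite lead_coefE sF0.
rewrite e afm0E; congr (_%:P); apply/polyP => -[|[|i]];
  rewrite coefD coefZ coefX coefC /= ?mulr0 ?mulr1 ?add0r ?addr0 //.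
by rewrite nth_default // sF0.
Qed.

Lemma aut_second_nonconst (Phi Psi : endo K) c : is_inv Psi Phi -> Phi.2 <> cst c.
Proof.
move=> iP e; have := congr1 snd (proj2 iP); rewrite /= e app_cst => e2.
have := congr1 (fun p : P2 K => p`_1`_0) e2; rewrite X2_afm afm_coef2.
by rewrite /cst coefC /= coef0 => /eqP; rewrite eq_sym oner_eq0.
Qed.

Lemma size1_poly_cst (q : {poly K}) : size q = 1%N -> exists2 c, c != 0 & q = c%:P.
Proof. by move/eqP/size_poly1P. Qed.

(* The factorisations [q * P = x1 - z] and [q * P = x2 + g(x1)] are trivial, so [P] is a
   constant multiple of the right-hand side. *)
Lemma coord_factor_X1 (Phi Psi : endo K) (q : P2 K) (z : K) : is_inv Psi Phi ->
  q * Phi.2 = X1 - cst z -> exists2 c, c != 0 & q = cst c.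
Proof.
move=> iP e; have eX : X1 - cst z = ('X - z%:P)%:P :> P2 K by rewrite /X1 /cst polyCB.
have nz : q * Phi.2 != 0 by rewrite e eX polyC_eq0 polyXsubC_eq0.
have /andP[nq nP] : (q != 0) && (Phi.2 != 0) by rewrite -negb_or -mulf_eq0.
have := size_mul nq nP; rewrite e eX size_polyC polyXsubC_eq0 /=.
have : (0 < size q)%N by rewrite size_poly_gt0. have : (0 < size Phi.2)%N by rewrite size_poly_gt0.
move=> s1 s2 s3; have [sq sP] := nat_pred_add1 s2 s1 s3.
have /size_poly1P [q0 q00 eq] : size q == 1%N by rewrite sq.
have /size_poly1P [p0 p00 eP] : size Phi.2 == 1%N by rewrite sP.
move: e; rewrite eX eq eP -polyCM => /polyC_inj e0.
have := size_mul q00 p00; rewrite e0 size_XsubC => s4.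
have : (0 < size q0)%N by rewrite size_poly_gt0. have : (0 < size p0)%N by rewrite size_poly_gt0.
move=> t1 t2; have [s5|s5] := nat_pred_add2 t2 t1 s4.
  by have [c c0 ->] := size1_poly_cst s5; exists c.
have [c c0 ec] := size1_poly_cst s5.
by case: (@aut_second_nonconst _ _ c iP); rewrite eP ec.
Qed.

Lemma coord_factor_X2 (Phi Psi : endo K) (q : P2 K) g : is_inv Psi Phi ->
  q * Phi.2 = X2 + g%:P -> exists2 c, c != 0 & q = cst c.
Proof.
move=> iP e; have mon : (X2 + g%:P : P2 K) \is monic.
  by rewrite /X2 -[g%:P]opprK -polyCN monicXsubC.
have szR : size (X2 + g%:P : P2 K) = 2 by rewrite /X2 -[g%:P]opprK -polyCN size_XsubC.
have nz : q * Phi.2 != 0 by rewrite e monic_neq0.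
have /andP[nq nP] : (q != 0) && (Phi.2 != 0) by rewrite -negb_or -mulf_eq0.
have := size_mul nq nP; rewrite e szR.
have : (0 < size q)%N by rewrite size_poly_gt0. have : (0 < size Phi.2)%N by rewrite size_poly_gt0.
move=> s1 s2 s3.
have el : lead_coef q * lead_coef Phi.2 = 1 by rewrite -lead_coefM e; exact/monicP.
have [/eq_leq/size1_polyC eq|/eq_leq/size1_polyC eP] := nat_pred_add2 s2 s1 s3.
  have u : q`_0 \is a GRing.unit.
    by apply/unitrPr; exists (lead_coef Phi.2); rewrite -el {2}eq lead_coefC.
  move: u; rewrite poly_unitE => /andP[/size_poly1P [c c0 ec] _].
  by exists c => //; rewrite eq ec.
have u : (Phi.2)`_0 \is a GRing.unit.
  by apply/unitrPr; exists (lead_coef q); rewrite mulrC -el {2}eP lead_coefC.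
move: u; rewrite poly_unitE => /andP[/size_poly1P [c c0 ec] _].
by case: (@aut_second_nonconst _ _ c iP); rewrite eP ec.
Qed.

Lemma app_scaleX2 (m : K) F i : (app_endo (trg 1 0 m 0) F)`_i = (m ^+ i)%:P * F`_i.
Proof.
rewrite app_triangular /=; last by rewrite -X1_afm.
have -> : cst m * X2 + 0%:P = m%:P *: 'X by rewrite addr0 /cst mul_polyC.
by rewrite coef_comp_scale -rmorphXn.
Qed.

Lemma factor_X2 F : F`_0 = 0 -> exists q, F = q * X2.
Proof. by move=> e; have [[]|q ->] := @low_coefs_dvd _ F 1 => //; exists q; rewrite expr1. Qed.

(** The first shape is linear; the second leads to type I and the third to type II. *)
Theorem triangular_fix_coordinate F (u c v : K) g : coordinate F -> u != 0 -> v != 0 ->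
    trg u c v g <> id_endo K -> app_endo (trg u c v g) F = F ->
  [\/ exists a b : K, a != 0 /\ F = afm a 0 b,
      exists (b : K) (p : {poly K}), b != 0 /\ F = cst b * X2 + p%:P |
      [/\ u = 1, c = 0, v != 1 &
        exists (a' : K) (h : {poly K}), [/\ a' != 0,
          F = cst a' * X1 + (map_poly (@cst K) h).[X2 + ((v - 1)^-1 *: g)%:P] &
          h \Po (v *: 'X) = h]]].
Proof.
move=> coF u0 v0 nid fixF; have aphi := is_aut_trg c g u0 v0.
have [Phi [Psi [m [s [iP eF m0 inter cases]]]]] := conj_normal_form coF aphi fixF nid.
have aPhi : is_aut Phi by exists Psi.
(* [Z] is [x1] written in the coordinates [(F, P)], where the given automorphism acts as
   [(x1, m * x2 + s)]. *)
pose Z := app_endo Psi X1.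
have PZ : app_endo Phi Z = X1 by rewrite app_inv //; exact: is_inv_sym.
have ZE : app_endo (trg 1 0 m s) Z = cst u * Z + cst c.
  by rewrite inter app_X1 /= /trg /afm /= rmorph0 mul0r addr0 rmorphD rmorphM /= !app_cst.
have second_X1 (a : K) (b : {poly K}) : a != 0 -> app_endo Phi (cst a * X2 + b%:P) = X1 ->
    exists (b : K) (p : {poly K}), b != 0 /\ F = cst b * X2 + p%:P.
  by rewrite -eF; exact: aut_X1_second.
case: cases => [[em s0]|[m1 es]].
  have [sZ|sZ] := leqP (size Z) 1.
    constructor 1; move: PZ; rewrite (size1_polyC sZ) app_polyC eF => e.
    by have [_ [a [b h]]] := horner_cst_X1 e; exists a, b.
  constructor 2; rewrite em -shearE app_triangular //= in ZE.
  have [k sz] : exists k, size Z = k.+2.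
    by exists (size Z).-2; move: sZ; case: (size Z) => [|[]].
  (* The leading coefficients force [u = 1]. The next ones give [(k + 1) * s * A = 0] unless
     [k = 0], where [s * A = c]. Hence [Z] is linear in [x2] with constant [A], that is,
     [x1 = a * P + b(F)]. *)
  have [] := comp_translate_top s (eq_leq sz); rewrite ZE.
  have [A eA] : exists A, Z`_k.+1 = A by eexists.
  rewrite !eA; have A0 : A != 0.
    have : lead_coef Z != 0 by rewrite lead_coef_eq0 -size_poly_eq0 sz.
    by rewrite lead_coefE sz eA.
  rewrite !coefD /cst !coefCM coefC addr0 eA => e1.
  have u1 : u = 1.
    apply: polyC_inj; apply: (mulIf A0); rewrite mul1r; exact: e1.
  rewrite u1 mul1r coefC => /addrI e2.
  have ks : k.+1%:R * s != 0 :> {poly K}.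
    by rewrite mulf_neq0 // -polyC_natr polyC_eq0.
  have k0 : k = 0%N.
    apply/eqP; apply: contraT => k0; rewrite (negbTE k0) in e2.
    by have := mulf_neq0 ks A0; rewrite -e2 eqxx.
  rewrite k0 in sz e2 eA; rewrite eqxx mul1r in e2.
  have uA : A \is a GRing.unit.
    have sA : size A = 1%N.
      have : (size (s * A)%R <= 1)%N by rewrite -e2 size_polyC_leq1.
      have ps : (0 < size s)%N by rewrite size_poly_gt0.
      have pA : (0 < size A)%N by rewrite size_poly_gt0.
      by rewrite size_mul // => le; exact: nat_pred_add_le1 le ps pA.
    by have [a a0 ->] := size1_poly_cst sA; rewrite rmorph_unit // unitfE.
  move: uA; rewrite poly_unitE => /andP[/size_poly1P [a a0 ea] _].
  apply: (second_X1 a Z`_0) => //; rewrite -PZ; congr (app_endo _ _).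
  apply/polyP => -[|[|i]]; rewrite coefD /cst coefCM coefX coefC ?mulr0 ?mulr1 ?add0r ?addr0 //.
    by rewrite -ea -eA.
  by rewrite nth_default // sz.
rewrite es in ZE inter.
have Z0E : Z`_0 = u%:P * Z`_0 + c%:P.
  by have := congr1 (fun q : P2 K => q`_0) ZE; rewrite app_scaleX2 expr0 mul1r coefD /cst coefCM coefC.
have [u1|u1] := eqVneq u 1; last first.
  (* Scaling [x2] does not affect the part of [Z] free of [x2], so this part is the constant
     [c / (1 - u)], and [P] divides [x1 - c / (1 - u)]. *)
  constructor 2; have u1' : 1 - u != 0 by rewrite subr_eq0 eq_sym.
  have Z0c : Z`_0 = (c / (1 - u))%:P.
    apply: (mulfI (_ : (1 - u)%:P != 0)); first by rewrite polyC_eq0.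
    rewrite -[RHS]polyCM [(1 - u) * _]mulrC divfK // polyCB mulrBl mul1r {1}Z0E.
    by rewrite addrAC subrr add0r.
  have [q eq] : exists q, Z - cst (c / (1 - u)) = q * X2.
    by apply: factor_X2; rewrite coefB /cst coefC /= Z0c subrr.
  have eq' : app_endo Phi q * Phi.2 = X1 - cst (c / (1 - u)).
    have e1 : app_endo Phi (Z - cst (c / (1 - u))) = app_endo Phi Z - cst (c / (1 - u)).
      exact: app_sub_cst.
    have e2 : app_endo Phi (q * X2) = app_endo Phi q * Phi.2.
      exact: app_mul_X2.
    by rewrite -e2 -eq e1 PZ.
  have [a a0 ea] := coord_factor_X1 iP eq'.
  apply: (second_X1 a (c / (1 - u))%:P) => //.
  by rewrite -/(cst _) app_cst_X2_add -ea eq' subrK.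
have c0 : c = 0.
  apply: polyC_inj; rewrite u1 mul1r in Z0E.
  by apply: (addrI Z`_0); rewrite addr0.
have [sF|sF] := leqP (size F) 1.
  by constructor 1; move: sF; rewrite -eF; exact: coord_const iP.
have v1 : v != 1.
  apply: contraTneq sF => v1; rewrite -leqNgt.
  rewrite u1 c0 v1 -shearE in fixF nid.
  apply: (@translation_fix_const _ g) => //; apply: contra_not_neq nid => ->; exact: shear0.
constructor 3; split=> //; have v1' : v - 1 != 0 by rewrite subr_eq0.
(* [Y] is an eigenvector for [v]. In the coordinates [(F, P)] its part free of [x2] is both fixed
   and multiplied by [v != 1], hence zero, so [P] divides [Y]. *)
pose G := (v - 1)^-1 *: g; pose Y : P2 K := X2 + G%:P.
have phi1 : (trg u c v g).1 = X1 by rewrite /= u1 c0 -X1_afm.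
have eg : g = (v - 1) *: G by rewrite /G scalerA mulfV // scale1r.
have gG : g + G = v *: G.
  by transitivity ((v - 1) *: G + G); [rewrite -eg | rewrite scalerBl scale1r subrK].
have phiY : app_endo (trg u c v g) Y = cst v * Y.
  rewrite rmorphD /= app_X2 app_polyX1 // /Y mulrDr /= -addrA; congr (_ + _).
  by rewrite -polyCD gG /cst -polyCM mul_polyC.
have [q eq] : exists q, app_endo Psi Y = q * X2.
  apply: factor_X2; have := inter Y; rewrite phiY rmorphM /= app_cst.
  move=> /(congr1 (fun q : P2 K => q`_0)); rewrite app_scaleX2 expr0 mul1r /cst coefCM => e.
  have : (1 - v)%:P * (app_endo Psi Y)`_0 = 0 by rewrite polyCB mulrBl mul1r {1}e subrr.
  by move/eqP; rewrite mulf_eq0 polyC_eq0 subr_eq0 eq_sym (negbTE v1) => /eqP.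
have eq' : app_endo Phi q * Phi.2 = X2 + G%:P.
  by rewrite -app_mul_X2 -eq app_inv //; exact: is_inv_sym.
have [a a0 ea] := coord_factor_X2 iP eq'.
have [|a' [h [a'0 eF']]] := @aut_X2_second Phi a 0 G aPhi a0.
  by rewrite app_linX2 polyC0 rmorph0 addr0 -ea.
exists a', h; rewrite eF in eF'; split=> //.
have e1 : app_endo (trg u c v g) F = cst a' * X1 + (map_poly (@cst K) h).[cst v * Y].
  rewrite eF' rmorphD rmorphM /= app_cst app_X1 phi1; congr (_ + _).
  by rewrite -[in LHS](app_map_polyC (X1, Y)) -app_comp app_map_polyC /= phiY.
rewrite fixF {1}eF' in e1; move/addrI: e1; rewrite !horner_cst => e1.
have := congr1 (fun p : P2 K => p \Po (X2 - G%:P)) e1.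
rewrite -!comp_polyA comp_polyM comp_polyD comp_polyX !comp_polyC subrK comp_polyXr.
rewrite mul_polyC => e2; apply/polyP => i; rewrite coef_comp_scale.
have := congr1 (fun p : P2 K => p`_i) e2; rewrite coef_comp_scale coef_map /= => e3.
by apply: polyC_inj; rewrite e3 polyCM rmorphXn.
Qed.
End Core.

Lemma aff_afm (S : idomainType) (a1 a2 a0 b1 b2 b0 : S) :
  a1 * b2 - a2 * b1 \is a GRing.unit -> aff (afm a1 a2 a0, afm b1 b2 b0).
Proof. by move=> u; exists a1, a2, a0, b1, b2, b0. Qed.

Lemma size2_polyE (T : nzRingType) (g : {poly T}) : (size g <= 2)%N -> g = g`_1 *: 'X + (g`_0)%:P.
Proof.
move=> sg; apply/polyP => -[|[|i]]; rewrite coefD coefZ coefX coefC /= ?mulr0 ?mulr1 ?add0r ?addr0 //.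
by rewrite nth_default // (leq_trans sg).
Qed.

Lemma size_linear (T : nzRingType) (r s : T) : (size (r *: 'X + s%:P)%R <= 2)%N.
Proof. by apply/leq_sizeP => -[|[|k]] // _; rewrite coefD coefZ coefX coefC mulr0 addr0. Qed.

Lemma afm_X2_polyE (S : comNzRingType) (g : {poly S}) :
  (size g <= 2)%N -> X2 + g%:P = afm g`_1 1 g`_0.
Proof. by move=> sg; rewrite afmE scale1r -size2_polyE. Qed.

Lemma horner_cst_at_X1 (S : comNzRingType) (p : {poly S}) : (map_poly (@cst S) p).[X1] = p%:P.
Proof. by rewrite -(app_polyC (id_endo S)) app_id. Qed.

Section AffineFix.
Variable K : fieldType.
Hypothesis char0 : forall n, n.+1%:R != 0 :> K.
Implicit Types (F : P2 K) (phi tau : endo K).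

Lemma coef_comp_top (T : comNzRingType) (p B : {poly T}) N : (size p <= N.+1)%N ->
  (size B <= 2)%N -> (p \Po B)`_N = B`_1 ^+ N * p`_N.
Proof.
move=> sp sB; rewrite coef_comp_poly.
rewrite (eq_bigr (fun i : 'I_(size p) => if i == N :> nat then B`_1 ^+ N * p`_N else 0)); last first.
  move=> i _; have [h1 h2] := exp_top i sB; rewrite mul1n in h1 h2.
  case: eqP => [->|ne]; first by have [_] := exp_top N sB; rewrite mul1n => ->; rewrite mulrC.
  rewrite [(B ^+ i)`_N]nth_default ?mulr0 //; apply: leq_trans h1 _.
  by rewrite ltn_neqAle; apply/andP; split; [exact/eqP | rewrite -ltnS (leq_trans _ sp)].
rewrite -big_mkcond /= (big_ord1_eq _ (fun=> _)).
by case: ltnP => // le; rewrite [p`_N]nth_default ?mulr0.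
Qed.

Lemma size_app_le1 phi F : (size phi.1 <= 1)%N -> (size phi.2 <= 1)%N ->
  (size (app_endo phi F) <= 1)%N.
Proof.
move=> /size1_polyC e1 /size1_polyC e2.
rewrite /app_endo /comp2 e1 e2; apply: leq_trans (size_sum _ _ _) _.
apply/bigmax_leqP => j _; rewrite mulr_suml; apply: leq_trans (size_sum _ _ _) _.
by apply/bigmax_leqP => i _; rewrite /cst -!rmorphXn /= -!polyCM size_polyC_leq1.
Qed.

Lemma coef_trg_top (m : K) s F N : (size F <= N.+1)%N ->
  (app_endo (trg 1 0 m s) F)`_N = (m ^+ N)%:P * F`_N.
Proof.
move=> sF; rewrite app_triangular /=; last by rewrite -X1_afm.
have sB : (size (cst m * X2 + s%:P : P2 K)%R <= 2)%N.
  by apply/leq_sizeP => -[|[|k]] // _; rewrite /cst coefD coefCM coefX coefC mulr0 addr0.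
by rewrite coef_comp_top // /cst coefD coefCM coefX coefC mulr1 addr0 rmorphXn.
Qed.

(** Write linear forms in the coordinates [(F, P)] and let [N] be the largest degree in [P] of [x1]
    and [x2]. There [phi] multiplies the coefficient of [P ^ N] by [m ^ N], so the forms without
    such a term make a space stable under the linear part of [phi]. It is not the whole plane, and
    once [x1] itself is no eigenform it is a line. *)
Lemma eigenform F phi : coordinate F -> aff phi -> app_endo phi F = F -> phi <> id_endo K ->
  exists l1 l2 u c : K, (l1 != 0 \/ l2 != 0) /\
    app_endo phi (afm l1 l2 0) = afm (u * l1) (u * l2) c.
Proof.
move=> coF hphi fixF nid.
have aphi : is_aut phi by have [psi i _] := aff_inv hphi; exists psi.
have [Phi [Psi [m [s [iP eF m0 inter _]]]]] := conj_normal_form coF aphi fixF nid.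
move: hphi inter => [a1 [a2 [a0 [b1 [b2 [b0 [-> _]]]]]]] inter.
have [e|a2n] := eqVneq a2 0.
  exists 1, 0, a1, a0; rewrite oner_eq0; split; first by left.
  by rewrite app_afm e !mul1r !mul0r !addr0 mulr1 mulr0.
pose Z1 := Psi.1; pose Z2 := Psi.2; pose N := maxn (degx2 Z1) (degx2 Z2).
have N0 : (0 < N)%N.
  rewrite lt0n; apply/negP => /eqP N0.
  have s1 : (size Z1 <= 1)%N by move: N0; rewrite /N /degx2; case: (size Z1) => [|[]] //; lia.
  have s2 : (size Z2 <= 1)%N by move: N0; rewrite /N /degx2; case: (size Z2) => [|[]] //; lia.
  have := size_app_le1 Phi.2 s1 s2; have := congr1 snd (proj2 iP).
  by rewrite /= => ->; rewrite /X2 size_polyX.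
have s1 : (size Z1 <= N.+1)%N by move: (leq_maxl (degx2 Z1) (degx2 Z2)); rewrite -/N /degx2; case: size.
have s2 : (size Z2 <= N.+1)%N by move: (leq_maxr (degx2 Z1) (degx2 Z2)); rewrite -/N /degx2; case: size.
have PsiL (p q r : K) : app_endo Psi (afm p q r) = cst p * Z1 + cst q * Z2 + cst r.
  exact: app_afm_gen.
have cC (p : K) (q : P2 K) k : (cst p * q)`_k = p%:P * q`_k by rewrite /cst coefCM.
have c0 (r : K) : (cst r)`_N = 0 by rewrite /cst coefC gtn_eqF.
have coefL (p q r : K) : (app_endo Psi (afm p q r))`_N = p%:P * Z1`_N + q%:P * Z2`_N.
  by rewrite PsiL !coefD !cC c0 addr0.
pose l1 := a1 - m ^+ N.
have dep : l1%:P * Z1`_N + a2%:P * Z2`_N = 0.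
  have : app_endo (trg 1 0 m s) Z1 = app_endo Psi (afm a1 a2 a0).
    by have := inter X1; rewrite !app_X1.
  move/(congr1 (fun q : P2 K => q`_N)); rewrite coefL coef_trg_top // => e.
  by rewrite /l1 polyCB mulrBl addrAC -e subrr.
exists l1, a2; pose al := l1 * a1 + a2 * b1; pose be := l1 * a2 + a2 * b2.
have szL : (size (app_endo Psi (afm l1 a2 0)) <= N)%N.
  apply/leq_sizeP => j; rewrite leq_eqVlt => /orP[/eqP <-|lt]; first by rewrite coefL.
  rewrite PsiL !coefD !cC /cst coefC gtn_eqF ?(leq_ltn_trans _ lt) // addr0.
  by rewrite !nth_default ?mulr0 ?addr0 ?(leq_trans s1) ?(leq_trans s2).
have dep' : al%:P * Z1`_N + be%:P * Z2`_N = 0.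
  have := inter (afm l1 a2 0); rewrite app_afm => /(congr1 (fun q : P2 K => q`_N)).
  rewrite coefL coef_trg_top ?(leq_trans szL) // => <-.
  by rewrite [X in _ * X]nth_default ?mulr0.
have nz : (Z1`_N != 0) || (Z2`_N != 0).
  have : N = degx2 Z1 \/ N = degx2 Z2 by rewrite /N /maxn; case: ifP; auto.
  have aux Z : N = degx2 Z -> Z`_N != 0.
    move=> e; rewrite e /degx2 -lead_coefE lead_coef_eq0 -size_poly_eq0.
    by move: N0; rewrite e /degx2; case: size.
  by case=> /aux -> //; rewrite orbT.
(* [(l1, a2)] and its image [(al, be)] both annihilate the non-zero pair of top coefficients, hence
   are proportional. *)
have det0 : al * a2 - be * l1 = 0.
  have p1 : (al * a2 - be * l1)%:P * Z1`_N = 0.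
    have -> : (al * a2 - be * l1)%:P * Z1`_N =
        a2%:P * (al%:P * Z1`_N + be%:P * Z2`_N) - be%:P * (l1%:P * Z1`_N + a2%:P * Z2`_N).
      by rewrite polyCB !polyCM; ring.
    by rewrite dep dep' !mulr0 subrr.
  have p2 : (al * a2 - be * l1)%:P * Z2`_N = 0.
    have -> : (al * a2 - be * l1)%:P * Z2`_N =
        al%:P * (l1%:P * Z1`_N + a2%:P * Z2`_N) - l1%:P * (al%:P * Z1`_N + be%:P * Z2`_N).
      by rewrite polyCB !polyCM; ring.
    by rewrite dep dep' !mulr0 subrr.
  by case/orP: nz => nz; [move: p1 | move: p2] => /eqP;
    rewrite mulf_eq0 polyC_eq0 (negbTE nz) orbF => /eqP.
exists (be / a2), (l1 * a0 + a2 * b0 + 0); split; first by right.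
rewrite app_afm -/al -/be; apply: afm_congr => //; last by rewrite divfK.
apply: (mulIf a2n); move/eqP: det0; rewrite subr_eq0 => /eqP ->.
by rewrite mulrAC divfK.
Qed.

(** Moving the eigenform to [x1] makes [phi] triangular. Each of the three resulting shapes is an
    affine image of some [x2 + p(x1)]; in the third, [G] is linear because [phi] is affine. *)
Theorem affine_fix_coordinate F phi : coordinate F -> aff phi -> app_endo phi F = F ->
    phi <> id_endo K ->
  exists tau (p : {poly K}), aff tau /\ F = app_endo tau (X2 + p%:P).
Proof.
move=> coF hphi fixF nid.
have [l1 [l2 [u0 [c0 [nz eL]]]]] := eigenform coF hphi fixF nid.
have [t0 [ht0 t01]] : exists t0, aff t0 /\ t0.1 = afm l1 l2 0.
  have [e|l1n] := eqVneq l1 0.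
    exists (afm l1 l2 0, afm 1 0 0); split=> //; do 6 eexists; split; first by reflexivity.
    by case: nz; rewrite e ?eqxx // => l2n; rewrite mul0r mulr1 sub0r unitrN unitfE.
  exists (afm l1 l2 0, afm 0 1 0); split=> //; do 6 eexists; split; first by reflexivity.
  by rewrite mulr0 mulr1 subr0 unitfE.
have [t1 it ht1] := aff_inv ht0.
pose psi := comp_endo t1 (comp_endo phi t0).
have hpsi : aff psi by apply: aff_comp => //; exact: aff_comp.
have psi1 : psi.1 = afm u0 0 c0.
  rewrite /psi /comp_endo /= t01 eL.
  have -> : afm (u0 * l1) (u0 * l2) c0 = cst u0 * t0.1 + cst c0.
    by rewrite t01 /afm !rmorphM /= rmorph0; ring.
  rewrite rmorphD rmorphM /= !app_cst.
  have -> : app_endo t1 t0.1 = X1 by exact: (congr1 fst (proj2 it)).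
  by rewrite /afm rmorph0; ring.
have [u [c [v [r [s [uu uv epsi]]]]]] : exists u c v r s, [/\ u \is a GRing.unit,
    v \is a GRing.unit & psi = trg u c v (r *: 'X + s%:P)].
  by apply: aff_tri => //; rewrite /nontri psi1 afm_coef2 negbK.
pose F' := app_endo t1 F; have eF : F = app_endo t0 F'.
  by rewrite /F' app_inv //; exact: is_inv_sym.
have coF' : coordinate F'.
  case: coF => Phi [aPhi e]; exists (comp_endo t1 Phi); split; last by rewrite /= e.
  by apply: is_aut_comp => //; exists t0; exact: is_inv_sym.
have fixF' : app_endo psi F' = F' by rewrite /psi !app_comp -eF fixF.
have nid' : psi <> id_endo K.
  move=> e; apply: nid; have [i1 i2] := it.
  have -> : phi = comp_endo t0 (comp_endo psi t1).
    by rewrite /psi !comp_endoA i1 comp_id_endo -comp_endoA i1 comp_endo_id.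
  by rewrite e comp_id_endo.
suff [t2 [p [ht2 e]]] : exists t2 (p : {poly K}), aff t2 /\ F' = app_endo t2 (X2 + p%:P).
  exists (comp_endo t0 t2), p; split; first exact: aff_comp.
  by rewrite app_comp -e.
have appE (q1 q2 : P2 K) (p : {poly K}) :
    app_endo (q1, q2) (X2 + p%:P) = q2 + (map_poly (@cst K) p).[q1].
  by rewrite rmorphD /= app_X2 app_polyC.
have u0' : u != 0 by rewrite -unitfE. have v0' : v != 0 by rewrite -unitfE.
rewrite epsi in fixF' nid'.
have [[a [b [a0 e]]]|[b [p [b0 e]]]|[_ _ _ [a [h [a0 e _]]]]] :=
  triangular_fix_coordinate char0 coF' u0' v0' nid' fixF'.
- exists (afm 0 1 0, afm a 0 b), 0; split; last by rewrite appE e rmorph0 horner0 addr0.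
  by apply: aff_afm; rewrite mul0r mul1r sub0r unitrN unitfE.
- exists (X1, cst b * X2), p; split; last by rewrite appE e horner_cst_at_X1.
  have -> : cst b * X2 = afm 0 b 0 by rewrite /afm !rmorph0 mul0r add0r addr0.
  by rewrite X1_afm; apply: aff_afm; rewrite mul1r mul0r subr0 unitfE.
set G := _ *: _ in e.
have eG : X2 + G%:P = afm G`_1 1 G`_0.
  by apply: afm_X2_polyE; apply: leq_trans (size_scale_leq _ _) (size_linear _ _).
exists (X2 + G%:P, cst a * X1), h; split; last by rewrite appE.
have -> : cst a * X1 = afm a 0 0 by rewrite /afm !rmorph0 mul0r !addr0.
by rewrite eG; apply: aff_afm; rewrite mulr0 mul1r sub0r unitrN unitfE.
Qed.
End AffineFix.

Lemma ntri_X2_poly (T : idomainType) (p : {poly T}) : (2 < size p)%N -> ntri 1 (size p).-1 (X2 + p%:P).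
Proof.
move=> sp; set n := (size p).-1.
split; rewrite ?muln1 //; first by rewrite /n; lia.
- move=> i [|[|j]]; rewrite coefD coefX coefC /= ?add0r ?addr0 ?mulr0 ?addn0.
  + move=> nz; have : (i < size p)%N by rewrite ltnNge; apply: contraNN nz => le; rewrite nth_default.
    by rewrite /n; lia.
  + by rewrite coef1; case: i => [|i] /=; rewrite ?eqxx ?muln1.
  + by rewrite coef0 eqxx.
- by rewrite coefD coefX coefC addr0 coefC oner_neq0.
by rewrite coefD coefX coefC add0r /n -lead_coefE lead_coef_eq0 -size_poly_gt0 (ltn_trans _ sp).
Qed.

(** * Passage from [R] to its field of fractions *)

Section FractionField.
Variable R : idomainType.
Local Notation K := {fraction R}.
Local Notation "x %:F" := (@FracField.tofrac R x).
Implicit Types (f : P2 R) (phi : endo R).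

HB.instance Definition _ := GRing.RMorphism.copy (@toK R) (map_poly (map_poly (@FracField.tofrac R))).

Lemma coef_toK f i j : (toK f)`_j`_i = (f`_j`_i)%:F.
Proof. by rewrite /toK !coef_map. Qed.

Lemma toK_cst (c : R) : toK (cst c) = cst c%:F.
Proof. by rewrite /toK /cst map_polyC /= map_polyC. Qed.

Lemma toK_polyC (g : {poly R}) : toK g%:P = (map_poly (@FracField.tofrac R) g)%:P.
Proof. by rewrite /toK map_polyC. Qed.

Lemma toK_X1 : toK (@X1 R) = X1.
Proof. by rewrite /X1 toK_polyC map_polyX. Qed.

Lemma toK_X2 : toK (@X2 R) = X2.
Proof. by rewrite /toK /X2 map_polyX. Qed.

Lemma tofrac_injective : injective (@FracField.tofrac R).
Proof. by move=> x y /eqP; rewrite tofrac_eq => /eqP. Qed.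

Lemma toK_inj : injective (@toK R).
Proof.
move=> f g e; apply/polyP => j; apply/polyP => i; apply: tofrac_injective.
by rewrite -!coef_toK e.
Qed.

Definition toKe phi : endo K := (toK phi.1, toK phi.2).

Lemma toK_app phi f : toK (app_endo phi f) = app_endo (toKe phi) (toK f).
Proof.
pose u : {rmorphism P2 R -> P2 K} := @toK R \o app_endo phi.
pose v : {rmorphism P2 R -> P2 K} := app_endo (toKe phi) \o @toK R.
apply: (P2_rmorph_ext (u := u) (v := v)) => [c||] /=.
- by rewrite app_cst toK_cst app_cst.
- by rewrite app_X1 toK_X1 app_X1.
- by rewrite app_X2 toK_X2 app_X2.
Qed.

Lemma toK_afm (a1 a2 a0 : R) : toK (afm a1 a2 a0) = afm a1%:F a2%:F a0%:F.
Proof. by rewrite /afm !rmorphD !rmorphM /= !toK_cst toK_X1 toK_X2. Qed.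

Lemma toKe_trg (u c v : R) (g : {poly R}) : toKe (trg u c v g) = trg u%:F c%:F v%:F (map_poly (@FracField.tofrac R) g).
Proof.
apply: pair_congr; first by rewrite toK_afm rmorph0.
by rewrite rmorphD rmorphM /= toK_cst toK_X2 toK_polyC.
Qed.

Lemma toKe_id phi : toKe phi = id_endo K -> phi = id_endo R.
Proof.
case: phi => p q [e1 e2]; apply: pair_congr; apply: toK_inj; first by rewrite e1 toK_X1.
by rewrite e2 toK_X2.
Qed.

Lemma unit_tofrac (u : R) : u \is a GRing.unit -> u%:F != 0.
Proof. by move=> uu; rewrite tofrac_eq0; apply: contraTneq uu => ->; rewrite unitr0. Qed.

Lemma toKe_aff (a : endo R) : aff a -> aff (toKe a).
Proof.
move=> [a1 [a2 [a0 [b1 [b2 [b0 [-> u]]]]]]]; rewrite /toKe /= !toK_afm.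
apply: aff_afm; rewrite -!tofracM -tofracB unitfE; exact: unit_tofrac.
Qed.

Lemma toKe_comp phi psi : toKe (comp_endo phi psi) = comp_endo (toKe phi) (toKe psi).
Proof. by rewrite /toKe /comp_endo /= !toK_app. Qed.

Lemma toKe_aut phi : is_aut phi -> is_aut (toKe phi).
Proof.
have toKid : toKe (id_endo R) = id_endo K by rewrite /toKe /= toK_X1 toK_X2.
by move=> [psi [e1 e2]]; exists (toKe psi); split; rewrite -toKe_comp ?e1 ?e2.
Qed.

Lemma wle_toK d M f : wle d M (toK f) <-> wle d M f.
Proof.
split=> h i j nz; apply: h; first by rewrite coef_toK tofrac_eq0.
by move: nz; rewrite coef_toK tofrac_eq0.
Qed.

Lemma toK_neq0 f i j : (toK f)`_j`_i != 0 -> f`_j`_i != 0.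
Proof. by rewrite coef_toK tofrac_eq0. Qed.

Lemma coordinate_aut (a : endo R) f : is_aut a -> coordinate (toK f) -> coordinate (toK (app_endo a f)).
Proof.
move=> ha [Phi [aPhi e]]; exists (comp_endo (toKe a) Phi); split.
  by apply: is_aut_comp => //; exact: toKe_aut.
by rewrite /= e toK_app.
Qed.

(** If the column [(c2, d2)] of [a] killed the form, the ratio would be [d2 / (- c2)], and the other
    column divided by the determinant supplies the Bezout relation. *)
Lemma nonV_unimodular (al1 al2 : K) (a : endo R) : al1 != 0 -> al2 != 0 -> ~ inV (al1 / al2) -> aff a ->
  al1 * (a.1`_1`_0)%:F + al2 * (a.2`_1`_0)%:F != 0.
Proof.
move=> n1 n2 nV [c1 [c2 [c0 [d1 [d2 [d0 [-> u]]]]]]]; rewrite /= !afm_coef2.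
apply/negP => /eqP e; have d0' : c1 * d2 - c2 * d1 != 0 by apply: contraTneq u => ->; rewrite unitr0.
have c2n : c2 != 0.
  apply/negP => /eqP z; move: e; rewrite z rmorph0 mulr0 add0r => /eqP.
  rewrite mulf_eq0 (negbTE n2) tofrac_eq0 => /eqP z'.
  by move: d0'; rewrite z z' mulr0 mul0r subrr eqxx.
have d2n : d2 != 0.
  apply/negP => /eqP z; move: e; rewrite z rmorph0 mulr0 addr0 => /eqP.
  by rewrite mulf_eq0 (negbTE n1) tofrac_eq0 (negbTE c2n).
apply: nV; exists d2, (- c2); rewrite oppr_eq0; split=> //.
  exists (c1 / (c1 * d2 - c2 * d1)), (d1 / (c1 * d2 - c2 * d1)).
  transitivity ((c1 * d2 - c2 * d1) / (c1 * d2 - c2 * d1)); first by ring.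
  exact: mulrV.
have c2F : (- c2)%:F != 0 by rewrite tofrac_eq0 oppr_eq0.
apply: (mulIf n2); rewrite divfK //; apply: (mulIf c2F).
rewrite mulrAC divfK // rmorphN mulrN.
have h : al1 * c2%:F = - (al2 * d2%:F) by apply/eqP; rewrite -addr_eq0 e.
by rewrite h opprK mulrC.
Qed.

(* The situation of types III-V: the top form of [f] is a power of a non-unimodular linear form. *)
Lemma goodA_intro (f : P2 R) (tau : endo K) (p : {poly K}) (al1 al2 al0 : K) :
  aff tau -> tau.1 = afm al1 al2 al0 -> al1 != 0 -> al2 != 0 -> ~ inV (al1 / al2) ->
  (2 < size p)%N -> toK f = app_endo tau (X2 + p%:P) -> goodA (size p).-1 f.
Proof.
move=> ht e1 n1 n2 nV sp ef; pose n := (size p).-1.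
have tri : ntri 1 n (X2 + p%:P : P2 K) := ntri_X2_poly sp.
have key (b : endo R) : aff b -> wle 1 n (app_endo b f) /\ (app_endo b f)`_n`_0 != 0.
  move=> hb; have hbt : aff (comp_endo (toKe b) tau) by apply: aff_comp => //; exact: toKe_aff.
  have nt : nontri (comp_endo (toKe b) tau).
    rewrite /nontri /comp_endo /= e1 app_afm_gen.
    have := nonV_unimodular n1 n2 nV hb.
    by rewrite !coefD /cst !coefCM !coefC /= addr0 !coef_toK.
  have [] := nontri_ntri hbt nt tri; rewrite muln1 app_comp -ef -toK_app => h1 h2 _.
  by split; [apply/wle_toK | exact: toK_neq0 h2].
split; first by rewrite /n; lia.
  by have [] := key _ (aff_id R); rewrite app_id.
by move=> b /key [].
Qed.

End FractionField.

(** * Explicit shapes and shears that lower their degree *)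

Section Shapes.
Variable S : idomainType.
Implicit Types (F : P2 S) (g h : {poly S}).

Lemma coef_X2_poly (b : S) g i j : (cst b * X2 + g%:P)`_j`_i =
  if j is 0%N then g`_i else if (j == 1%N) && (i == 0%N) then b else 0.
Proof.
rewrite coefD /cst coefCM coefX coefC; case: j => [|[|j]] /=.
- by rewrite mulr0 add0r.
- by rewrite mulr1 addr0 coefC.
- by rewrite mulr0 addr0 coef0.
Qed.

Lemma wle1_linear F : wle 1 1 F -> F = afm F`_0`_1 F`_1`_0 F`_0`_0.
Proof.
move=> wF; apply/polyP => j; apply/polyP => i; rewrite coef_afm !xpair_eqE.
have z i' j' : (1 < i' + j')%N -> F`_j'`_i' = 0.
  by move=> lt; apply/eqP; apply: contraTT lt => /wF; rewrite mul1n -leqNgt.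
by case: i j => [|[|i]] [|[|j]] //=; apply: z; rewrite ?addSn ?addnS.
Qed.

Lemma wle_X2_poly (b : S) g n : (0 < n)%N -> (size g <= n.+1)%N -> wle 1 n (cst b * X2 + g%:P).
Proof.
move=> n0 sg i [|[|j]]; rewrite coef_X2_poly /= ?mul1n ?addn0.
- by move=> nz; rewrite -ltnS; apply: leq_trans sg; rewrite ltnNge; apply: contraNN nz => le; rewrite nth_default.
- by case: i => [|i] //=; rewrite eqxx.
- by rewrite eqxx.
Qed.

Lemma coef_X1_poly2 (a : S) h i j : (cst a * X1 + map_poly polyC h)`_j`_i =
  (if (j == 0%N) && (i == 1%N) then a else 0) + (if i == 0%N then h`_j else 0).
Proof.
rewrite coefD /cst /X1 -polyCM coefC coef_map /= coefD coefC; congr (_ + _).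
case: j => [|j] /=; last by rewrite coef0.
by rewrite coefCM coefX; case: (i == 1%N); rewrite ?mulr1 ?mulr0.
Qed.

Lemma X1_poly2_shape (a : S) h n : (0 < n)%N -> size h = n.+1 ->
  wle 1 n (cst a * X1 + map_poly polyC h) /\
  (cst a * X1 + map_poly polyC h)`_n`_0 = lead_coef h.
Proof.
move=> n0 sh; split; last first.
  by rewrite coef_X1_poly2 lead_coefE sh /= andbF add0r.
move=> i j; rewrite coef_X1_poly2 mul1n; case: i => [|[|i]] /=; rewrite ?andbF ?add0r ?addr0 ?eqxx //.
  by move=> nz; rewrite add0n -ltnS -sh ltnNge; apply: contraNN nz => le; rewrite nth_default.
by case: j => [|j] //=; rewrite eqxx.
Qed.

Lemma shear_X1_poly2_tdeg (a : S) h n p g : (0 < n)%N -> size h = n.+1 -> (0 < p)%N ->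
  (size g <= p.+1)%N ->
  (tdeg (app_endo (shear g) (cst a * X1 + map_poly polyC h)) <= p * n)%N.
Proof.
move=> n0 sh p0 sg; have [wF _] := X1_poly2_shape a n0 sh; apply: tdeg_leq.
have s1 : (size (app_endo (theta 1) (@X1 S)) <= p.+1)%N.
  by rewrite app_X1 /theta /= /X2 size_polyX ltnS.
have s2 : (size (app_endo (theta 1) (X2 + g%:P : P2 S)) <= (p * 1).+1)%N.
  rewrite muln1; apply/wleP => i j; have := @wle_X2_poly 1 g p p0 sg i j.
  by rewrite rmorph1 mul1r.
by have [] := @app_comp_top S 1 n _ 1 (shear g) p _ _ erefl erefl p0 wF s1 s2.
Qed.

Lemma ntri_bounds n d F : ntri n d F -> degx1 F = (d * n)%N /\ tdeg F = (d * n)%N.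
Proof.
move=> [d1 wF _ h1]; have w1 : wle 1 (d * n) F by move=> i j /wF; nia.
have := leq_degx1 h1; have := leq_tdeg h1; have := tdeg_leq w1; have [] := wle1_degx w1.
by lia.
Qed.

(** The premises are chosen so that this follows from least total degree, and also from tame
    reducedness, as shears preserve [degx2]. *)
Definition locmin F := forall g M, degx1 F = M -> tdeg F = M -> (M <= tdeg (app_endo (shear g) F))%N.

Lemma sub_lead_size g (c : S) : (2 < size g)%N -> lead_coef g = c ->
  (size (g - c *: 'X^((size g).-1))%R <= (size g).-1)%N.
Proof.
move=> sg <-; apply/leq_sizeP => j; rewrite leq_eqVlt => /orP[/eqP <-|lt].
  by rewrite coefB coefZ coefXn eqxx mulr1 lead_coefE subrr.
rewrite coefB coefZ coefXn gtn_eqF // mulr0 subr0 nth_default //.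
by case: (size g) sg lt.
Qed.

(** The shear by [- r * x1 ^ d] cancels the leading term of [g]; this is the source of the ideal
    condition in type I. *)
Lemma locmin_X2_poly (b r : S) g : (2 < size g)%N -> lead_coef g = b * r ->
  locmin (cst b * X2 + g%:P) -> False.
Proof.
move=> sg el; pose d := (size g).-1; have sgd : size g = d.+1 by rewrite /d; case: (size g) sg.
have d1 : (1 < d)%N by rewrite -ltnS -sgd.
have nz : (cst b * X2 + g%:P)`_0`_d != 0.
  by rewrite coef_X2_poly /d -lead_coefE lead_coef_eq0 -size_poly_eq0 sgd.
have w1 : wle 1 d (cst b * X2 + g%:P) by apply: wle_X2_poly; rewrite ?sgd // ltnW.
have [e1 e2] : degx1 (cst b * X2 + g%:P) = d /\ tdeg (cst b * X2 + g%:P) = d.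
  have := leq_degx1 nz; have := leq_tdeg nz; have := tdeg_leq w1; have [] := wle1_degx w1.
  by lia.
move=> /(_ (- (r *: 'X^d)) d e1 e2); rewrite app_linX2 app_polyX1 //= mulrDr -addrA.
have -> : cst b * (- (r *: 'X^d))%:P + g%:P = (g - (b * r) *: 'X^d)%:P :> P2 S.
  by rewrite /cst -polyCM -polyCD mulrN mul_polyC scalerA addrC.
have sz : (size (g - (b * r) *: 'X^d)%R <= d)%N by exact: sub_lead_size.
have d0 : (0 < d.-1)%N by case: (d) d1 => [|[]].
have ed : d = d.-1.+1 by case: (d) d1.
have sz' : (size (g - (b * r) *: 'X^d)%R <= d.-1.+1)%N by rewrite -ed.
move=> le; have := leq_trans le (tdeg_leq (@wle_X2_poly b _ d.-1 d0 sz')).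
by rewrite leqNgt -ed leqnn.
Qed.

End Shapes.

(** * Types I and II *)

Section TypesIandII.
Variable R : idomainType.
Local Notation K := {fraction R}.
Local Notation "x %:F" := (@FracField.tofrac R x).
Local Notation toP g := (map_poly (@FracField.tofrac R) g).
Implicit Types (f : P2 R) (g : {poly R}).

Lemma horner_cst_comp (S : comNzRingType) (p r : {poly S}) (Y : P2 S) :
  (map_poly (@cst S) (p \Po r)).[Y] = (map_poly (@cst S) p).[(map_poly (@cst S) r).[Y]].
Proof.
rewrite -(app_polyC (Y, 0)) -(@app_polyC1 _ (r%:P, 0) p r) // -app_comp app_polyC /=.
by rewrite app_polyC.
Qed.

Lemma horner_cst_scaleXn (S : comNzRingType) (c : S) e (Y : P2 S) :
  (map_poly (@cst S) (c *: 'X^e)).[Y] = cst c * Y ^+ e.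
Proof.
by rewrite -(app_polyC (Y, 0)) -mul_polyC polyCM rmorphXn rmorphM rmorphXn /= app_X1 app_cst.
Qed.

Lemma horner_cst_comp_scaleXn (S : comNzRingType) (q : {poly S}) (c : S) e (Y : P2 S) :
  (map_poly (@cst S) (q \Po (c *: 'X^e))).[Y] = (map_poly (@cst S) q).[cst c * Y ^+ e].
Proof. by rewrite horner_cst_comp horner_cst_scaleXn. Qed.

Lemma horner_cst_C (S : comNzRingType) (c : S) (Y : P2 S) : (map_poly (@cst S) c%:P).[Y] = cst c.
Proof. by rewrite map_polyC /= hornerC. Qed.

Lemma afm_X1 (S : comNzRingType) (a c : S) : afm a 0 c = cst a * X1 + cst c.
Proof. by rewrite /afm rmorph0 mul0r addr0. Qed.

Lemma wle1_afm (S : comNzRingType) (a1 a2 a0 : S) : wle 1 1 (afm a1 a2 a0).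
Proof.
move=> i j; rewrite coef_afm mul1n !xpair_eqE.
by case: i j => [|[|i]] [|[|j]] //=; rewrite eqxx.
Qed.

Lemma cst_exp (S : comNzRingType) (c : S) n : cst c ^+ n = cst (c ^+ n).
Proof. by rewrite rmorphXn. Qed.

Lemma size_toP g : size (toP g) = size g.
Proof. by apply: size_map_inj_poly; [exact: tofrac_injective | exact: rmorph0]. Qed.

Lemma lead_toP g : lead_coef (toP g) = (lead_coef g)%:F.
Proof. by rewrite !lead_coefE size_toP coef_map. Qed.

Lemma top_toK d M f : top d M (toK f) = toP (top d M f).
Proof.
apply/polyP => j; rewrite coef_map !top_coef.
by case: leqP => _; rewrite ?coef_toK ?rmorph0.
Qed.

Lemma shear_horner (a' : K) (h G : {poly K}) :
  cst a' * X1 + (map_poly (@cst K) h).[X2 + G%:P] =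
  app_endo (shear G) (cst a' * X1 + map_poly polyC h).
Proof. by rewrite rmorphD rmorphM /= app_cst app_X1 app_map_polyC. Qed.

(* The situation of types I and II: the weighted top form of [f] is a power of
   [x2 + lead_coef G * x1 ^ d] with [lead_coef G] outside [R]. *)
Lemma goodB_intro f (a' : K) (h G : {poly K}) :
  toK f = cst a' * X1 + (map_poly (@cst K) h).[X2 + G%:P] ->
  (1 < size h)%N -> (2 < size G)%N -> (forall r : R, lead_coef G <> r%:F) ->
  goodB (size h).-1 (size G).-1 f.
Proof.
rewrite shear_horner => ef sh sG nR; pose n := (size h).-1; pose d := (size G).-1.
have n0 : (0 < n)%N by rewrite /n -subn1 subn_gt0.
have shn : size h = n.+1 by rewrite /n; case: (size h) sh.
have sGd : size G = d.+1 by rewrite /d; case: (size G) sG.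
have d1 : (1 < d)%N by rewrite -ltnS -sGd.
have [wF cF] := X1_poly2_shape a' n0 shn.
have hn : lead_coef h != 0 by rewrite lead_coef_eq0 -size_poly_eq0 shn.
have [wG tG] := top_shear d1 sGd wF.
rewrite -/(shear G) -ef in wG tG.
have c0 : (cst a' * X1 + map_poly polyC h)`_n`_0 != 0 by rewrite cF.
have [_ _ c1 _] := ntri_shear sG wF c0; rewrite -ef in c1.
split=> //; first exact/wle_toK.
  exact: toK_neq0 c1.
move=> r; rewrite -tofrac_eq0 -horner_map -top_toK tG cF hornerZ horner_exp hornerD hornerX hornerC.
apply: (mulf_neq0 hn); apply: expf_neq0; apply/negP; rewrite addrC addr_eq0 => /eqP e.
by apply: (nR (- r)); rewrite e rmorphN.
Qed.

Lemma tdeg_toK f : tdeg (toK f) = tdeg f.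
Proof.
apply/eqP; rewrite eqn_leq; apply/andP; split; apply: tdeg_leq; last apply/wle_toK.
  by apply/wle_toK; exact: wle_tdeg.
exact: wle_tdeg.
Qed.

(** A shear over [R] cancels the leading term of [G] and lowers the total degree from [d * n] to at
    most [(d - 1) * n]; this is the source of the ideal condition in type II. *)
Lemma locmin_shear f (a' : K) (h G : {poly K}) (r : R) :
  toK f = cst a' * X1 + (map_poly (@cst K) h).[X2 + G%:P] ->
  (1 < size h)%N -> (2 < size G)%N -> lead_coef G = r%:F -> locmin f -> False.
Proof.
rewrite shear_horner => ef sh sG lG; pose n := (size h).-1; pose d := (size G).-1.
have n0 : (0 < n)%N by rewrite /n -subn1 subn_gt0.
have shn : size h = n.+1 by rewrite /n; case: (size h) sh.
have sGd : size G = d.+1 by rewrite /d; case: (size G) sG.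
have d1 : (1 < d)%N by rewrite -ltnS -sGd.
have [wF cF] := X1_poly2_shape a' n0 shn.
have c0 : (cst a' * X1 + map_poly polyC h)`_n`_0 != 0.
  by rewrite cF lead_coef_eq0 -size_poly_eq0 shn.
have := ntri_shear sG wF c0; rewrite -ef => -[_ /wle_toK w1 /toK_neq0 w2 /toK_neq0 w3].
have tri : ntri n d f by split.
have [b1 b2] := ntri_bounds tri.
pose s : {poly R} := - (r *: 'X^d).
move=> /(_ s _ b1 b2); rewrite -tdeg_toK toK_app ef.
have es : toKe (shear s) = shear (toP s).
  by rewrite !shearE toKe_trg tofrac1 tofrac0.
rewrite es -app_comp shear_comp.
have sz : (size (toP s + G)%R <= d)%N.
  by rewrite /s rmorphN /= map_polyZ map_polyXn /= addrC; exact: sub_lead_size.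
have d0 : (0 < d.-1)%N by case: (d) d1 => [|[]].
have := @shear_X1_poly2_tdeg K a' h n d.-1 (toP s + G) n0 shn d0.
rewrite prednK ?(ltnW d1) // => /(_ sz) le1 le2; have := leq_trans le2 le1.
by rewrite leq_pmul2r // leqNgt ltn_predL (ltnW d1).
Qed.

Lemma horner_cst_rescale (F : fieldType) (h1 : {poly F}) (c : F) e (Y : P2 F) : c != 0 ->
  (map_poly (@cst F) (h1 \Po 'X^e)).[Y] =
  (map_poly (@cst F) (h1 \Po (c ^- e *: 'X))).[(cst c * Y) ^+ e].
Proof.
move=> c0; rewrite -['X in RHS]expr1 horner_cst_comp_scaleXn expr1 exprMn mulrA !cst_exp -rmorphM /=.
by rewrite mulVf ?expf_neq0 // rmorph1 mul1r horner_cst_comp -['X^e]scale1r horner_cst_scaleXn rmorph1 mul1r.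
Qed.

Lemma horner_cst_const (F : idomainType) (h G : {poly F}) c :
  (map_poly (@cst F) h).[X2 + G%:P] = cst c -> (size h <= 1)%N.
Proof.
rewrite horner_cst => /(congr1 (fun p : P2 F => size p)).
rewrite size_comp_poly2; last by rewrite -[G%:P]opprK -polyCN /X2 size_XsubC.
by rewrite size_map_polyC => ->; rewrite size_polyC_leq1.
Qed.

Lemma typeI_or_linear f (b : K) (p : {poly K}) : b != 0 -> toK f = cst b * X2 + p%:P ->
  locmin f -> typeI f \/ wle 1 1 f.
Proof.
move=> b0 ef lm; set b1 := f`_1`_0; set g := f`_0.
have eb : b = b1%:F by rewrite -[RHS](coef_toK f 0 1) ef coef_X2_poly.
have ep : p = toP g by apply/polyP => i; rewrite coef_map -[RHS](coef_toK f i 0) ef coef_X2_poly.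
have e : f = cst b1 * X2 + g%:P.
  by apply: toK_inj; rewrite ef rmorphD rmorphM /= toK_cst toK_X2 toK_polyC eb ep.
clearbody g b1; have [sg|sg] := leqP (size g) 2.
  by right; rewrite e; apply: wle_X2_poly.
left; exists b1, g; split=> //; first by rewrite -tofrac_eq0 -eb.
  by case: (size g) sg => [|[|]].
by move=> [r er]; apply: (@locmin_X2_poly _ b1 r g) => //; rewrite -e.
Qed.

(** Taylor expansion modulo [a]. The map [x1 + a], [x2 - s] then fixes [a * x2 + g]. *)
Lemma translation_divisible g (a : R) : exists s, g \Po ('X + a%:P) = g + a *: s.
Proof.
elim/poly_ind: g => [|g c [s IH]]; first by exists 0; rewrite comp_poly0 scaler0 addr0.
exists (g + s * 'X + a *: s).
rewrite comp_polyD comp_polyM comp_polyX comp_polyC IH -!mul_polyC; ring.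
Qed.

Lemma typeI_spec f : typeI f -> H_nontrivial f /\ exists n d, goodB n d f.
Proof.
move=> [a [g [a0 dg nl e]]]; split.
  have [s es] := translation_divisible g a.
  exists (trg 1 a 1 (- s)); split; last split.
  - by apply: tame_triangular; exists 1, a, 1, (- s); rewrite unitr1.
  - rewrite e app_linX2 (@app_polyC1 _ _ _ ('X + a%:P)) ?es //=; last by rewrite afm0E scale1r.
    by rewrite rmorph1 mul1r polyCD -mul_polyC polyCM /cst; ring.
  rewrite id_trg => /(congr1 fst) /= /afm_inj [_ _ /eqP]; exact/negP.
have aF : a%:F != 0 by rewrite tofrac_eq0.
pose h : {poly K} := a%:F *: 'X; pose G := (a%:F)^-1 *: toP g.
have sh : size h = 2%N by rewrite /h size_scale ?size_polyX.
have sG : size G = size g by rewrite /G size_scale ?invr_eq0 // size_toP.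
exists (size h).-1, (size G).-1; apply: (@goodB_intro f 0 h G).
- rewrite rmorph0 mul0r add0r e rmorphD rmorphM /= toK_cst toK_X2 toK_polyC.
  rewrite /h -['X]expr1 horner_cst_scaleXn expr1 mulrDr; congr (_ + _).
  by rewrite /cst -polyCM /G mul_polyC scalerA mulfV // scale1r.
- by rewrite sh.
- by rewrite sG; case: (size g) dg => [|[|]].
move=> r; rewrite /G lead_coefZ lead_toP => er; apply: nl; exists r.
by apply: tofrac_injective; rewrite tofracM -er mulrA mulfV // mul1r.
Qed.

Section LocalizedRing.
Variable zeta : R.
Hypothesis zeta_n1 : zeta != 1.
Local Notation z := (zeta%:F - 1).

Lemma z_neq0 : z != 0 :> K.
Proof. by rewrite -tofrac1 subr_eq0 tofrac_eq. Qed.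

Lemma inRp_tofrac (r : R) : inRp zeta r%:F.
Proof. by exists r, 0%N; rewrite expr0 divr1. Qed.

Lemma inRp0 : inRp zeta 0.
Proof. by exists 0, 0%N; rewrite tofrac0 mul0r. Qed.

Lemma inRpD (c d : K) : inRp zeta c -> inRp zeta d -> inRp zeta (c + d).
Proof.
move=> [r [k ->]] [s [l ->]]; exists (r * (zeta - 1) ^+ l + s * (zeta - 1) ^+ k), (k + l)%N.
have zk := expf_neq0 k z_neq0; have zl := expf_neq0 l z_neq0.
rewrite exprD tofracD !tofracM !tofracXn tofracB tofrac1.
by rewrite addf_div.
Qed.

Lemma inRpM (c d : K) : inRp zeta c -> inRp zeta d -> inRp zeta (c * d).
Proof.
move=> [r [k ->]] [s [l ->]]; exists (r * s), (k + l)%N.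
by rewrite exprD tofracM mulf_div.
Qed.

Lemma inRp_inv n : inRp zeta (z ^- n).
Proof. by exists 1, n; rewrite tofrac1 mul1r. Qed.

Lemma inRp_sum (I : Type) (s : seq I) (P : pred I) (F : I -> K) :
  (forall i, P i -> inRp zeta (F i)) -> inRp zeta (\sum_(i <- s | P i) F i).
Proof.
move=> h; elim/big_ind: _ => // [|c d]; last exact: inRpD.
exact: inRp0.
Qed.

Definition allRp (F : P2 K) := forall i j, inRp zeta F`_j`_i.

Lemma allRp_cst c : inRp zeta c -> allRp (cst c).
Proof.
have -> : cst c = afm 0 0 c by rewrite /afm !rmorph0 !mul0r !add0r.
by move=> h i j; rewrite coef_afm; do 3 (case: ifP => _; first by [exact: inRp0 | exact: h]); exact: inRp0.
Qed.

Lemma allRpM F G : allRp F -> allRp G -> allRp (F * G).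
Proof.
move=> hF hG i j; rewrite coefM coef_sum; apply: inRp_sum => k _.
by rewrite coefM; apply: inRp_sum => l _; apply: inRpM.
Qed.

Lemma allRpD F G : allRp F -> allRp G -> allRp (F + G).
Proof. by move=> hF hG i j; rewrite !coefD; apply: inRpD. Qed.

Lemma allRpX F n : allRp F -> allRp (F ^+ n).
Proof.
move=> hF; elim: n => [|n IH]; last by rewrite exprS; apply: allRpM.
by rewrite expr0 -(rmorph1 (@cst K)); apply: allRp_cst; rewrite -tofrac1; exact: inRp_tofrac.
Qed.

Lemma allRp_sum (I : Type) (s : seq I) (P : pred I) (F : I -> P2 K) :
  (forall i, P i -> allRp (F i)) -> allRp (\sum_(i <- s | P i) F i).
Proof.
move=> h; elim/big_ind: _ => // [|c d]; last exact: allRpD.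
by rewrite -(rmorph0 (@cst K)); apply: allRp_cst; exact: inRp0.
Qed.

Lemma allRp_app phi F : allRp phi.1 -> allRp phi.2 -> allRp F -> allRp (app_endo phi F).
Proof.
move=> h1 h2 hF; rewrite /app_endo /comp2; apply: allRp_sum => j _.
apply: allRpM; last exact: allRpX.
by apply: allRp_sum => i _; apply: allRpM; [apply: allRp_cst | apply: allRpX].
Qed.

Lemma allRp_toK f : allRp (toK f).
Proof. by move=> i j; rewrite coef_toK; exact: inRp_tofrac. Qed.

(* Undoing the shear shows that the coefficients of [f] in terms of [x1] and [y2] lie in [R']. *)
Lemma allRp_unshear f g (a' : K) (h : {poly K}) :
  toK f = cst a' * X1 + (map_poly (@cst K) h).[X2 + (z^-1 *: toP g)%:P] ->
  allRp (cst a' * X1 + map_poly polyC h).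
Proof.
rewrite shear_horner => ef; set F := cst a' * X1 + _.
have -> : F = app_endo (shear (- (z^-1 *: toP g))) (toK f).
  by rewrite ef app_inv //; exact: shear_inv.
apply: allRp_app; last exact: allRp_toK.
  by rewrite /= -toK_X1; exact: allRp_toK.
rewrite /=; apply: allRpD; first by rewrite -toK_X2; exact: allRp_toK.
move=> i j; rewrite coefC; case: eqP => _; last by rewrite coef0; exact: inRp0.
rewrite coefN coefZ coef_map -mulrN /=; apply: inRpM.
  by rewrite -[z^-1]/(z ^- 1); exact: inRp_inv.
by have := inRp_tofrac (- g`_i); rewrite tofracN.
Qed.

End LocalizedRing.

Lemma poly_in_Xn (T : comNzRingType) (h : {poly T}) e : (0 < e)%N ->
  (forall i, h`_i != 0 -> (e %| i)%N) -> h = (\poly_(j < size h) h`_(j * e)%N) \Po 'X^e.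
Proof.
move=> e0 hd; apply/polyP => i; rewrite coef_comp_poly_Xn //; case: ifP => [d|nd]; last first.
  by apply/eqP; apply: contraFT nd => /hd.
rewrite coef_poly divnK //; case: ltnP => // le.
by rewrite nth_default // (leq_trans le) // leq_divLR // leq_pmulr.
Qed.

Lemma cst_mul_scaleV (F : fieldType) (c : F) (p : {poly F}) :
  c != 0 -> cst c * (c^-1 *: p)%:P = p%:P.
Proof. by move=> c0; rewrite /cst -polyCM mul_polyC scalerA mulfV // scale1r. Qed.

Lemma y2E (zeta : R) g : zeta != 1 ->
  toK (cst (zeta - 1) * X2 + g%:P) = cst (zeta%:F - 1) * (X2 + ((zeta%:F - 1)^-1 *: toP g)%:P).
Proof.
move=> n1; rewrite rmorphD rmorphM /= toK_cst toK_X2 toK_polyC tofracB tofrac1 mulrDr.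
by rewrite cst_mul_scaleV // z_neq0.
Qed.

Lemma typeII_spec f : typeII f -> H_nontrivial f /\ exists n d, goodB n d f.
Proof.
move=> [a' [hh [a'0 [ef [zeta [e [zn1 e2 ze _ [g [dg nl [[q [hq eh]] nc]]]]]]]]]].
set y2 := toK _ in eh; pose z := zeta%:F - 1; have z0 : z != 0 by exact: z_neq0.
have ey : y2 = cst z * (X2 + (z^-1 *: toP g)%:P) by exact: y2E.
have uz : zeta \is a GRing.unit.
  by apply/unitrPr; exists (zeta ^+ e.-1); rewrite -exprS prednK // ltnW.
have sg : (2 < size g)%N by case: (size g) dg => [|[|]].
split.
  (* This map fixes [x1] and sends [y2 = (zeta - 1) * x2 + g] to [zeta * y2], so it fixes
     [y2 ^ e]. *)
  exists (trg 1 0 zeta g); split; last split.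
  - by apply: tame_triangular; exists 1, 0, zeta, g; rewrite unitr1.
  - apply: toK_inj; rewrite toK_app ef eh.
    have t1 : (toKe (trg 1 0 zeta g)).1 = X1 by rewrite /= -X1_afm toK_X1.
    have ty : app_endo (toKe (trg 1 0 zeta g)) y2 = cst zeta%:F * y2.
      rewrite /y2 -toK_app -toK_cst -rmorphM /=; congr toK.
      have e1 : (trg 1 0 zeta g).1 = X1 by rewrite X1_afm.
      rewrite app_linX2 (app_polyX1 _ e1) -[(trg 1 0 zeta g).2]/(cst zeta * X2 + g%:P).
      have -> : cst zeta = cst (zeta - 1) + 1 by rewrite -(rmorph1 (@cst R)) -rmorphD subrK.
      by move: (cst (zeta - 1)) X2 g%:P => D x y; ring.
    rewrite rmorphD rmorphM /= app_cst app_X1 t1; congr (_ + _).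
    rewrite -[in LHS](app_polyC (y2 ^+ e, 0)) -app_comp app_polyC /=.
    by rewrite rmorphXn /= ty exprMn -rmorphXn /= -tofracXn ze tofrac1 rmorph1 mul1r.
  rewrite id_trg => /(congr1 (fun t : endo R => t.2`_1`_0)).
  by rewrite /= !coef_X2_poly /= => /eqP; rewrite (negbTE zn1).
pose h := q \Po ((z ^+ e) *: 'X^e); pose G := z^-1 *: toP g.
have ehh : hh = (map_poly (@cst K) h).[X2 + G%:P].
  transitivity ((map_poly (@cst K) q).[cst (z ^+ e) * (X2 + G%:P) ^+ e]).
    by rewrite eh; congr (_.[_]); rewrite ey exprMn cst_exp.
  exact: (esym (@horner_cst_comp_scaleXn K q (z ^+ e) e (X2 + G%:P))).
have sq : (1 < size q)%N.
  rewrite ltnNge; apply/negP => /size1_polyC; have := hq 0%N; move: (q`_0) => c hc eq.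
  apply: nc; exists c; split=> //; rewrite eh eq; exact: (@horner_cst_C K).
have sG : size G = size g by rewrite /G size_scale ?invr_eq0 // size_toP.
have sh : (size h).-1 = ((size q).-1 * e)%N.
  by rewrite /h size_comp_poly size_scale ?expf_neq0 // size_polyXn.
rewrite ehh in ef; exists (size h).-1, (size G).-1; apply: (goodB_intro ef); rewrite ?sG //.
  have : (0 < (size q).-1 * e)%N by rewrite muln_gt0 (ltnW e2) andbT -subn1 subn_gt0.
  by rewrite -sh; case: (size h) => [|[]].
move=> r er; apply: nl; exists r; apply: tofrac_injective.
rewrite tofracM tofracB tofrac1 -/z -er /G lead_coefZ lead_toP mulrA mulfV //.
by rewrite mul1r.
Qed.

Lemma triangular_stab_types f phi : (forall n, n.+1%:R != 0 :> K) -> coordinate (toK f) -> locmin f ->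
    triangular phi -> phi <> id_endo R -> app_endo phi f = f ->
  [\/ typeI f, typeII f, wle 1 1 f | aff phi].
Proof.
move=> char0 cof lm [u [c [v [g [uu uv ephi]]]]] nid fixf.
have nidK : trg u%:F c%:F v%:F (toP g) <> id_endo K.
  by rewrite -toKe_trg -ephi => /toKe_id.
have fixK : app_endo (trg u%:F c%:F v%:F (toP g)) (toK f) = toK f.
  by rewrite -toKe_trg -ephi -toK_app fixf.
have [[a [b [a0 e]]]|[b [p [b0 e]]]|[u1 c0 v1 [a' [h [a'0 e hv]]]]] :=
  triangular_fix_coordinate char0 cof (unit_tofrac uu) (unit_tofrac uv) nidK fixK.
- by constructor 3; apply/wle_toK; rewrite e; exact: wle1_afm.
- by have [h|h] := typeI_or_linear b0 e lm; [constructor 1 | constructor 3].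
have {}u1 : u = 1 by apply: tofrac_injective; rewrite u1 tofrac1.
have {}c0 : c = 0 by apply: tofrac_injective; rewrite c0 tofrac0.
have {}v1 : v != 1 by rewrite -tofrac_eq tofrac1.
(* For linear [g] type II is out of reach, but [phi] is affine and is left to the affine
   analysis. *)
have [sg|sg] := leqP (size g) 2.
  constructor 4; rewrite ephi u1 c0.
  rewrite (size2_polyE sg) -aff_trg; apply: aff_afm.
  by rewrite mul1r mul0r subr0.
set G := _ *: _ in e.
have z0 : v%:F - 1 != 0 := z_neq0 v1.
have sG : size G = size g by rewrite /G size_scale ?invr_eq0 // size_toP.
have [sh|sh] := leqP (size h) 1.
  have [c1 eh] : exists c1, h = c1%:P by exists h`_0; exact: size1_polyC.
  constructor 3; apply/wle_toK; rewrite e eh (@horner_cst_C K) -afm_X1; exact: wle1_afm.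
(* Invariance of [h] under scaling by [v] confines its exponents to multiples of the order of [v],
   which serves as the [e] of type II. *)
have vpow i : h`_i != 0 -> v ^+ i = 1.
  move=> nz; apply: tofrac_injective; rewrite tofracXn tofrac1; apply: (mulIf nz).
  by rewrite mul1r -coef_comp_scale hv.
pose n := (size h).-1; have hn : h`_n != 0 by rewrite -lead_coefE lead_coef_eq0 -size_poly_gt0 ltnW.
have n0 : (0 < n)%N by rewrite /n -subn1 subn_gt0.
have [e1 pe _] := prim_order_exists n0 (vpow _ hn).
have e2 : (1 < e1)%N.
  rewrite ltn_neqAle (prim_order_gt0 pe) andbT; apply: contraNneq v1 => E.
  by rewrite -E in pe; have := prim_expr_order pe; rewrite expr1 => ->.
constructor 2; pose h1 := \poly_(j < size h) h`_(j * e1)%N.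
have eh : h = h1 \Po 'X^e1.
  by apply: poly_in_Xn => [|i /vpow vi]; [exact: ltnW | rewrite (prim_order_dvd pe) vi].
pose z := v%:F - 1; have all_h := allRp_unshear v1 e.
(* [y2] is [z] times [X2 + G], whence the factor [z ^- e1]; it stays in the localisation [R']. *)
pose q := h1 \Po (z ^- e1 *: 'X).
exists a', ((map_poly (@cst K) h).[X2 + G%:P]); split=> //; split=> //.
exists v, e1; split=> //; first exact: prim_expr_order.
  by have := all_h 1%N 0%N; rewrite coef_X1_poly2 /= addr0.
exists g; split; first by case: (size g) sg => [|[|]].
- move=> [r er]; apply: (@locmin_shear f a' h G r) => //; rewrite ?sG //.
  by rewrite /G lead_coefZ lead_toP er tofracM tofracB tofrac1 mulKf.
rewrite y2E //; split.
  exists q; split.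
    move=> i; rewrite /q coef_comp_scale -exprVn -exprM; apply: inRpM => //.
      by rewrite exprVn; exact: inRp_inv.
    rewrite coef_poly; case: ifP => _; last exact: inRp0.
    case: i => [|i].
      by have := all_h 0%N 0%N; rewrite coef_X1_poly2 /= add0r mul0n.
    by have := all_h 0%N (i.+1 * e1)%N; rewrite coef_X1_poly2 /= andbF add0r.
  rewrite {1}eh; exact: horner_cst_rescale.
by move=> [c1 [_ /horner_cst_const]]; rewrite leqNgt sh.
Qed.

End TypesIandII.

(** * Types III, IV and V *)

Section QuadraticForms.
Variable S : comNzRingType.

Definition quad (A B C E F G : S) : P2 S :=
  (A *: 'X^2 + E *: 'X + G%:P)%:P + (B *: 'X + F%:P)%:P * 'X + C%:P%:P * 'X^2.

Lemma quadE A B C E F G : quad A B C E F G =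
  cst A * X1 ^+ 2 + cst B * X1 * X2 + cst C * X2 ^+ 2 + cst E * X1 + cst F * X2 + cst G.
Proof. by rewrite /quad /cst /X1 /X2 -!mul_polyC !polyCD !polyCM; ring. Qed.

Lemma coef_quad A B C E F G j : (quad A B C E F G)`_j =
  if j is 0%N then A *: 'X^2 + E *: 'X + G%:P else if j is 1%N then B *: 'X + F%:P
  else if j is 2%N then C%:P else 0.
Proof.
rewrite /quad !coefD !coefCM coefC coefX coefXn.
by case: j => [|[|[|j]]] /=; rewrite ?mulr0 ?mulr1 ?add0r ?addr0.
Qed.

Lemma quad_inj A B C E F G A' B' C' E' F' G' :
  quad A B C E F G = quad A' B' C' E' F' G' ->
  [/\ A = A', B = B', C = C', E = E' & F = F'].
Proof.
move=> e; have c j := congr1 (fun p : P2 S => p`_j) e.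
move: (c 0%N) (c 1%N) (c 2%N); rewrite !coef_quad => e0 e1 e2.
split.
- by move: (congr1 (fun p : {poly S} => p`_2) e0); rewrite !coefD !coefZ !coefXn !coefX !coefC /= !mulr1 !mulr0 !addr0.
- by move: (congr1 (fun p : {poly S} => p`_1) e1); rewrite !coefD !coefZ !coefX !coefC /= !mulr1 !addr0.
- by move: (congr1 (fun p : {poly S} => p`_0) e2); rewrite !coefC.
- by move: (congr1 (fun p : {poly S} => p`_1) e0); rewrite !coefD !coefZ !coefXn !coefX !coefC /= !mulr1 !mulr0 !addr0 !add0r.
- by move: (congr1 (fun p : {poly S} => p`_0) e1); rewrite !coefD !coefZ !coefX !coefC /= !mulr0 !add0r.
Qed.

Lemma wle2_quad (f : P2 S) : wle 1 2 f ->
  f = quad f`_0`_2 f`_1`_1 f`_2`_0 f`_0`_1 f`_1`_0 f`_0`_0.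
Proof.
move=> wf; have z i j : (2 < i + j)%N -> f`_j`_i = 0.
  by move=> lt; apply/eqP; apply: contraTT lt => /wf; rewrite mul1n -leqNgt.
apply/polyP => j; rewrite coef_quad; apply/polyP => i.
case: j => [|[|[|j]]]; rewrite ?coefD ?coefZ ?coefXn ?coefX ?coefC ?coef0.
- by case: i => [|[|[|i]]] /=; rewrite ?mulr1 ?mulr0 ?addr0 ?add0r //; apply: z; lia.
- by case: i => [|[|i]] /=; rewrite ?mulr1 ?mulr0 ?addr0 ?add0r //; apply: z; lia.
- by case: i => [|i] //=; apply: z; lia.
- by rewrite if_same; apply: z; lia.
Qed.

Lemma quad_square (a al1 al2 be1 be2 be0 : S) :
  cst a * afm al1 al2 0 ^+ 2 + afm be1 be2 be0 =
  quad (a * al1 ^+ 2) (2 * a * al1 * al2) (a * al2 ^+ 2) be1 be2 be0.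
Proof. by rewrite quadE /afm !rmorphM /= rmorph0 rmorph_nat; ring. Qed.

(* The time-2 flow of the derivation [x1 |-> f_x2, x2 |-> -f_x1], for [f = quad A B C E F G]. *)
Definition quad_flow (A B C E F : S) : endo S :=
  (afm (1 + 2 * B) (4 * C) (2 * F + 2 * B * F - 4 * C * E),
   afm (- (4 * A)) (1 - 2 * B) (- (2 * E) - 4 * A * F + 2 * B * E)).

(** Vanishing of the discriminant makes the linear part of the derivation square to zero, so the
    flow is polynomial of degree two in the time [t]; [t = 2] keeps [t ^ 2 / 2] integral. *)
Lemma quad_flow_fix A B C E F G : B ^+ 2 = 4 * A * C ->
  app_endo (quad_flow A B C E F) (quad A B C E F G) = quad A B C E F G.
Proof.
move=> hB; rewrite quadE !rmorphD !rmorphM /= !app_cst !app_X1 !app_X2 /= /afm.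
have {hB} hB : cst B ^+ 2 = 4 * cst A * cst C.
  by rewrite cst_exp hB !rmorphM /= rmorph_nat.
have cD (u v : S) : cst (u + v) = cst u + cst v by exact: rmorphD.
have cN (u : S) : cst (- u) = - cst u by exact: rmorphN.
have cM (u v : S) : cst (u * v) = cst u * cst v by exact: rmorphM.
have cn n : cst (n%:R : S) = n%:R by exact: rmorph_nat.
have c1 : cst (1 : S) = 1 by exact: rmorph1.
rewrite !cD !cN !cM !cn !c1.
move: (cst A) (cst B) (cst C) (cst E) (cst F) (cst G) X1 X2 hB => a b c e f' g x y hb.
ring: hb.
Qed.

End QuadraticForms.

Lemma aff_snd (S : idomainType) (tau : endo S) : aff tau -> exists b1 b2 b0, tau.2 = afm b1 b2 b0.
Proof. by move=> [t1 [t2 [t0 [b1 [b2 [b0 [-> _]]]]]]]; exists b1, b2, b0. Qed.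

Lemma aff_det (S : idomainType) (tau : endo S) a1 a2 a0 b1 b2 b0 :
  aff tau -> tau.1 = afm a1 a2 a0 -> tau.2 = afm b1 b2 b0 -> a1 * b2 - a2 * b1 \is a GRing.unit.
Proof.
by move=> [c1 [c2 [c0 [d1 [d2 [d0 [-> u]]]]]]] /= /afm_inj [<- <- _] /afm_inj [<- <- _].
Qed.

Lemma cst_mul_afm (S : comNzRingType) (x a b c : S) :
  cst x * afm a b c = afm (x * a) (x * b) (x * c).
Proof. by rewrite /afm !rmorphM /=; ring. Qed.

Section LinearAlgebra.
Variable F : fieldType.

(* The automorphism [l1 |-> zeta * l1, l2 |-> l2] in the coordinates [x1, x2], where
   [k = (zeta - 1) / (al1 * be2 - al2 * be1)]. *)
Definition homology (k al1 al2 al0 be1 be2 : F) : endo F :=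
  (afm (1 + k * al1 * be2) (k * al2 * be2) (k * al0 * be2),
   afm (- (k * al1 * be1)) (1 - k * al2 * be1) (- (k * al0 * be1))).

Lemma homology_fix (k z al1 al2 al0 be1 be2 be0 : F) : k * (al1 * be2 - al2 * be1) = z - 1 ->
  app_endo (homology k al1 al2 al0 be1 be2) (afm al1 al2 al0) = cst z * afm al1 al2 al0 /\
  app_endo (homology k al1 al2 al0 be1 be2) (afm be1 be2 be0) = afm be1 be2 be0.
Proof.
move=> hk; have -> : z = 1 + k * (al1 * be2 - al2 * be1) by rewrite hk addrC subrK.
by rewrite cst_mul_afm !app_afm; split; apply: afm_congr; ring.
Qed.

(** Converse of [homology_fix]. For an affine map over [R] it identifies the quantities in condition
    (c) of type V with matrix entries. *)
Lemma homology_unique (z c1 c2 c0 d1 d2 d0 al1 al2 al0 be1 be2 be0 : F) :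
    al1 * be2 - al2 * be1 != 0 ->
    app_endo (afm c1 c2 c0, afm d1 d2 d0) (afm al1 al2 al0) = cst z * afm al1 al2 al0 ->
    app_endo (afm c1 c2 c0, afm d1 d2 d0) (afm be1 be2 be0) = afm be1 be2 be0 ->
  let k := (z - 1) / (al1 * be2 - al2 * be1) in
  [/\ k * al1 * be2 = c1 - 1, k * al2 * be2 = c2, k * al0 * be2 = c0 &
  [/\ k * al1 * be1 = - d1, k * al2 * be1 = 1 - d2, k * al0 * be1 = - d0 & z = c1 + d2 - 1]].
Proof.
move=> D0; rewrite cst_mul_afm !app_afm => /afm_inj [e1 e2 e0] /afm_inj [f1 f2 f0] k.
have kD : k * (al1 * be2 - al2 * be1) = z - 1 by rewrite divfK.
have {e0} e0 : al1 * c0 + al2 * d0 = z * al0 - al0 by rewrite -e0 addrK.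
have {f0} f0 : be1 * c0 + be2 * d0 = 0 by apply: (addIr be0); rewrite add0r.
(* Cramer's rule, used once for each column of the map minus the identity. *)
have main x1 x2 y a : al1 * x1 + al2 * x2 = (z - 1) * a -> be1 * x1 + be2 * x2 = 0 ->
    y = k * a -> y * be2 = x1 /\ y * be1 = - x2.
  move=> h1 h2 ->; split; apply: (mulIf D0).
    transitivity (k * (al1 * be2 - al2 * be1) * a * be2); first by ring.
    rewrite kD -h1; transitivity (x1 * (al1 * be2 - al2 * be1) + al2 * (be1 * x1 + be2 * x2)); first by ring.
    by rewrite h2; ring.
  transitivity (k * (al1 * be2 - al2 * be1) * a * be1); first by ring.
  rewrite kD -h1; transitivity (- x2 * (al1 * be2 - al2 * be1) + al1 * (be1 * x1 + be2 * x2)); first by ring.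
  by rewrite h2; ring.
have [r1 r2] : k * al1 * be2 = c1 - 1 /\ k * al1 * be1 = - d1.
  apply: main => //; first by rewrite mulrBr mulr1 addrAC e1; ring.
  by rewrite mulrBr mulr1 addrAC f1 subrr.
have [s1 s2] : k * al2 * be2 = c2 /\ k * al2 * be1 = - (d2 - 1).
  apply: main => //; first by rewrite mulrBr mulr1 addrA e2; ring.
  by rewrite mulrBr mulr1 addrA f2 subrr.
have [t1 t2] : k * al0 * be2 = c0 /\ k * al0 * be1 = - d0.
  by apply: main => //; rewrite e0; ring.
split=> //; split=> //; first by rewrite s2 opprB.
apply: (addIr (-1)); rewrite -kD.
transitivity (k * al1 * be2 - k * al2 * be1); first by ring.
by rewrite r1 s2; ring.
Qed.

End LinearAlgebra.

Lemma perfect_square (S : comNzRingType) (a x y : S) :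
  (2 * a * x * y) ^+ 2 = 4 * (a * x ^+ 2) * (a * y ^+ 2).
Proof. by ring. Qed.

Lemma det_homology (S : comNzRingType) (k a1 a2 b1 b2 : S) :
  (1 + k * a1 * b2) * (1 - k * a2 * b1) - k * a2 * b2 * - (k * a1 * b1) =
  1 + k * (a1 * b2 - a2 * b1).
Proof. by ring. Qed.

Lemma horner_cst_scale_inv (S : comNzRingType) (g q : {poly S}) e (z : S) (Y : P2 S) :
  g = 'X^e * (q \Po 'X^e) -> z ^+ e = 1 ->
  (map_poly (@cst S) g).[cst z * Y] = (map_poly (@cst S) g).[Y].
Proof.
move=> -> ze; rewrite -['X^e]scale1r rmorphM /= !hornerM !horner_cst_scaleXn.
by rewrite !horner_cst_comp_scaleXn exprMn cst_exp ze rmorph1 !mul1r.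
Qed.

Lemma app_scaled_axis (S : comNzRingType) (phi tau : endo S) (g q : {poly S}) e (z : S) :
  g = 'X^e * (q \Po 'X^e) -> z ^+ e = 1 ->
  app_endo phi tau.1 = cst z * tau.1 -> app_endo phi tau.2 = tau.2 ->
  app_endo phi (app_endo tau (X2 + g%:P)) = app_endo tau (X2 + g%:P).
Proof.
move=> eg ze h1 h2; rewrite -app_comp !rmorphD /= !app_X2 !app_polyC /= h1 h2.
by rewrite (horner_cst_scale_inv _ eg ze).
Qed.

Section TypesIIItoV.
Variable R : idomainType.
Local Notation K := {fraction R}.
Local Notation "x %:F" := (@FracField.tofrac R x).
Hypothesis hZ : injective (fun z : int => (z%:~R : R)).
Implicit Types (f : P2 R).

Lemma natr_neq0 n : n.+1%:R != 0 :> R.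
Proof.
apply/eqP => e; have : n.+1%:Z = 0 by apply: hZ; rewrite mulr0z -[LHS]/(n.+1%:R).
by [].
Qed.

Lemma natr_neq0K n : n.+1%:R != 0 :> K.
Proof. by have := natr_neq0 n; rewrite -tofrac_eq0 rmorph_nat. Qed.

Lemma typeIII_spec f : typeIII f -> H_nontrivial f /\ exists k, goodA k f.
Proof.
move=> [a1 [a2 [b [a10 a20 e nV]]]]; have {}e : f = afm a1 a2 b by [].
split.
  exists (afm 1 0 a2, afm 0 1 (- a1)); split; last split.
  - by apply: tame_aff; apply: aff_afm; rewrite mulr1 mul0r subr0 unitr1.
  - by rewrite e app_afm; apply: afm_congr; ring.
  rewrite id_endoE => /(congr1 fst) /= /afm_inj [_ _ /eqP]; exact/negP.
exists 1%N; split=> //; first by rewrite e; exact: wle1_afm.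
move=> a ha; have n1 : a1%:F != 0 by rewrite tofrac_eq0.
have n2 : a2%:F != 0 by rewrite tofrac_eq0.
have := nonV_unimodular n1 n2 nV ha; rewrite -!tofracM -tofracD tofrac_eq0.
by rewrite e app_afm_gen !coefD /cst !coefCM !coefC /= addr0.
Qed.

Lemma afm_nz (al1 al2 : K) : cst al1 * X1 + cst al2 * X2 = afm al1 al2 0.
Proof. by rewrite /afm rmorph0 addr0. Qed.

Lemma toK_quad (A B C E G H : R) :
  toK (quad A B C E G H) = quad A%:F B%:F C%:F E%:F G%:F H%:F.
Proof. by rewrite !quadE !rmorphD !rmorphM /= !toK_cst toK_X1 toK_X2. Qed.

Lemma typeIV_spec f : typeIV f -> H_nontrivial f /\ exists k, goodA k f.
Proof.
move=> [a [tau [al1 [al2 [a0 /affP ht et [n1 n2 nV] ef]]]]].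
have aF : a%:F != 0 by rewrite tofrac_eq0.
rewrite afm_nz in et.
have gf : goodA 2 f.
  have sp : size (a%:F *: 'X^2 : {poly K}) = 3%N by rewrite size_scale // size_polyXn.
  rewrite -[2%N]/(3.-1) -sp; apply: (goodA_intro ht et n1 n2 nV); first by rewrite sp.
  by rewrite ef rmorphD /= app_X2 app_polyC horner_cst_scaleXn addrC.
split; last by exists 2%N.
have wf : wle 1 2 f by case: gf.
have fq := wle2_quad wf; move: fq.
move: f`_0`_2 f`_1`_1 f`_2`_0 f`_0`_1 f`_1`_0 f`_0`_0 => A B C E G H fq.
have [be1 [be2 [be0 e2]]] : exists be1 be2 be0, tau.2 = afm be1 be2 be0.
  exact: aff_snd ht.
have qK : quad A%:F B%:F C%:F E%:F G%:F H%:F =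
    quad (a%:F * al1 ^+ 2) (2 * a%:F * al1 * al2) (a%:F * al2 ^+ 2) be1 be2 be0.
  rewrite -toK_quad -fq ef et e2; exact: (@quad_square K).
have [eA eB eC _ _] := quad_inj qK.
(* The quadratic part is [a] times the square of a linear form over [K], so the discriminant
   vanishes already in [R]. The flow is thus defined over [R] although [tau] is not. *)
have hB : B ^+ 2 = 4 * A * C.
  apply: tofrac_injective; rewrite tofracXn !tofracM rmorph_nat eA eB eC.
  exact: (@perfect_square K).
have A0 : A != 0 by rewrite -tofrac_eq0 eA; exact: (mulf_neq0 aF (expf_neq0 2 n1)).
exists (quad_flow A B C E G); split; last split.
- apply: tame_aff; apply: aff_afm.
  rewrite (_ : _ - _ = 1 - 4 * (B ^+ 2 - 4 * A * C)); last by ring.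
  by rewrite hB subrr mulr0 subr0 unitr1.
- by rewrite fq; exact: quad_flow_fix.
rewrite id_endoE => /(congr1 snd) /= /afm_inj [/eqP]; rewrite oppr_eq0 mulf_eq0 (negbTE A0) orbF.
by rewrite (negbTE (natr_neq0 3)).
Qed.

Lemma typeV_spec f : typeV f -> H_nontrivial f /\ exists k, goodA k f.
Proof.
move=> [tau [g [/affP ht dg ef [al0 [al1 [al2 [be0 [be1 [be2 [et1 et2 [n1 n2 nV] [e [e2 [q eg] [zeta [zn1 ze hin]]]]]]]]]]]]]].
have {}et1 : tau.1 = afm al1 al2 al0 := et1.
have {}et2 : tau.2 = afm be1 be2 be0 := et2.
have gf : goodA (size g).-1 f.
  by apply: (goodA_intro ht et1 n1 n2 nV _ ef); case: (size g) dg => [|[|[|]]].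
split; last by exists (size g).-1.
have D0 : al1 * be2 - al2 * be1 != 0.
  by have := aff_det ht et1 et2; rewrite unitfE.
(* The homology that scales [tau.1] by [zeta] and fixes [tau.2] has its entries in [R] by condition
   (c). *)
pose k := (zeta%:F - 1) / (al1 * be2 - al2 * be1).
have kE (x y : K) : (zeta%:F - 1) * x * y / (al1 * be2 - al2 * be1) = k * x * y.
  by rewrite /k -!mulrA; congr (_ * _); rewrite mulrA mulrC.
have inR x y : x \in [:: al0; al1; al2] -> y \in [:: be1; be2] -> exists r, k * x * y = r%:F.
  by move=> hx hy; have [r er] := hin _ _ hx hy; exists r; rewrite -kE.
have [r12 h12] : exists r, k * al1 * be2 = r%:F by apply: inR; rewrite !inE eqxx ?orbT.
have [r22 h22] : exists r, k * al2 * be2 = r%:F by apply: inR; rewrite !inE eqxx ?orbT.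
have [r02 h02] : exists r, k * al0 * be2 = r%:F by apply: inR; rewrite !inE eqxx ?orbT.
have [r11 h11] : exists r, k * al1 * be1 = r%:F by apply: inR; rewrite !inE eqxx ?orbT.
have [r21 h21] : exists r, k * al2 * be1 = r%:F by apply: inR; rewrite !inE eqxx ?orbT.
have [r01 h01] : exists r, k * al0 * be1 = r%:F by apply: inR; rewrite !inE eqxx ?orbT.
have kD : k * (al1 * be2 - al2 * be1) = zeta%:F - 1 by rewrite divfK.
pose phi : endo R := (afm (1 + r12) r22 r02, afm (- r11) (1 - r21) (- r01)).
have phiK : toKe phi = homology k al1 al2 al0 be1 be2.
  rewrite /toKe /= !toK_afm /homology h12 h22 h02 h11 h21 h01.
  by rewrite tofracD tofracB !tofracN tofrac1.
have detE : (1 + r12) * (1 - r21) - r22 * - r11 = zeta.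
  apply: tofrac_injective; rewrite tofracB !tofracM tofracD tofracB tofracN tofrac1.
  by rewrite -h12 -h22 -h11 -h21 (@det_homology K) kD addrC subrK.
have uz : zeta \is a GRing.unit.
  by apply/unitrPr; exists (zeta ^+ e.-1); rewrite -exprS prednK // ltnW.
have [f1 f2] := homology_fix al0 be0 kD.
exists phi; split; last split.
- by apply: tame_aff; apply: aff_afm; rewrite detE.
- apply: toK_inj; rewrite toK_app phiK ef.
  have zeK : zeta%:F ^+ e = 1 :> K by rewrite -tofracXn ze; exact: tofrac1.
  rewrite -et1 in f1; rewrite -et2 in f2.
  exact: (@app_scaled_axis K _ tau g q e _ eg zeK f1 f2).
rewrite id_endoE => eid; have [/= e1 e2' _] := afm_inj (congr1 fst eid).
have [/= e3 e4 _] := afm_inj (congr1 snd eid).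
by move: zn1; rewrite -detE e1 e2' e4 mul0r subr0 mulr1 eqxx.
Qed.

End TypesIIItoV.

(** * Polynomials [x2 + p(x1)] fixed by an affine automorphism *)

Section AffineNormalForm.
Variable F : fieldType.
Hypothesis char0 : forall n, n.+1%:R != 0 :> F.
Implicit Types p g q : {poly F}.

(** Centred at the fixed point [z0] of [X |-> u * X + c], the substitution multiplies the
    coefficient of degree [i] by [u ^ i]. Beyond degree one only multiples of the order of [u]
    survive; the linear part is split off. *)
Lemma affine_selfmap_normal_form p (u c r s : F) : (3 < size p)%N -> u != 1 ->
    p \Po (u *: 'X + c%:P) + (r *: 'X + s%:P) = p ->
  exists (z0 b1 b0 : F) g e, [/\ c = z0 - u * z0, b1 = u * b1 + r, s = - (b1 * c) &
    [/\ size g = size p, p = (g + (b1 *: 'X + b0%:P)) \Po ('X + (- z0)%:P), (2 <= e)%N, u ^+ e = 1 &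
    exists q, g = 'X^e * (q \Po 'X^e)]].
Proof.
move=> sp u1 ep; have u1' : 1 - u != 0 by rewrite subr_eq0 eq_sym.
pose z0 := c / (1 - u); have cz : c = z0 - u * z0.
  by rewrite -[X in X - _]mul1r -mulrBl mulrC divfK.
pose t := p \Po ('X + z0%:P); have st : size t = size p.
  by rewrite size_comp_poly2 // size_XaddC.
have et : t \Po (u *: 'X) + (r *: 'X + (r * z0 + s)%:P) = t.
  rewrite /t -[X in _ = X \Po _]ep comp_polyD; congr (_ + _).
    rewrite -!comp_polyA; congr (_ \Po _).
    rewrite !comp_polyD !comp_polyZ !comp_polyX !comp_polyC scalerDr -addrA; congr (_ + _).
    by rewrite -mul_polyC -polyCM -polyCD; congr _%:P; rewrite cz addrC subrK.
  rewrite !comp_polyD !comp_polyZ !comp_polyX !comp_polyC scalerDr -addrA; congr (_ + _).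
  by rewrite -mul_polyC -polyCM -polyCD.
have ct i : u ^+ i * t`_i + (r *: 'X + (r * z0 + s)%:P)`_i = t`_i.
  by rewrite -[in RHS]et [in RHS]coefD coef_comp_scale.
have r0 : r * z0 + s = 0.
  have := ct 0%N; rewrite expr0 mul1r coefD coefZ coefX coefC mulr0 add0r => /eqP.
  by rewrite -[X in _ == X]addr0 (inj_eq (addrI _)) => /eqP.
have r1 : t`_1 = u * t`_1 + r.
  by have := ct 1%N; rewrite expr1 coefD coefZ coefX coefC mulr1 addr0.
have ri i : (1 < i)%N -> t`_i != 0 -> u ^+ i = 1.
  move=> i1 nz; apply: (mulIf nz); rewrite mul1r -[RHS]ct coefD coefZ coefX coefC.
  by case: i i1 {nz} => [|[|i]] // _; rewrite mulr0 !addr0.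
pose g := t - (t`_1 *: 'X + (t`_0)%:P).
have gi i : g`_i = if (1 < i)%N then t`_i else 0.
  rewrite /g coefB coefD coefZ coefX coefC.
  by case: i => [|[|i]]; rewrite /= ?mulr0 ?mulr1 ?add0r ?addr0 ?subrr ?subr0.
have sg : size g = size t.
  rewrite /g size_polyDl // size_polyN st (leq_ltn_trans (size_linear _ _)) //.
  exact: leq_trans sp.
have un : u ^+ (size p).-1 = 1.
  apply: ri; first by case: (size p) sp => [|[|[]]].
  by rewrite -st -lead_coefE lead_coef_eq0 -size_poly_eq0 st -lt0n; case: (size p) sp.
have [|e pe _] := prim_order_exists _ un; first by case: (size p) sp => [|[]].
have e0 := prim_order_gt0 pe.
have e2 : (1 < e)%N.
  rewrite ltnNge; apply: contraNN u1 => le; rewrite -(prim_expr_order pe).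
  by have -> : e = 1%N by apply/eqP; rewrite eqn_leq le.
exists z0, t`_1, t`_0, g, e; split=> //.
  rewrite cz; move/eqP: r0; rewrite addrC addr_eq0 => /eqP ->.
  have -> : r = t`_1 - u * t`_1 by rewrite {1}r1 addrC addKr.
  by ring.
split=> //; first by rewrite sg.
- by rewrite /g subrK /t -comp_polyA comp_polyD comp_polyX comp_polyC -addrA -polyCD addNr addr0 comp_polyXr.
- exact: prim_expr_order.
have gd i : g`_i != 0 -> (e %| i)%N.
  rewrite gi; case: ltnP => [i1 nz|_]; last by rewrite eqxx.
  by rewrite (prim_order_dvd pe) ri.
have := poly_in_Xn e0 gd; set h := \poly_(j < _) _ => eg.
(* Since [g] has no constant term, a factor [X] splits off [h], which becomes the factor [X^e] of
   [g]. *)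
have h0 : h`_0 = 0 by rewrite coef_poly mul0n gi; case: ifP.
exists (drop_poly 1 h); rewrite {1}eg -[in LHS](poly_take_drop 1 h).
have -> : take_poly 1 h = 0.
  by apply/polyP => -[|i]; rewrite coef_take_poly coef0.
by rewrite add0r comp_polyM comp_polyX mulrC.
Qed.

Lemma affine_fix_normal_form (phi : endo F) p : (3 < size p)%N -> aff phi ->
    phi <> id_endo F -> app_endo phi (X2 + p%:P) = X2 + p%:P ->
  exists (z0 r s u : F) g (e : nat),
    let kappa := (afm 1 0 (- z0), afm r 1 s) in
    [/\ app_endo kappa (X2 + g%:P) = X2 + p%:P,
        app_endo phi kappa.1 = cst u * kappa.1, app_endo phi kappa.2 = kappa.2,
        size g = size p &
    [/\ u != 1, (2 <= e)%N, u ^+ e = 1 & exists q, g = 'X^e * (q \Po 'X^e)]].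
Proof.
move=> sp hphi nid fixp.
(* A non-triangular map would create a pure power of [x2] of degree [deg p > 1]. *)
have [nt|nt] := boolP (nontri phi).
  have [_] := nontri_ntri hphi nt (ntri_X2_poly (ltnW sp)); rewrite muln1 fixp.
  case: (size p) sp => [|[|[|n]]] //= _; by rewrite coefD coefX coefC /= addr0 coef0 eqxx.
have [u [c [v [r [s [uu uv ephi]]]]]] := aff_tri hphi nt.
have ev : app_endo phi (X2 + p%:P) =
    cst v * X2 + (p \Po (u *: 'X + c%:P) + (r *: 'X + s%:P))%:P.
  rewrite rmorphD /= app_X2 (@app_polyC1 _ _ _ (u *: 'X + c%:P)); last by rewrite ephi /= afm0E.
  by rewrite ephi /= polyCD; ring.
have cX2 (w : F) (k : {poly F}) j : (cst w * X2 + k%:P)`_j = if j == 1%N then w%:P else if j == 0%N then k else 0.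
  rewrite /cst coefD coefCM coefX coefC; case: j => [|[|j]] /=; by rewrite ?mulr0 ?mulr1 ?add0r ?addr0.
have eX2 : X2 + p%:P = cst 1 * X2 + p%:P :> P2 F by rewrite rmorph1 mul1r.
rewrite ev eX2 in fixp.
have v1 : v = 1 by have := congr1 (fun q : P2 F => q`_1) fixp; rewrite !cX2 => /polyC_inj.
have ep := congr1 (fun q : P2 F => q`_0) fixp; rewrite !cX2 /= in ep.
have [u1|u1] := eqVneq u 1.
  case: nid; rewrite ephi id_trg u1 v1.
  rewrite u1 scale1r in ep.
  have [k sk] : exists k, size p = k.+4 by exists (size p - 4)%N; lia.
  (* The degree of [p] is at least three, so the coefficient just below the leading one is out of
     reach of [r * X + s] and must be preserved by the translation alone. *)
  have c0 : c = 0.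
    have [_ tk] := comp_translate_top c (eq_leq sk : (size p <= k.+2.+2)%N).
    have := congr1 (fun q : {poly F} => q`_k.+2) ep.
    rewrite coefD tk coefD coefZ coefX coefC mulr0 !addr0 => /eqP.
    rewrite -[X in _ == X]addr0 (inj_eq (addrI _)) mulf_eq0 mulf_eq0 (negbTE (char0 _)) /=.
    case/orP => /eqP // z; have : lead_coef p != 0 by rewrite lead_coef_eq0 -size_poly_eq0 sk.
    by rewrite lead_coefE sk z eqxx.
  move: ep; rewrite c0 addr0 comp_polyXr -[RHS]addr0 => /addrI ->.
  by [].
have [z0 [b1 [b0 [g [e [hc hr hs [sg epg e2 ue hq]]]]]]] := affine_selfmap_normal_form sp u1 ep.
exists z0, b1, (b0 - b1 * z0), u, g, e => kappa; split; last (by split); last exact: sg.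
- rewrite rmorphD /= app_X2 (@app_polyC1 _ _ _ ('X + (- z0)%:P)); last by rewrite /= afm0E scale1r.
  have -> : kappa.2 = X2 + ((b1 *: 'X + b0%:P) \Po ('X + (- z0)%:P))%:P.
    rewrite /kappa /= afmE scale1r; congr (_ + _%:P).
    rewrite comp_polyD comp_polyZ comp_polyX comp_polyC scalerDr -addrA; congr (_ + _).
    by rewrite -mul_polyC -polyCM -polyCD; congr _%:P; rewrite mulrN addrC.
  rewrite -addrA -polyCD addrC [RHS]addrC; congr (_%:P + _).
  by rewrite addrC [RHS]epg -comp_polyD.
- rewrite /kappa /= ephi -aff_trg app_afm cst_mul_afm; apply: afm_congr; rewrite ?mulr0 ?mul0r ?mulr1 ?mul1r ?addr0 //.
  by rewrite hc; ring.
rewrite /kappa /= ephi v1 -aff_trg app_afm; apply: afm_congr.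
- by rewrite mul1r [X in _ = X]hr mulrC.
- by rewrite mulr0 add0r mul1r.
by rewrite hs mul1r; ring.
Qed.

End AffineNormalForm.

Lemma aff_fst (S : idomainType) (tau : endo S) : aff tau -> exists a1 a2 a0, tau.1 = afm a1 a2 a0.
Proof. by move=> [t1 [t2 [t0 [b1 [b2 [b0 [-> _]]]]]]]; exists t1, t2, t0. Qed.

Section AffineOrbits.
Variable F : fieldType.
Implicit Types p g q : {poly F}.

Lemma app_aff_X2_poly (tau : endo F) p al1 al0 : aff tau -> tau.1 = afm al1 0 al0 ->
  exists b p', [/\ b != 0, app_endo tau (X2 + p%:P) = cst b * X2 + p'%:P &
    forall n, (0 < n)%N -> (size p <= n.+1)%N -> (size p' <= n.+1)%N].
Proof.
move=> ht e1; have [be1 [be2 [be0 e2]]] := aff_snd ht.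
have := aff_det ht e1 e2; rewrite mul0r subr0 unitfE mulf_eq0 negb_or => /andP[n1 n2].
exists be2, (be1 *: 'X + be0%:P + (p \Po (al1 *: 'X + al0%:P))); split=> //.
  rewrite rmorphD /= app_X2 (@app_polyC1 _ _ _ (al1 *: 'X + al0%:P)); last by rewrite e1 afm0E.
  rewrite e2 polyCD addrA; congr (_ + _).
  by rewrite afmE -mul_polyC addrC.
move=> n n0 sp; rewrite (leq_trans (size_polyD _ _)) // geq_max.
rewrite (leq_trans (size_linear _ _)) //= size_comp_poly2 //.
by rewrite size_polyDl size_scale ?size_polyX // (leq_ltn_trans (size_polyC_leq1 _)).
Qed.

(** The linear form is normalised to have coefficient 1 at [x1], so that [a] is the coefficient of
    [x1 ^ 2] and lies in [R] whenever the polynomial does. *)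
Lemma app_aff_quadratic (tau : endo F) p al1 al2 al0 : aff tau -> tau.1 = afm al1 al2 al0 ->
    al1 != 0 -> size p = 3%N ->
  exists a w, [/\ a != 0, aff (afm 1 (al2 / al1) 0, w) &
    app_endo tau (X2 + p%:P) = cst a * afm 1 (al2 / al1) 0 ^+ 2 + w].
Proof.
move=> ht e1 n1 sp; have [be1 [be2 [be0 e2]]] := aff_snd ht.
have := aff_det ht e1 e2; rewrite unitfE => D0.
pose m := p`_1 + 2 * p`_2 * al0; pose c := be0 + p`_1 * al0 + p`_0 + p`_2 * al0 ^+ 2.
have p2 : p`_2 != 0.
  by rewrite (_ : p`_2 = lead_coef p) ?lead_coef_eq0 -?size_poly_eq0 ?lead_coefE sp.
have eal : al2 = al1 * (al2 / al1) by rewrite mulrC divfK.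
exists (p`_2 * al1 ^+ 2), (afm (be1 + m * al1) (be2 + m * al2) c); split.
- by rewrite mulf_neq0 // expf_neq0.
- apply: aff_afm; rewrite unitfE; apply: contraNneq D0 => h.
  have -> : al1 * be2 - al2 * be1 = al1 * (1 * (be2 + m * al2) - al2 / al1 * (be1 + m * al1)).
    by rewrite [in LHS]eal [X in m * X]eal; ring.
  by rewrite h mulr0.
rewrite rmorphD /= app_X2 app_polyC e1 e2.
have ep : p = p`_2 *: 'X^2 + p`_1 *: 'X^1 + (p`_0)%:P.
  apply/polyP => -[|[|[|i]]]; rewrite !coefD !coefZ !coefXn coefC /= ?mulr0 ?mulr1 ?add0r ?addr0 //.
  by rewrite nth_default // sp.
rewrite [X in map_poly _ X]ep !rmorphD /= !hornerD !horner_cst_scaleXn horner_cst_C.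
have -> : afm 1 (al2 / al1) 0 = cst al1^-1 * afm al1 al2 0 :> P2 F.
  by rewrite cst_mul_afm (mulVf n1) mulr0 [al1^-1 * _]mulrC.
have -> : cst (p`_2 * al1 ^+ 2) * (cst al1^-1 * afm al1 al2 0) ^+ 2 = cst p`_2 * afm al1 al2 0 ^+ 2.
  rewrite exprMn mulrA cst_exp; congr (_ * _); rewrite -rmorphM /= -mulrA -exprMn mulfV //.
  by rewrite expr1n mulr1.
move: (p`_2) (p`_1) (p`_0) @m @c {D0 eal n1 e1 e2 p2 ep} => a b d m c.
rewrite /m /c /afm !rmorphD !rmorphM /= rmorph0.
rewrite (rmorphD (@cst F) b) !(rmorphM (@cst F)) /= rmorph_nat.
move: (cst al1) (cst al2) (cst al0) (cst be1) (cst be2) (cst be0) (cst a) (cst b) (cst d) X1 X2.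
by move=> *; ring.
Qed.

Hypothesis char0 : forall n, n.+1%:R != 0 :> F.

(** Only the constant term of [tau.1] changes in the passage to [tau'], so a condition on
    [al1 / al2] is kept. *)
Lemma affine_fix_homology (phi tau : endo F) p al1 al2 al0 : (3 < size p)%N -> aff tau ->
    tau.1 = afm al1 al2 al0 -> aff phi -> phi <> id_endo F ->
    app_endo phi (app_endo tau (X2 + p%:P)) = app_endo tau (X2 + p%:P) ->
  exists (tau' : endo F) al0' be1 be2 be0 u g e,
  [/\ aff tau', tau'.1 = afm al1 al2 al0', tau'.2 = afm be1 be2 be0,
      app_endo tau (X2 + p%:P) = app_endo tau' (X2 + g%:P) & size g = size p] /\
  [/\ app_endo phi (afm al1 al2 al0') = cst u * afm al1 al2 al0',
      app_endo phi (afm be1 be2 be0) = afm be1 be2 be0, u != 1, (2 <= e)%N &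
      u ^+ e = 1 /\ exists q, g = 'X^e * (q \Po 'X^e)].
Proof.
move=> sp ht e1 hphi nid fixp; have [t it hti] := aff_inv ht.
pose psi := comp_endo t (comp_endo phi tau).
have hpsi : aff psi by apply: aff_comp => //; exact: aff_comp.
have ephi : comp_endo tau psi = comp_endo phi tau.
  by rewrite /psi comp_endoA (proj1 it) comp_id_endo.
have nid' : psi <> id_endo F.
  move=> e; apply: nid; rewrite -(comp_endo_id phi) -(proj1 it) comp_endoA -ephi e.
  by rewrite comp_endo_id (proj1 it).
have fix' : app_endo psi (X2 + p%:P) = X2 + p%:P.
  by rewrite /psi !app_comp fixp app_inv.
have [z0 [r [s [u [g [e [ek k1 k2 sg [u1 e2 ue hq]]]]]]]] :=
  affine_fix_normal_form char0 sp hpsi nid' fix'.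
set kappa := (afm 1 0 (- z0), afm r 1 s) in ek k1 k2.
have hk : aff kappa by apply: aff_afm; rewrite mul1r mul0r subr0 unitr1.
have [be1 [be2 [be0 e2']]] := aff_snd (aff_comp ht hk).
have e1' : (comp_endo tau kappa).1 = afm al1 al2 (al0 - z0).
  have -> : (comp_endo tau kappa).1 = app_endo tau (X1 + cst (- z0)).
    by rewrite /= afm_X1 rmorph1 mul1r.
  by rewrite rmorphD /= app_X1 app_cst e1 /afm -addrA -rmorphD.
have key F' : app_endo phi (app_endo tau F') = app_endo tau (app_endo psi F').
  by rewrite -!app_comp ephi.
exists (comp_endo tau kappa), (al0 - z0), be1, be2, be0, u, g, e; split; split.
- exact: aff_comp.
- exact: e1'.
- exact: e2'.
- by rewrite app_comp ek.
- exact: sg.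
- by rewrite -e1' /= key k1 rmorphM /= app_cst.
- by rewrite -e2' /= key k2.
- exact: u1.
- exact: e2.
- by split.
Qed.

End AffineOrbits.

Lemma field_cross (F : fieldType) (a b x y : F) : b != 0 -> y != 0 -> a / b = x / y -> a * - y + b * x = 0.
Proof. by move=> b0 y0 /eqP; rewrite eqr_div // => /eqP e; rewrite mulrN e [b * x]mulrC addNr. Qed.

Lemma afm_kill2 (F : comNzRingType) (c1 c2 a1 a2 b1 b2 : F) : c1 * a2 + c2 * b2 = 0 ->
  forall c0, app_endo (afm a1 a2 0, afm b1 b2 0) (afm c1 c2 c0) = afm (c1 * a1 + c2 * b1) 0 c0.
Proof. by move=> e c0; rewrite app_afm e !mulr0 !add0r. Qed.

(** * Recognition of types III, IV and V from an affine stabilizer *)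

Section AffineStabilizers.
Variable R : idomainType.
Local Notation K := {fraction R}.
Local Notation "x %:F" := (@FracField.tofrac R x).
Implicit Types (f : P2 R).

(** The Bezout relation completes the kernel vector [(- y, x)] of the linear form to a matrix of
    determinant 1 over [R]. *)
Lemma inV_reduction (al1 al2 : K) : al2 != 0 -> inV (al1 / al2) ->
  exists (a : endo R) d, aff a /\
    forall al0, app_endo (toKe a) (afm al1 al2 al0) = afm d 0 al0.
Proof.
move=> n2 [x [y [x0 y0 [u [v uv]] e]]].
exists (afm u (- y) 0, afm v x 0), (al1 * u%:F + al2 * v%:F); split.
  by apply: aff_afm; rewrite mulNr opprK mulrC uv unitr1.
move=> al0; rewrite /toKe /= !toK_afm tofrac0 tofracN.
have yF : y%:F != 0 by rewrite tofrac_eq0.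
exact: (@afm_kill2 K _ _ _ _ _ _ (field_cross n2 yF e)).
Qed.

Lemma sdeg_X2_poly (b : K) (p : {poly K}) f n : (0 < n)%N -> (size p <= n.+1)%N ->
  toK f = cst b * X2 + p%:P -> (degx1 f <= n)%N /\ (degx2 f <= 1)%N.
Proof.
move=> n0 sp e; have w := wle_X2_poly (b := b) n0 sp.
split; first by have [] := wle1_degx (F := f) (M := n); [apply/wle_toK; rewrite e |].
apply: degx2_leq => i j; rewrite -tofrac_eq0 -coef_toK e coef_X2_poly.
by case: j => [|[|j]] //=; rewrite eqxx.
Qed.

Definition affine_minimal f := forall a, aff a -> (sdeg f <= sdeg (app_endo a f))%N.

(** Otherwise an affine map over [R] removes [x2] from [tau.1], and the image [b * x2 + p'(x1)] has
    degree sum at most [n + 1]. *)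
Lemma affine_minimal_nonV f (tau : endo K) (p : {poly K}) n al1 al2 al0 : affine_minimal f ->
  aff tau -> tau.1 = afm al1 al2 al0 -> al2 != 0 -> (0 < n)%N -> (size p <= n.+1)%N ->
  toK f = app_endo tau (X2 + p%:P) -> (n.+1 < sdeg f)%N -> ~ inV (al1 / al2).
Proof.
move=> mf ht e1 n2 n0 sp ef lt /(inV_reduction n2) [a [d [ha ea]]].
have := mf _ ha; apply/negP; rewrite -ltnNge; apply: leq_ltn_trans lt.
have hc : aff (comp_endo (toKe a) tau) by apply: aff_comp => //; exact: toKe_aff.
have ec : (comp_endo (toKe a) tau).1 = afm d 0 al0.
  exact: etrans (congr1 (app_endo (toKe a)) e1) (ea al0).
have [b [p' [_ e sp']]] := app_aff_X2_poly p hc ec.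
have ea' : toK (app_endo a f) = cst b * X2 + p'%:P by rewrite toK_app ef -app_comp.
have [h1 h2] := sdeg_X2_poly n0 (sp' n n0 sp) ea'.
by rewrite /sdeg -[n.+1]addn1; exact: leq_add.
Qed.

Lemma linear_typeIII f : wle 1 1 f -> affine_minimal f -> (0 < degx1 f)%N -> (0 < degx2 f)%N -> typeIII f.
Proof.
move=> wf mf d1 d2; have := wle1_linear wf.
move: f`_0`_1 f`_1`_0 f`_0`_0 => a1 a2 a0 e.
have a10 : a1 != 0.
  apply: contraTneq d1 => z; rewrite -leqNgt; apply: degx1_leq => i j.
  rewrite e z coef_afm !xpair_eqE.
  by case: i j => [|[|i]] [|[|j]] //=; rewrite eqxx.
have a20 : a2 != 0.
  apply: contraTneq d2 => z; rewrite -leqNgt; apply: degx2_leq => i j.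
  rewrite e z coef_afm !xpair_eqE.
  by case: i j => [|[|i]] [|[|j]] //=; rewrite eqxx.
exists a1, a2, a0; split=> //.
move=> /inV_reduction; rewrite tofrac_eq0 => /(_ a20) [a [d [ha ea]]].
have := mf _ ha; apply/negP; rewrite -ltnNge.
have ed : toK (app_endo a f) = afm d 0 a0%:F by rewrite toK_app e toK_afm ea.
apply: (@leq_trans 2); last by rewrite /sdeg -(addn1 1) leq_add.
rewrite ltnS -[1%N]addn0 leq_add //.
  by have [] := wle1_degx (F := app_endo a f) (M := 1); [apply/wle_toK; rewrite ed; exact: wle1_afm |].
apply: degx2_leq => i j; rewrite -tofrac_eq0 -coef_toK ed coef_afm !xpair_eqE.
by case: i j => [|[|i]] [|[|j]] //=; rewrite eqxx.
Qed.
End AffineStabilizers.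

Lemma coef_square_afm (S : comNzRingType) (a c b1 b2 b0 : S) :
  a = (cst a * afm 1 c 0 ^+ 2 + afm b1 b2 b0)`_0`_2.
Proof.
rewrite quad_square coef_quad !coefD !coefZ coefXn coefX coefC /= mulr0 !addr0.
by rewrite expr1n !mulr1.
Qed.

Lemma mul_div_shuffle (F : fieldType) (z a b d : F) : z * a * b / d = z / d * a * b.
Proof. by rewrite mulrAC [z * a / d]mulrAC. Qed.

Lemma app_swap_afm (S : idomainType) (a1 a2 a0 : S) : app_endo (swap S) (afm a1 a2 a0) = afm a2 a1 a0.
Proof. by rewrite app_afm_gen /= /afm [_ * X2 + _]addrC. Qed.

Lemma wle_app_X2_poly (S : idomainType) (tau : endo S) (p : {poly S}) n : aff tau -> (0 < n)%N ->
  (size p <= n.+1)%N -> wle 1 n (app_endo tau (X2 + p%:P)).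
Proof.
move=> ht n0 sp; apply: wle1_aff => //; have := @wle_X2_poly S 1 p n n0 sp.
by rewrite rmorph1 mul1r.
Qed.

Lemma app_X2_poly_ends (S : idomainType) (tau : endo S) (p : {poly S}) al1 al2 al0 : aff tau ->
    tau.1 = afm al1 al2 al0 -> (2 < size p)%N ->
  (al2 != 0 -> (app_endo tau (X2 + p%:P))`_(size p).-1`_0 != 0) /\
  (al1 != 0 -> (app_endo tau (X2 + p%:P))`_0`_(size p).-1 != 0).
Proof.
move=> ht e1 sp; split=> n; have tri := ntri_X2_poly sp.
  have nt : nontri tau by rewrite /nontri e1 afm_coef2.
  by have [_] := nontri_ntri ht nt tri; rewrite muln1.
have hs : aff (comp_endo (swap S) tau) by apply: aff_comp => //; exact: aff_swap.
have nt : nontri (comp_endo (swap S) tau).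
  by rewrite /nontri /comp_endo [_.1]/= e1 coef_swap afm_coef1.
by have [_] := nontri_ntri hs nt tri; rewrite muln1 app_comp coef_swap.
Qed.

Section AffineTypes.
Variable R : idomainType.
Local Notation K := {fraction R}.
Local Notation "x %:F" := (@FracField.tofrac R x).
Hypothesis hZ : injective (fun z : int => (z%:~R : R)).
Implicit Types (f : P2 R).

Lemma typeIV_intro f (tau : endo K) (p : {poly K}) al1 al2 al0 : aff tau -> tau.1 = afm al1 al2 al0 ->
  al1 != 0 -> al2 != 0 -> ~ inV (al1 / al2) -> size p = 3%N ->
  toK f = app_endo tau (X2 + p%:P) -> typeIV f.
Proof.
move=> ht e1 n1 n2 nV sp ef.
have [a [w [a0 hw e]]] := app_aff_quadratic ht e1 n1 sp.
have [be1 [be2 [be0 ew]]] := aff_snd hw; rewrite /= in ew.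
have ea : a = (f`_0`_2)%:F.
  rewrite -[RHS](coef_toK f 2 0) ef e ew; exact: (@coef_square_afm K).
exists f`_0`_2, (afm 1 (al2 / al1) 0, w), 1, (al2 / al1); split.
- by rewrite -tofrac_eq0 -ea.
- exact/affP.
- exact: esym (afm_nz 1 (al2 / al1)).
- split; [exact: oner_neq0 | exact: (mulf_neq0 n2 (invr_neq0 n1)) |].
  by rewrite mul1r invf_div.
rewrite -ea ef; exact: e.
Qed.

Lemma typeV_intro f phi (tau : endo K) (p : {poly K}) al1 al2 al0 : aff tau ->
  tau.1 = afm al1 al2 al0 -> al1 != 0 -> al2 != 0 -> ~ inV (al1 / al2) -> (3 < size p)%N ->
  toK f = app_endo tau (X2 + p%:P) -> aff phi -> phi <> id_endo R -> app_endo phi f = f -> typeV f.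
Proof.
move=> ht e1 n1 n2 nV sp ef hphi nid fixf.
have fixK : app_endo (toKe phi) (app_endo tau (X2 + p%:P)) = app_endo tau (X2 + p%:P).
  by rewrite -ef -toK_app fixf.
have nidK : toKe phi <> id_endo K by move/toKe_id.
have [tau' [al0' [be1 [be2 [be0 [u [g [e [[ht' e1' e2' eg sg] [h1 h2 u1 e2 [ue hq]]]]]]]]]]] :=
  affine_fix_homology (natr_neq0K hZ) sp ht e1 (toKe_aff hphi) nidK fixK.
have D0 : al1 * be2 - al2 * be1 != 0 by have := aff_det ht' e1' e2'; rewrite unitfE.
move: hphi h1 h2 => [c1 [c2 [c0 [d1 [d2 [d0 [-> _]]]]]]].
have -> : toKe (afm c1 c2 c0, afm d1 d2 d0) = (afm c1%:F c2%:F c0%:F, afm d1%:F d2%:F d0%:F).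
  by rewrite /toKe /= !toK_afm.
(* The linear part has eigenvalues [u] and 1, so [u] is its trace minus one and lies in [R]. *)
move=> h1 h2; have [r12 r22 r02 [r11 r21 r01 eu]] := homology_unique D0 h1 h2.
have {}eu : u = (c1 + d2 - 1)%:F by rewrite eu tofracB tofracD tofrac1.
exists tau', g; split.
- exact/affP.
- by rewrite sg; case: (size p) sp => [|[|[|]]].
- by rewrite ef.
exists al0', al1, al2, be0, be1, be2; split; [exact: e1' | exact: e2' | by split |].
exists e; split=> //; exists (c1 + d2 - 1); split.
- by rewrite -tofrac_eq tofrac1 -eu.
- by apply: tofrac_injective; rewrite tofracXn tofrac1 -eu.
move=> al be; rewrite -eu !inE => hal hbe.
have -> : (u - 1) * al * be / (al1 * be2 - al2 * be1) = (u - 1) / (al1 * be2 - al2 * be1) * al * be.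
  exact: (@mul_div_shuffle K).
case/orP: hbe => /eqP ->; case/or3P: hal => /eqP ->.
- by rewrite r01 -tofracN; exists (- d0).
- by rewrite r11 -tofracN; exists (- d1).
- by rewrite r21; exists (1 - d2); rewrite tofracB tofrac1.
- by rewrite r02; exists c0.
- by rewrite r12; exists (c1 - 1); rewrite tofracB tofrac1.
- by rewrite r22; exists c2.
Qed.

Lemma affine_stab_types f phi : coordinate (toK f) -> locmin f -> affine_minimal f ->
    (1 <= degx2 f <= degx1 f)%N -> aff phi -> phi <> id_endo R -> app_endo phi f = f ->
  [\/ typeI f, typeIII f, typeIV f | typeV f].
Proof.
move=> cof lm am /andP[d2 d21] hphi nid fixf.
have lin : wle 1 1 f -> typeIII f.
  by move=> w; apply: linear_typeIII => //; exact: leq_trans d21.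
have fixK : app_endo (toKe phi) (toK f) = toK f by rewrite -toK_app fixf.
have nidK : toKe phi <> id_endo K by move/toKe_id.
have [tau [p [ht ef]]] := affine_fix_coordinate (natr_neq0K hZ) cof (toKe_aff hphi) fixK nidK.
have [al1 [al2 [al0 e1]]] := aff_fst ht.
have [sp|sp] := leqP (size p) 2.
  by constructor 2; apply: lin; apply/wle_toK; rewrite ef; exact: wle_app_X2_poly.
have [z2|n2] := eqVneq al2 0.
  rewrite z2 in e1; have [b [p' [b0 e _]]] := app_aff_X2_poly p ht e1.
  rewrite -ef in e; have [h|h] := typeI_or_linear b0 e lm; first by constructor 1.
  by constructor 2; exact: lin.
have [end2 end1] := app_X2_poly_ends ht e1 sp.
move: (end2 n2); rewrite -ef => /toK_neq0 f2; have ge2 := leq_degx2 f2.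
have n_gt1 : (1 < (size p).-1)%N by case: (size p) sp => [|[|]].
have n_gt0 := ltnW n_gt1.
have spn : (size p <= (size p).-1.+1)%N by rewrite prednK // (ltn_trans _ sp).
have [z1|n1] := eqVneq al1 0.
  (* Here [f] has degree at most one in [x1] but contains a power of [x2] above the first, against
     [degx2 f <= degx1 f]. *)
  have hs : aff (comp_endo (swap K) tau) by apply: aff_comp => //; exact: aff_swap.
  have es : (comp_endo (swap K) tau).1 = afm al2 0 al0.
    exact: etrans (congr1 (app_endo (swap K)) e1) (etrans (app_swap_afm _ _ _) (afm_congr erefl z1 erefl)).
  have [b [p' [_ e _]]] := app_aff_X2_poly p hs es; rewrite app_comp -ef in e.
  have d1 : (degx1 f <= 1)%N.
    apply: degx1_leq => i j; rewrite -tofrac_eq0 -coef_toK -coef_swap e coef_X2_poly.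
    by case: i => [|[|i]] //=; rewrite eqxx.
  by move: (leq_trans ge2 (leq_trans d21 d1)); rewrite leqNgt n_gt1.
move: (end1 n1); rewrite -ef => /toK_neq0 f1; have ge1 := leq_degx1 f1.
have nV : ~ inV (al1 / al2).
  apply: (affine_minimal_nonV am ht e1 n2 n_gt0 spn ef).
  have aux (n a b : nat) : (1 < n -> n <= a -> n <= b -> n.+1 < a + b)%N by lia.
  exact: aux n_gt1 ge1 ge2.
have [sp3|sp3] := leqP (size p) 3.
  have e3 : size p = 3%N by apply/eqP; rewrite eqn_leq sp3 sp.
  by constructor 3; exact: (typeIV_intro ht e1 n1 n2 nV e3 ef).
by constructor 4; exact: (typeV_intro ht e1 n1 n2 nV sp3 ef hphi nid fixf).
Qed.

End AffineTypes.

Lemma minimal_value (P : nat -> Prop) : (exists n, P n) -> exists2 n, P n & forall m, P m -> (n <= m)%N.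
Proof.
move=> [n Pn]; apply: NNPP => none.
suff h m : forall k, (k < m)%N -> ~ P k by exact: (h n.+1 n).
elim: m => // m IH k; rewrite ltnS leq_eqVlt => /orP[/eqP -> Pm|]; last exact: IH.
by apply: none; exists m => // j Pj; rewrite leqNgt; apply/negP => /IH.
Qed.

(** * Representatives of least degree and the transfer to [f] *)

Section Assembly.
Variable R : idomainType.
Local Notation K := {fraction R}.
Hypothesis hZ : injective (fun z : int => (z%:~R : R)).
Implicit Types (f : P2 R) (phi : endo R).

Definition good f := (exists k, goodA k f) \/ exists n d, goodB n d f.
Definition typed f := typeI f \/ typeII f \/ typeIII f \/ typeIV f \/ typeV f.

Lemma typed_spec f : typed f -> H_nontrivial f /\ good f.
Proof.
case=> [/typeI_spec|[/typeII_spec|[/typeIII_spec|[/(typeIV_spec hZ)|/typeV_spec]]]] [h g]; split=> //;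
  by [right | left].
Qed.

Lemma good_degrees f : good f -> (1 <= degx2 f <= degx1 f)%N.
Proof.
case=> [[k g]|[n [d g]]].
  by have [-> ->] := goodA_deg g; case: g => k0 _ _; rewrite k0 leqnn.
have [-> ->] := goodB_deg g; case: g => d1 n0 _ _ _.
by rewrite n0 leq_pmull // ltnW.
Qed.

Lemma degx2_cst (c : R) : degx2 (cst c) = 0%N.
Proof. by rewrite /degx2 /cst size_polyC; case: eqP. Qed.

Lemma good_reduced f : good f -> tamely_reduced f.
Proof.
move=> gf; split.
  by move=> [c e]; have := good_degrees gf; rewrite e degx2_cst.
move=> tau ht; case: gf => [[k g]|[n [d g]]].
  have [e1 e2] := goodA_deg g; rewrite e1 e2.
  have [/goodA_aff/(_ g)/goodA_deg [-> ->] //|] := goodA_tame g ht.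
  by rewrite mul2n -addnn; exact: ltnW.
by have [e1 e2] := goodB_deg g; have [h _] := goodB_tame g ht; rewrite e1 e2 addnC.
Qed.

Lemma degx1_tdeg f : (degx1 f <= tdeg f)%N.
Proof. by have [] := wle1_degx (@wle_tdeg _ f). Qed.

Lemma reduced_locmin f : tamely_reduced f -> locmin f.
Proof.
move=> [_ h] g M e1 _; have := h _ (tame_shear g).
rewrite (degx2_triangular f (triangular_shear g)) leq_add2r e1 => le.
exact: leq_trans le (degx1_tdeg _).
Qed.

Lemma reduced_affine_minimal f : tamely_reduced f -> affine_minimal f.
Proof. by move=> [_ h] a /tame_aff; exact: h. Qed.

Lemma stab_typed f phi : coordinate (toK f) -> locmin f -> affine_minimal f ->
    (1 <= degx2 f <= degx1 f)%N -> aff phi \/ triangular phi -> phi <> id_endo R ->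
  app_endo phi f = f -> typed f.
Proof.
move=> cof lm am dg hphi nid fixf; rewrite /typed.
have aff_case : aff phi -> typeI f \/ typeII f \/ typeIII f \/ typeIV f \/ typeV f.
  by move=> h; case: (affine_stab_types hZ cof lm am dg h nid fixf); tauto.
case: hphi => // h.
have [] := triangular_stab_types (natr_neq0K hZ) cof lm h nid fixf; [tauto | tauto | | exact: aff_case].
move/andP: dg => [d2 d21] w.
by have := linear_typeIII w am (leq_trans d2 d21) d2; tauto.
Qed.

Lemma conj_inv (a a' phi : endo R) : is_inv a' a ->
  phi = comp_endo a' (comp_endo (comp_endo a (comp_endo phi a')) a).
Proof. by move=> [_ i2]; rewrite !comp_endoA i2 comp_id_endo -comp_endoA i2 comp_endo_id. Qed.

Lemma conj_stab (a a' phi : endo R) f : is_inv a' a -> phi <> id_endo R -> app_endo phi f = f ->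
  comp_endo a (comp_endo phi a') <> id_endo R /\
  app_endo (comp_endo a (comp_endo phi a')) (app_endo a f) = app_endo a f.
Proof.
move=> i nid fixf; split; last by rewrite !app_comp (app_inv _ i) fixf.
by move=> e; apply: nid; rewrite (conj_inv phi i) e comp_id_endo; case: i.
Qed.

Lemma tame_conj (a a' phi : endo R) : tame a -> tame a' -> tame phi ->
  tame (comp_endo a (comp_endo phi a')).
Proof. by move=> h1 h2 h3; apply: tame_comp => //; exact: tame_comp. Qed.

Lemma tame_is_aut (a : endo R) : tame a -> is_aut a.
Proof. by move/tame_inv_exists => [b i _]; exists b. Qed.

(** A lexicographic minimum: total degree first, then [sdeg]. Affine maps preserve the former, so
    minimality of the latter gives [affine_minimal]; a swap, which changes neither, puts the partial
    degrees in order. *)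
Lemma orbit_minimum f : exists2 sigma, tame sigma & 
  let F := app_endo sigma f in
  [/\ forall t, tame t -> (tdeg F <= tdeg (app_endo t F))%N, affine_minimal F
    & (degx2 F <= degx1 F)%N].
Proof.
pose inorb F := exists2 sigma, tame sigma & F = app_endo sigma f.
have orb_step F t : tame t -> inorb F -> inorb (app_endo t F).
  by move=> ht [s hs ->]; exists (comp_endo t s); [exact: tame_comp | rewrite app_comp].
have [|N [F1 o1 e1] minN] := @minimal_value (fun n => exists2 F, inorb F & tdeg F = n).
  by exists (tdeg f), f => //; exists (id_endo R); [exact: tame_aff (aff_id R) | rewrite app_id].
have [|M [F2 [o2 e2] e2'] minM] := @minimal_value (fun n => exists2 F, inorb F /\ tdeg F = N & sdeg F = n).
  by exists (sdeg F1), F1.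
have key F : inorb F -> tdeg F = N -> sdeg F = M ->
    (forall t, tame t -> (tdeg F <= tdeg (app_endo t F))%N) /\ affine_minimal F.
  move=> oF eN eM; split=> [t ht|a ha].
    by rewrite eN; apply: minN; exists (app_endo t F) => //; exact: orb_step.
  rewrite eM; apply: minM; exists (app_endo a F) => //; split; last by rewrite tdeg_aff.
  by apply: orb_step => //; exact: tame_aff.
have hsw := aff_swap R.
case: (leqP (degx2 F2) (degx1 F2)) => le.
  by have [k1 k2] := key _ o2 e2 e2'; case: o2 k1 k2 le => s hs -> k1 k2 le; exists s.
have o3 := orb_step _ _ (tame_aff hsw) o2.
have le' : (degx2 (app_endo (swap R) F2) <= degx1 (app_endo (swap R) F2))%N.
  by rewrite degx1_swap degx2_swap ltnW.
have [||k1 k2] := key _ o3.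
- by rewrite tdeg_aff.
- by rewrite /sdeg degx1_swap degx2_swap addnC.
by case: o3 k1 k2 le' => s hs -> k1 k2 le'; exists s.
Qed.

Lemma good_in_orbit f phi : coordinate (toK f) -> tamely_reduced f -> (2 <= sdeg f)%N ->
  tame phi -> phi <> id_endo R -> app_endo phi f = f ->
  exists2 sigma, tame sigma & good (app_endo sigma f).
Proof.
move=> cof [_ red] sd tphi nid fixf.
have [s ts [mt am d21]] := orbit_minimum f.
have [s' is' ts'] := tame_inv_exists ts.
set F := app_endo s f in mt am d21.
have coF : coordinate (toK F) by apply: coordinate_aut => //; exact: tame_is_aut.
have [nid0 fix0] := conj_stab is' nid fixf; rewrite -/F in fix0.
set phi0 := comp_endo s _ in nid0 fix0.
have tphi0 : tame phi0 by exact: tame_conj.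
have sF : (2 <= sdeg F)%N := leq_trans sd (red _ ts).
(* A coordinate free of [x2] is linear in [x1], with degree sum one, below the bound inherited from
   [f]. *)
have d2 : (0 < degx2 F)%N.
  rewrite lt0n; apply/negP => /eqP d0; move: sF; rewrite /sdeg d0 addn0 leqNgt.
  have [Phi [[Psi iP] eP]] := coF.
  have sz : (size Phi.1 <= 1)%N.
    rewrite eP; apply: leq_trans (size_poly _ _) _.
    by move: d0; rewrite /degx2; case: (size F) => [|[]].
  have [a [b [_ e]]] := coord_const iP sz.
  rewrite eP in e; have w : wle 1 1 F by apply/wle_toK; rewrite e; exact: wle1_afm.
  by rewrite ltnS; have [-> _] := wle1_degx w.
have lmt F' : tdeg F' = tdeg F -> (exists2 t, tame t & F' = app_endo t F) -> locmin F'.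
  move=> e [t ht e'] g M _ <-; rewrite e e' -app_comp; apply: mt.
  by apply: tame_comp => //; exact: tame_shear.
have lm : locmin F by apply: lmt => //; exists (id_endo R); [exact: tame_aff (aff_id R) | rewrite app_id].
have dg : (1 <= degx2 F <= degx1 F)%N by rewrite d2.
have N0 : (0 < tdeg F)%N.
  by apply: leq_trans (degx1_tdeg F); exact: leq_trans d21.
have aff_done : aff phi0 -> good F.
  by move=> h; have [] := typed_spec (stab_typed coF lm am dg (or_introl h) nid0 fix0).
(* Either [dom] fails on the whole affine orbit and the stabilizer is affine, or it holds for some
   affine image, whose stabilizer is triangular. *)
have [nodom|] := classic (forall a, aff a -> ~ dom (app_endo a F)).
  by exists s => //; apply: aff_done; exact: (stab_aff N0 erefl nodom tphi0 fix0).
move=> h; have [a h'] := not_all_ex_not _ _ h; have [ha /NNPP da] := imply_to_and _ _ h' => {h h'}.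
have [a' ia ha'] := aff_inv ha.
have [nid1 fix1] := conj_stab ia nid0 fix0.
set phi1 := comp_endo a _ in nid1 fix1.
have tphi1 : tame phi1 by apply: tame_conj => //; exact: tame_aff.
have e1 : tdeg (app_endo a F) = tdeg F by exact: tdeg_aff.
have mt1 t : tame t -> (tdeg F <= tdeg (app_endo t (app_endo a F)))%N.
  by move=> ht; rewrite -app_comp; apply: mt; apply: tame_comp => //; exact: tame_aff.
have tri1 := stab_triangular N0 e1 da mt1 tphi1 fix1.
have co1 : coordinate (toK (app_endo a F)) by apply: coordinate_aut => //; exists a'.
have lm1 : locmin (app_endo a F) by apply: lmt => //; exists a => //; exact: tame_aff.
have good1 : typed (app_endo a F) -> exists2 sigma, tame sigma & good (app_endo sigma f).
  move=> ty; exists (comp_endo a s); first by apply: tame_comp => //; exact: tame_aff.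
  by rewrite app_comp; have [] := typed_spec ty.
have [h|h|h|h] := triangular_stab_types (natr_neq0K hZ) co1 lm1 tri1 nid1 fix1.
- by apply: good1; left.
- by apply: good1; right; left.
(* In the linear case one returns to [F], since [affine_minimal] is known for [F] and not for its
   image under [a]. *)
- exists s => //; have w : wle 1 1 F.
    have w1 := @wle_tdeg _ F; have := tdeg_leq h; rewrite e1 => le.
    by move=> i j /w1 le'; exact: leq_trans le.
  have t3 := linear_typeIII w am (leq_trans d2 d21) d2.
  by have [] := typed_spec (or_intror (or_intror (or_introl t3)) : typed F).
exists s => //; apply: aff_done.
rewrite (conj_inv phi0 ia) -/phi1; apply: aff_comp => //; exact: aff_comp.
Qed.

(** Both [s'] and [phi] after [s'] carry the good representative to [f] without raising the degree
    sum. Goodness makes both affine, or both triangular, and [phi] is their quotient. *)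
Lemma stab_of_reduced f phi : coordinate (toK f) -> tamely_reduced f -> (1 <= degx2 f <= degx1 f)%N ->
  tame phi -> phi <> id_endo R -> app_endo phi f = f -> aff phi \/ triangular phi.
Proof.
move=> cof red /andP[d2 d21] tphi nid fixf.
have sd : (2 <= sdeg f)%N by rewrite /sdeg -(addn1 1) leq_add // (leq_trans d2).
have [s ts gF] := good_in_orbit cof red sd tphi nid fixf.
have [s' is' ts'] := tame_inv_exists ts; have [i1 i2] := is'.
have ef : app_endo s' (app_endo s f) = f by exact: app_inv.
have ef' : app_endo (comp_endo phi s') (app_endo s f) = f by rewrite app_comp ef.
have tps : tame (comp_endo phi s') by exact: tame_comp.
have ephi : phi = comp_endo (comp_endo phi s') s by rewrite -comp_endoA i2 comp_endo_id.
have le := (proj2 red) _ ts.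
case: gF => [[k g]|[n [d g]]].
  left; have [e1 e2] := goodA_deg g; rewrite e1 e2 addnn -mul2n in le.
  have [h|] := goodA_tame g ts'; last by rewrite ef /sdeg ltnNge le.
  have [h'|] := goodA_tame g tps; last by rewrite ef' /sdeg ltnNge le.
  have [s1 i1' h1] := aff_inv h.
  by rewrite ephi; apply: aff_comp => //; rewrite (is_inv_uniq (is_inv_sym is') i1').
right; have [e1 e2] := goodB_deg g; rewrite e1 e2 [(d * n + n)%N]addnC in le.
have [_] := goodB_tame g ts'; rewrite ef => /(_ le d21) h.
have [_] := goodB_tame g tps; rewrite ef' => /(_ le d21) h'.
have [s1 i1' h1] := triangular_inv h.
by rewrite ephi; apply: triangular_comp => //; rewrite (is_inv_uniq (is_inv_sym is') i1').
Qed.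

End Assembly.

Theorem theorem4p1p3 (R : idomainType)
  (hZ : injective (fun z : int => (z%:~R : R)))
  (f : P2 R) (hcoord : coordinate (toK f)) :
  (typeI f \/ typeII f \/ typeIII f \/ typeIV f \/ typeV f) <->
  [/\ H_nontrivial f, tamely_reduced f & (1 <= degx2 f <= degx1 f)%N].
Proof.
split=> [/(typed_spec hZ) [hH gf]|[[phi [tphi [fixf nid]]] red dg]].
  by split=> //; [exact: good_reduced | exact: good_degrees].
apply: (stab_typed hZ hcoord _ _ dg _ nid fixf).
- exact: reduced_locmin.
- exact: reduced_affine_minimal.
exact: (stab_of_reduced hZ hcoord red dg tphi nid fixf).
Qed.
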